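(* Fork representability of a ternary relation on a finite ground set can be tested in polynomial time: there is an algorithm that, given a finite set $N$ and a ternary relation $\mathfrak r\subseteq N^3$, decides in time polynomial in $|N|$ whether $\mathfrak r$ is fork representable.
   Context: In a probability space $(\Omega,\mathcal F,P)$, an ordered triple $(A,B,C)$ of events is a conjunctive fork, written $(A,B,C)_P$, if $0<P(B)<1$ and, with $AC:=A\cap C$ and $\overline B:=\Omega\setminus B$: $P(AC|B)=P(A|B)P(C|B)$, $P(AC|\overline B)=P(A|\overline B)P(C|\overline B)$, $P(A|B)>P(A|\overline B)$, and $P(C|B)>P(C|\overline B)$. A ternary relation $\mathfrak r\subseteq N^3$ is fork representable if there exist a probability space $(\Omega,\mathcal F,P)$ and events $A_i\in\mathcal F$ ($i\in N$; not required to be distinct) such that $\mathfrak r=\{(i,j,k)\in N^3 : (A_i,A_j,A_k)_P\}$. The input relation is given explicitly (as the list of its triples). *)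

(* Defs.v *)
From HB Require Import structures.
From mathcomp Require Import all_boot all_order all_algebra.
From mathcomp Require Import all_classical all_reals all_analysis.

Set Implicit Arguments.
Unset Strict Implicit.
Unset Printing Implicit Defensive.

Import Order.TTheory GRing.Theory Num.Theory.

Local Open Scope classical_set_scope.
Local Open Scope ring_scope.

Section ConjunctiveForks.
Context {d : measure_display} {T : measurableType d} {R : realType}.
Variable P : probability T R.

(* As a quotient of reals, this is the conditional probability of E given F
   only when F has positive probability; conjunctive_fork conditions on B and
   on its complement, under the assumption 0 < P(B) < 1. *)
Definition cond_prob (E F : set T) : R := fine (P (E `&` F)) / fine (P F).

Definition conjunctive_fork (A B C : set T) : Prop :=
  [/\ 0 < fine (P B) < 1,
      cond_prob (A `&` C) B = cond_prob A B * cond_prob C B,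
      cond_prob (A `&` C) (~` B) = cond_prob A (~` B) * cond_prob C (~` B),
      cond_prob A B > cond_prob A (~` B) &
      cond_prob C B > cond_prob C (~` B)].

End ConjunctiveForks.

Definition fork_representable (R : realType) (N : finType)
    (r : {set N * N * N}) : Prop :=
  exists (d : measure_display) (T : measurableType d) (P : probability T R)
         (A : N -> set T),
    (forall i, measurable (A i)) /\
    (forall i j k, (i, j, k) \in r <-> conjunctive_fork P (A i) (A j) (A k)).

(* A tape, infinite in both directions: left lists the cells to the left of the
   head, nearest first; right lists the scanned cell and the cells to its
   right. All cells beyond the two lists are blank, a blank being None. *)
Record tape (G : Type) :=
  Tape { tape_left : seq (option G); tape_right : seq (option G) }.

Inductive move := MoveLeft | Stay | MoveRight.

Section Tapes.
Variable G : Type.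
Implicit Types (t : tape G) (a : option G).

Definition tape_read t : option G := head None (tape_right t).

Definition tape_write a t : tape G :=
  Tape (tape_left t) (a :: behead (tape_right t)).

Definition tape_move (m : move) t : tape G :=
  match m with
  | MoveLeft =>
      Tape (behead (tape_left t)) (head None (tape_left t) :: tape_right t)
  | Stay => t
  | MoveRight =>
      Tape (head None (tape_right t) :: tape_left t) (behead (tape_right t))
  end.

End Tapes.

(* Deterministic Turing machines with tm_tapes.+1 tapes and input alphabet
   bool. A cell holds the blank None, an input letter Some (inl b), or an
   auxiliary letter Some (inr g). A state q is halting, with answer b, when
   tm_halt q = Some b. *)
Record turing_machine := TuringMachine {
  tm_state : finType;
  tm_aux : finType;
  tm_tapes : nat;
  tm_start : tm_state;
  tm_halt : tm_state -> option bool;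
  tm_trans : tm_state -> {ffun 'I_tm_tapes.+1 -> option (bool + tm_aux)} ->
    tm_state * {ffun 'I_tm_tapes.+1 -> option (bool + tm_aux) * move}
}.

Section Runs.
Variable M : turing_machine.

Definition tm_letter : Type := (bool + tm_aux M)%type.

Definition tm_config : Type :=
  (tm_state M * {ffun 'I_(tm_tapes M).+1 -> tape tm_letter})%type.

Definition tm_step (c : tm_config) : tm_config :=
  if tm_halt c.1 is Some _ then c else
  let: (q, act) :=
    tm_trans c.1 [ffun i => tape_read (c.2 i) : option (bool + tm_aux M)] in
  (q, [ffun i => tape_move (act i).2 (tape_write (act i).1 (c.2 i))]).

(* The input is written on tape ord0, with the head on its first letter. *)
Definition tm_init (w : seq bool) : tm_config :=
  (tm_start M,
   [ffun i => Tape [::] (if i == ord0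
                         then [seq Some (inl b : tm_letter) | b <- w]
                         else [::])]).

Definition decides_within (w : seq bool) (bound : nat) (Q : Prop) : Prop :=
  exists (b : bool) (t : nat),
    [/\ (t <= bound)%N,
        tm_halt (iter t tm_step (tm_init w)).1 = Some b &
        b <-> Q].

End Runs.

Definition encode_nat (n : nat) : seq bool := rcons (nseq n true) false.

(* The ground set N is presented as {0, ..., #|N| - 1} through enum_rank. The
   code is the number #|N| followed by the listed triples, every number being
   in unary and terminated by false. For a duplicate-free list its length is
   O(#|N|^4). *)
Definition encode_relation (N : finType) (s : seq (N * N * N)) : seq bool :=
  encode_nat #|N| ++
  flatten [seq encode_nat (enum_rank t.1.1) ++ encode_nat (enum_rank t.1.2)
               ++ encode_nat (enum_rank t.2) | t <- s].

(* Main.v *)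
(* A conjunctive fork (A, B, C) has cov(A, B), cov(B, C) > 0 and
   var(B) cov(A, C) = cov(A, B) cov(B, C). So a representable relation obeys a few
   closure rules (fork_axioms), and the lengths x_ij = ln (var_i var_j / cov_ij^2),
   positive for events that are not almost surely equal, satisfy x_ij + x_jk = x_ik
   for every fork on three such events. Conversely, let the rules hold and let this
   linear system have a positive solution, without loss of generality an integral
   one. A density on sign vectors is given by its Walsh coefficients; taking
   q ^ x_ij on the pairs {i, j} with (i, i, j) in the relation, a nonzero
   coefficient on the triples that support no fork, and 0 elsewhere, realizes the
   relation by events of probability 1/2.

   It remains to decide in polynomial time whether a homogeneous system with
   coefficients in {-1, 0, 1} has a positive solution. Let Q be the orthogonal
   projection onto the solution space. Starting from y = 0, add to y a unit vector
   e_j with (Q y)_j <= 0 as long as there is one; then |Q y|^2 <= sum y. Every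
   solution x with entries in ]0, 1] has (y . x)^2 <= n (sum y), so x_j <= 1/2 once
   y_j >= 4 n^2; then x_j is doubled and y reset. By Cramer's rule some solution has
   product of entries at least (n!)^(-n), which allows at most n^3 doublings. Q is
   kept as an integral matrix over a common denominator, whose size Gram
   determinants bound.

   For the machine model, while programs over binary stacks are compiled to Turing
   machines, and the functions on tree codes they compute in polynomial time are
   closed under composition and under folds with bounded accumulator. *)
Require Import Defs.
From HB Require Import structures.
From mathcomp Require Import all_boot all_order all_algebra perm zify ring lra.

Set Implicit Arguments.
Unset Strict Implicit.
Unset Printing Implicit Defensive.

Import Order.TTheory GRing.Theory Num.Theory.

Generalizable Variables A B C D E F.

(** * While programs and Turing machines *)

(** Triples outside the relation must not become forks, which asks for inequations that a linear
    system does not express. For events of probability 1/2, a fork with middle b amounts to positive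
    correlations, a product rule and a vanishing third moment. The third moment is free and common
    to all orders of a triple, so a nonzero value destroys every accidental solution of the product
    rule. A triple that supports a fork needs the value 0, but then no second middle is possible:
    two product rules on three events would force a correlation 1. Hence equations and positivity
    are enough, and any positive solution serves. In the feasibility test, adding e_j changes y . Q
    y by 2 (Q y)_j + Q_jj, at most 1, whence |Q y|^2 <= sum y. If no such j is left, Q y is itself a
    positive solution. On the machine side the obstacle is size rather than the number of steps:
    every fold needs an a priori bound on its intermediate values, whence the Hadamard bound and the
    exact division in the projection. *)

Definition store := {ffun 'I_4 -> seq bool}.

Definition upd (s : store) (i : 'I_4) (x : seq bool) : store :=
  [ffun j => if j == i then x else s j].

Inductive cmd :=
| Skip
| Push of 'I_4 & bool
| Pop of 'I_4
| Seq of cmd & cmd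
| If of 'I_4 & (option bool -> bool) & cmd & cmd
| While of 'I_4 & (option bool -> bool) & cmd.

(** Pushes, pops and tests cost 1; jumps are free. A unit of cost pays for at most two machine
    steps, so the factor 3 of [compile_correct] is generous. *)
Inductive exec : cmd -> store -> nat -> store -> Prop :=
| ExecSkip s : exec Skip s 0 s
| ExecPush i b (s : store) : exec (Push i b) s 1 (upd s i (b :: s i))
| ExecPop i (s : store) : exec (Pop i) s 1 (upd s i (behead (s i)))
| ExecSeq c1 c2 s1 s2 s3 t1 t2 :
    exec c1 s1 t1 s2 -> exec c2 s2 t2 s3 -> exec (Seq c1 c2) s1 (t1 + t2) s3
| ExecIfT i (p : option bool -> bool) c1 c2 (s : store) s' t :
    p (ohead (s i)) -> exec c1 s t s' -> exec (If i p c1 c2) s t.+1 s'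
| ExecIfF i (p : option bool -> bool) c1 c2 (s : store) s' t :
    ~~ p (ohead (s i)) -> exec c2 s t s' -> exec (If i p c1 c2) s t.+1 s'
| ExecWhileF i (p : option bool -> bool) c (s : store) : ~~ p (ohead (s i)) -> exec (While i p c) s 1 s
| ExecWhileT i (p : option bool -> bool) c (s : store) s' s'' t t' :
    p (ohead (s i)) -> exec c s t s' -> exec (While i p c) s' t' s'' ->
    exec (While i p c) s (t + t').+1 s''.

Notation sletter := (bool + void)%type.
Notation reads := {ffun 'I_4 -> option sletter}.
Notation actions := {ffun 'I_4 -> option sletter * move}.

Definition unletter (a : option sletter) : option bool :=
  if a is Some (inl b) then Some b else None.

Definition act1 (r : reads) (i : 'I_4) (a : option sletter) (m : move) :
  actions := [ffun j => if j == i then (a, m) else (r j, Stay)].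

Definition act0 (r : reads) : actions := [ffun j => (r j, Stay)].

Definition instr := reads -> nat * actions.

(* Code placed at address a; all jump targets are absolute. *)
Fixpoint code (c : cmd) (a : nat) : seq instr :=
  match c with
  | Skip => [::]
  | Push i b => [:: (fun r : reads => (a.+1, act1 r i (r i) MoveLeft));
                    (fun r : reads => (a.+2, act1 r i (Some (inl b)) Stay))]
  | Pop i => [:: (fun r : reads => (a.+1, act1 r i None MoveRight))]
  | Seq c1 c2 => let k := code c1 a in k ++ code c2 (a + size k)
  | If i p c1 c2 =>
      let k1 := code c1 a.+1 in
      let e := (a + size k1).+2 in
      let k2 := code c2 e in
      (fun r : reads => (if p (unletter (r i)) then a.+1 else e, act0 r)) ::
      k1 ++ (fun r : reads => (e + size k2, act0 r)) :: k2
  | While i p c =>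
      let k := code c a.+1 in
      (fun r : reads => (if p (unletter (r i)) then a.+1 else (a + size k).+2, act0 r))
      :: k ++ [:: fun r : reads => (a, act0 r)]
  end.

(* rX receives the input, rD holds a stack of tree codes, rY and rT are scratch. *)
Definition rX : 'I_4 := @Ordinal 4 0 isT.
Definition rD : 'I_4 := @Ordinal 4 1 isT.
Definition rY : 'I_4 := @Ordinal 4 2 isT.
Definition rT : 'I_4 := @Ordinal 4 3 isT.

Definition final (n : nat) : instr := fun r =>
  (if unletter (r rD) == Some true then n.+1 else n.+2, act0 r).

Definition prog (c : cmd) : seq instr :=
  let k := code c 0 in rcons k (final (size k)).

(** The states 0 to n are the addresses of [prog c], the last one holding [final]; n.+1 and n.+2 are
    the accepting and the rejecting state. The argument 3 gives four tapes. *)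
Definition machine (c : cmd) : turing_machine :=
  let n := size (code c 0) in
  @TuringMachine 'I_n.+3 void 3 ord0
    (fun q => if q == n.+1 :> nat then Some true
              else if q == n.+2 :> nat then Some false else None)
    (fun q r => let: (pc, act) := nth (final 0) (prog c) q r in
                (inord pc, act)).

(** * Simulation of commands by the machine *)

Section Simulation.
Variable c : cmd.
Let M := machine c.
Let n := size (code c 0).

Definition tapes := {ffun 'I_4 -> tape sletter}.

(** Blanks may pad both sides: a pop leaves a blank on the left, and writing back the letter scanned
    on an empty tape makes a blank explicit on the right. *)
Definition holds (tp : tape sletter) (s : seq bool) : Prop :=
  exists a b, tape_left tp = nseq a None /\
              tape_right tp = [seq Some (inl x) | x <- s] ++ nseq b None.

Definition represents (T : tapes) (s : store) := forall i, holds (T i) (s i).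

Lemma read_holds tp s : holds tp s -> unletter (tape_read tp) = ohead s.
Proof. by case=> a [b [_]]; rewrite /tape_read => ->; case: s => [|x s] //=; case: b. Qed.

Lemma rewrite_holds tp s : holds tp s -> holds (tape_write (tape_read tp) tp) s.
Proof.
case=> a [b [hl hr]]; rewrite /tape_write /tape_read /=.
case: s hr => [|x s] hr; last by exists a, b; rewrite /= hr.
exists a, b.-1.+1; rewrite /= hr /=; split => //.
by case: b {hr}.
Qed.

Lemma push_holds b tp s : holds tp s ->
  let tp1 := tape_move MoveLeft (tape_write (tape_read tp) tp) in
  holds (tape_move Stay (tape_write (Some (inl b)) tp1)) (b :: s).
Proof.
move=> /rewrite_holds [a [e [hl hr]]]; rewrite /= in hl hr *.
by exists a.-1, e; rewrite /= hl hr; case: a {hl}.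
Qed.

Lemma pop_holds tp s :
  holds tp s -> holds (tape_move MoveRight (tape_write None tp)) (behead s).
Proof.
case=> a [b [hl hr]]; exists a.+1; rewrite /= hl hr.
by case: s {hr} => [|x s]; [exists b.-1; case: b|exists b].
Qed.

Definition do_acts (act : actions) (T : tapes) : tapes :=
  [ffun i => tape_move (act i).2 (tape_write (act i).1 (T i))].

Definition config := tm_config M.

Definition at_pc (pc : nat) (T : tapes) : config := ((inord pc : 'I_n.+3), T).

Definition read_all (T : tapes) : reads := [ffun i => tape_read (T i)].

Lemma step_at pc T : pc <= n ->
  tm_step (at_pc pc T) =
  let: (pc', act) := nth (final 0) (prog c) pc (read_all T) in
  at_pc pc' (do_acts act T).
Proof.
move=> lepc; rewrite /tm_step /at_pc /=.
have e : (inord pc : 'I_n.+3) = pc :> nat by rewrite inordK // ltnS; lia.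
rewrite -/n !e ltn_eqF ?ltnS // ltn_eqF; last lia.
rewrite /M /machine /=.
rewrite /read_all.
by case: (nth _ _ _ _).
Qed.

Lemma act0_represents T s :
  represents T s -> represents (do_acts (act0 (read_all T)) T) s.
Proof. by move=> H i; rewrite !ffunE /= ?ffunE; apply: rewrite_holds. Qed.

Definition reaches (pc : nat) T (t : nat) pc' T' :=
  exists2 t', t' <= t & iter t' (@tm_step M) (at_pc pc T) = at_pc pc' T'.

Lemma reaches_trans pc1 T1 t1 pc2 T2 t2 pc3 T3 t :
  reaches pc1 T1 t1 pc2 T2 -> reaches pc2 T2 t2 pc3 T3 -> t1 + t2 <= t ->
  reaches pc1 T1 t pc3 T3.
Proof.
move=> [u1 h1 e1] [u2 h2 e2] h; exists (u2 + u1); first lia.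
by rewrite iterD e1 e2.
Qed.

Lemma reaches1 pc T t pc' act : 0 < t -> pc <= n ->
  nth (final 0) (prog c) pc (read_all T) = (pc', act) ->
  reaches pc T t pc' (do_acts act T).
Proof. by move=> t0 h e; exists 1 => //=; rewrite step_at // e. Qed.

(** The induction is on the execution, because [While] re-enters its own code; the place of the
    block in the program is therefore quantified, through [pre] and [post]. *)
Lemma compile_correct d s t s' : exec d s t s' ->
  forall pre post a T, prog c = pre ++ code d a ++ post -> size pre = a ->
  size post > 0 -> represents T s ->
  exists2 T', represents T' s' & reaches a T (3 * t) (a + size (code d a)) T'.
Proof.
have sp : size (prog c) = n.+1 by rewrite size_rcons.
elim=> {d s t s'}.
- move=> s pre post a T _ _ _ H; exists T => //; exists 0 => //=.
  by rewrite addn0.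
- move=> i b s pre post a T e ea p0 H /=.
  have := sp; rewrite e !size_cat /= ea => esz.
  set T1 := do_acts (act1 (read_all T) i (read_all T i) MoveLeft) T.
  have r1 : reaches a T 1 a.+1 T1.
    apply: reaches1 => //; first lia.
    by rewrite e nth_cat ea ltnn subnn.
  have r2 : reaches a.+1 T1 1 a.+2
      (do_acts (act1 (read_all T1) i (Some (inl b)) Stay) T1).
    apply: reaches1 => //; first lia.
    by rewrite e nth_cat ea ltnNge leqnSn subSnn.
  eexists; last by rewrite addn2; apply: reaches_trans r1 r2 _.
  move=> j; rewrite !ffunE; case: (eqVneq j i) => [->|nj]; last first.
    by rewrite ?ffunE ?(negPf nj) /= ?ffunE; do 2!apply: rewrite_holds; apply: H.
  by rewrite ?ffunE ?eqxx; apply: push_holds; apply: H.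
- move=> i s pre post a T e ea p0 H /=.
  have := sp; rewrite e !size_cat /= ea => esz.
  eexists; last first.
    apply: reaches1 => //; first lia.
    by rewrite e nth_cat ea ltnn subnn addn1 /=.
  move=> j; rewrite !ffunE; case: (eqVneq j i) => [->|nj]; last first.
    by rewrite ?ffunE /=; apply: rewrite_holds; apply: H.
  by apply: pop_holds; apply: H.
- move=> c1 c2 s1 s2 s3 t1 t2 _ IH1 _ IH2 pre post a T e ea p0 H /=.
  have e1 : prog c = pre ++ code c1 a ++ (code c2 (a + size (code c1 a)) ++ post).
    by rewrite e /= -!catA.
  have [|T1 H1 R1] := IH1 _ _ _ _ e1 ea _ H; first by rewrite size_cat; lia.
  have e2 : prog c = (pre ++ code c1 a) ++ code c2 (a + size (code c1 a)) ++ post.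
    by rewrite e /= -!catA.
  have [|T2 H2 R2] := IH2 _ _ _ _ e2 _ p0 H1; first by rewrite size_cat ea.
  exists T2 => //; rewrite size_cat addnA; apply: reaches_trans R1 R2 _; lia.
- move=> i p c1 c2 s s' t hp _ IH pre post a T e ea p0 H /=.
  have := sp; rewrite e; do 3!rewrite ?size_cat /=; rewrite ea => esz.
  set k1 := code c1 a.+1 in e esz *; set k2 := code c2 _ in e esz *.
  have r1 : reaches a T 1 a.+1 (do_acts (act0 (read_all T)) T).
    apply: reaches1 => //; first lia.
    by rewrite e nth_cat ea ltnn subnn /= ffunE (read_holds (H i)) hp.
  (* [take 1] names the test instruction, which is thus moved into the prefix of the inner block. *)
  have e1 : prog c = (pre ++ take 1 (code (If i p c1 c2) a)) ++ code c1 a.+1 ++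
     ((fun r : reads => ((a + size k1).+2 + size k2, act0 r)) :: k2 ++ post).
    by rewrite e /= take0; do 4!rewrite -?catA /=.
  have [||T1 H1 R1] := IH _ _ _ _ e1 _ _ (act0_represents H) => //.
    by rewrite size_cat ea /= take0 addn1.
  exists (do_acts (act0 (read_all T1)) T1); first exact: act0_represents.
  have r3 : reaches (a.+1 + size k1) T1 1 ((a + size k1).+2 + size k2)
     (do_acts (act0 (read_all T1)) T1).
    apply: reaches1 => //; first lia.
    rewrite e1 catA nth_cat !size_cat ea /= take0 /= addn1 ltnn subnn.
    by [].
  have -> : a + (size k1 + (size k2).+1).+1 = (a + size k1).+2 + size k2 by lia.
  by apply: reaches_trans r1 (reaches_trans R1 r3 (leqnn _)) _; lia.
- move=> i p c1 c2 s s' t hp _ IH pre post a T e ea p0 H /=.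
  have := sp; rewrite e; do 3!rewrite ?size_cat /=; rewrite ea => esz.
  set k1 := code c1 a.+1 in e esz *; set k2 := code c2 _ in e esz *.
  have r1 : reaches a T 1 (a + size k1).+2 (do_acts (act0 (read_all T)) T).
    apply: reaches1 => //; first lia.
    by rewrite e nth_cat ea ltnn subnn /= ffunE (read_holds (H i)) (negPf hp).
  have e1 : prog c = (pre ++ (take 1 (code (If i p c1 c2) a) ++ k1 ++ [:: fun r : reads => ((a + size k1).+2 + size k2, act0 r)])) ++ code c2 (a + size k1).+2 ++ post.
    by rewrite e /= take0; do 4!rewrite -?catA /=.
  have [||T1 H1 R1] := IH _ _ _ _ e1 _ _ (act0_represents H) => //.
    by rewrite size_cat ea /= take0 /= size_cat /=; lia.
  exists T1 => //.
  have -> : a + (size k1 + (size k2).+1).+1 = (a + size k1).+2 + size k2 by lia.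
  by apply: reaches_trans r1 R1 _; lia.
- move=> i p d s hp pre post a T e ea p0 H /=.
  have := sp; rewrite e; do 3!rewrite ?size_cat /=; rewrite ea => esz.
  exists (do_acts (act0 (read_all T)) T); first exact: act0_represents.
  apply: reaches1 => //; first lia.
  rewrite e nth_cat ea ltnn subnn /= ffunE (read_holds (H i)) (negPf hp).
  by congr (_, _); lia.
- move=> i p d s s' s'' t t' hp _ IH1 _ IH2 pre post a T e ea p0 H /=.
  have := sp; rewrite e; do 3!rewrite ?size_cat /=; rewrite ea => esz.
  set k := code d a.+1 in e esz *.
  have r1 : reaches a T 1 a.+1 (do_acts (act0 (read_all T)) T).
    apply: reaches1 => //; first lia.
    by rewrite e nth_cat ea ltnn subnn /= ffunE (read_holds (H i)) hp.
  have e1 : prog c = (pre ++ take 1 (code (While i p d) a)) ++ code d a.+1 ++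
     ((fun r : reads => (a, act0 r)) :: post).
    by rewrite e /= take0; do 4!rewrite -?catA /=.
  have [||T1 H1 R1] := IH1 _ _ _ _ e1 _ _ (act0_represents H) => //.
    by rewrite size_cat ea /= take0 addn1.
  have r3 : reaches (a.+1 + size k) T1 1 a (do_acts (act0 (read_all T1)) T1).
    apply: reaches1 => //; first lia.
    by rewrite e1 catA nth_cat !size_cat ea /= take0 /= addn1 ltnn subnn.
  have [T2 H2 R2] := IH2 _ _ _ _ e ea p0 (act0_represents H1).
  exists T2 => //.
  have -> : a + (size k + 1).+1 = a + size (code (While i p d) a).
    by rewrite /= size_cat.
  apply: reaches_trans (reaches_trans r1 (reaches_trans R1 r3 (leqnn _)) (leqnn _)) R2 _.
  lia.
Qed.

End Simulation.

Definition st (x d y t : seq bool) : store :=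
  [ffun i : 'I_4 => nth [::] [:: x; d; y; t] i].

Theorem machine_decides c (w : seq bool) t (b : bool) d (Q : Prop) :
  exec c (st w [::] [::] [::]) t (st [::] (b :: d) [::] [::]) -> b <-> Q ->
  decides_within (machine c) w (3 * t).+1 Q.
Proof.
move=> ex hQ.
pose T : tapes := [ffun i => Tape [::] (if i == ord0
                         then [seq Some (inl b : sletter) | b <- w] else [::])].
have hT : represents T (st w [::] [::] [::]).
  move=> i; exists 0, 0; rewrite !ffunE /= cats0; split=> //.
  by case: i => -[|[|[|[]]]].
have e : prog c = [::] ++ code c 0 ++ [:: final (size (code c 0))].
  by rewrite /prog cats1.
have [T' hT' [t' le' e']] := compile_correct ex e erefl isT hT.
(* One more step is spent on [final]. *)
exists b, t'.+1; split => //.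
set n := size (code c 0) in e' *.
have hinit : tm_init (machine c) w = at_pc c 0 T.
  rewrite /tm_init /at_pc; congr pair; apply: val_inj; by rewrite /= inordK.
rewrite hinit iterS e' step_at //.
have -> : nth (final 0) (prog c) n = final n by rewrite nth_rcons ltnn eqxx.
rewrite /final /= -/n.
have := read_holds (hT' rD); rewrite !ffunE /= => ->.
by case: (b); rewrite /= inordK ?eqxx // ?gtn_eqF.
Qed.

(** A unit of cost writes at most one bit: running time bounds the size of the result, hence the
    cost of whatever runs next. *)
Lemma exec_size c s t s' i : exec c s t s' -> size (s' i) <= size (s i) + t.
Proof.
move=> H; elim: H i => {c s t s'} //=; try by move=> *; lia.
- by move=> i b s j; rewrite ffunE; case: eqP => [->|_] /=; lia.
- by move=> i s j; rewrite ffunE; case: eqP => [->|_] //=; rewrite ?size_behead; lia.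
- by move=> c1 c2 s1 s2 s3 t1 t2 _ IH1 _ IH2 j; have := IH1 j; have := IH2 j; lia.
- by move=> i p c1 c2 s s' t _ _ IH j; have := IH j; lia.
- by move=> i p c1 c2 s s' t _ _ IH j; have := IH j; lia.
- by move=> i p c s s' s'' t t' _ _ IH1 _ IH2 j; have := IH1 j; have := IH2 j; lia.
Qed.

(** * Cost-bounded runs and stack manipulation *)

Definition runs c s n s' := exists2 t, t <= n & exec c s t s'.

Lemma runsW c s n m s' : n <= m -> runs c s n s' -> runs c s m s'.
Proof. by move=> h [t ht e]; exists t => //; apply: leq_trans h. Qed.

Lemma runs_skip s : runs Skip s 0 s.
Proof. by exists 0 => //; constructor. Qed.

Lemma runs_seq c1 c2 s1 s2 s3 n1 n2 :
  runs c1 s1 n1 s2 -> runs c2 s2 n2 s3 -> runs (Seq c1 c2) s1 (n1 + n2) s3.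
Proof.
move=> [t1 h1 e1] [t2 h2 e2]; exists (t1 + t2); first exact: leq_add.
exact: ExecSeq e1 e2.
Qed.

Lemma runs_if i (p : option bool -> bool) c1 c2 (s : store) n s' :
  runs (if p (ohead (s i)) then c1 else c2) s n s' ->
  runs (If i p c1 c2) s n.+1 s'.
Proof.
by case: ifP => h [t ht e]; exists t.+1 => //; [apply: ExecIfT|apply: ExecIfF; rewrite ?h].
Qed.

Lemma runs_whileF i (p : option bool -> bool) c (s : store) :
  ~~ p (ohead (s i)) -> runs (While i p c) s 1 s.
Proof. by exists 1 => //; apply: ExecWhileF. Qed.

Lemma runs_whileT i (p : option bool -> bool) c (s : store) s' s'' n1 n2 :
  p (ohead (s i)) -> runs c s n1 s' -> runs (While i p c) s' n2 s'' ->
  runs (While i p c) s (n1 + n2).+1 s''.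
Proof.
move=> h [t1 h1 e1] [t2 h2 e2]; exists (t1 + t2).+1; first by rewrite ltnS leq_add.
exact: ExecWhileT e1 e2.
Qed.

Lemma upd_stX x d y t z : upd (st x d y t) rX z = st z d y t.
Proof. by apply/ffunP => -[[|[|[|[|i]]]] h] //; rewrite !ffunE. Qed.
Lemma upd_stD x d y t z : upd (st x d y t) rD z = st x z y t.
Proof. by apply/ffunP => -[[|[|[|[|i]]]] h] //; rewrite !ffunE. Qed.
Lemma upd_stY x d y t z : upd (st x d y t) rY z = st x d z t.
Proof. by apply/ffunP => -[[|[|[|[|i]]]] h] //; rewrite !ffunE. Qed.
Lemma upd_stT x d y t z : upd (st x d y t) rT z = st x d y z.
Proof. by apply/ffunP => -[[|[|[|[|i]]]] h] //; rewrite !ffunE. Qed.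
Definition upd_st := (upd_stX, upd_stD, upd_stY, upd_stT).

Lemma st_X x d y t : st x d y t rX = x. Proof. by rewrite ffunE. Qed.
Lemma st_D x d y t : st x d y t rD = d. Proof. by rewrite ffunE. Qed.
Lemma st_Y x d y t : st x d y t rY = y. Proof. by rewrite ffunE. Qed.
Lemma st_T x d y t : st x d y t rT = t. Proof. by rewrite ffunE. Qed.
Definition st_E := (st_X, st_D, st_Y, st_T).

Lemma runs_push i b s s' : upd s i (b :: s i) = s' -> runs (Push i b) s 1 s'.
Proof. by move=> <-; exists 1 => //; constructor. Qed.

Lemma runs_pop i s s' : upd s i (behead (s i)) = s' -> runs (Pop i) s 1 s'.
Proof. by move=> <-; exists 1 => //; constructor. Qed.

Definition is_true1 : option bool -> bool := pred1 (Some true).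

Definition pour (i : 'I_4) (f : bool -> cmd) : cmd :=
  While i isSome
    (If i is_true1 (Seq (Pop i) (f true)) (Seq (Pop i) (f false))).

(** [S y r] is the store in which [y] remains on the poured stack and [r] lists, in reverse, the
    bits already treated; an abstract [S] covers every use of the other stacks. *)
Lemma runs_pour i f k (S : seq bool -> seq bool -> store) :
  (forall y r, S y r i = y) ->
  (forall b y r, runs (f b) (upd (S (b :: y) r) i y) k (S y (b :: r))) ->
  forall y r, runs (pour i f) (S y r) ((k + 3) * size y).+1 (S [::] (rev y ++ r)).
Proof.
move=> Si Sf; elim=> [|b y IH] r.
  by rewrite muln0; apply: runs_whileF; rewrite Si.
apply: runsW; last first.
  apply: (@runs_whileT _ _ _ _ (S y (b :: r)) _ (k + 2)); first by rewrite Si.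
    rewrite addnC addSnnS; apply: runsW (leqnn _) (runs_if _).
    have -> : (if is_true1 (ohead (S (b :: y) r i)) then Seq (Pop i) (f true)
       else Seq (Pop i) (f false)) = Seq (Pop i) (f b) by rewrite Si; case: (b).
    rewrite -[k.+1]/(1 + k).
    apply: runs_seq; last exact: Sf.
    by apply: runs_pop; rewrite Si.
  by rewrite rev_cons cat_rcons; apply: IH.
by rewrite /=; lia.
Qed.

Inductive tree := Leaf | Node of tree & tree.

(* A prefix code: eat finds the end of the first code by counting the pending
   subtrees in unary on rT. *)
Fixpoint tcode t := if t is Node a b then true :: tcode a ++ tcode b else [:: false].

Definition eat (j : 'I_4) : cmd :=
  Seq (Push rT true)
   (While rT is_true1
     (If rD is_true1 (Seq (Pop rD) (Seq (Push j true) (Push rT true)))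
                     (Seq (Pop rD) (Seq (Push j false) (Pop rT))))).

Lemma runs_eat j (S : seq bool -> seq bool -> seq bool -> store) :
  (forall d y t, S d y t rD = d) -> (forall d y t, S d y t rT = t) ->
  (forall d y t, S d y t j = y) ->
  (forall d y t z, upd (S d y t) rD z = S z y t) ->
  (forall d y t z, upd (S d y t) rT z = S d y z) ->
  (forall d y t z, upd (S d y t) j z = S d z t) ->
  forall t s y, runs (eat j) (S (tcode t ++ s) y [::]) (5 * size (tcode t) + 2)
     (S s (rev (tcode t) ++ y) [::]).
Proof.
move=> SD ST SY UD UT UY t s y.
apply: runsW; last first.
  apply: runs_seq; first exact: runs_push.
  rewrite ST.
  set w := While _ _ _.
  (* In continuation form: with one more pending subtree, the loop reads one code and then goes on
     as the given run does. A [Node] then composes two instances. *)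
  suff H u n s' : forall y s, runs w (S s (rev (tcode t) ++ y) u) n s' ->
      runs w (S (tcode t ++ s) y (true :: u)) (5 * size (tcode t) + n) s'.
    by apply: H; apply: runs_whileF; rewrite ST.
  elim: t u n s' {s y} => [|t1 IH1 t2 IH2] u n s' y s /= H.
    apply: runsW; last first.
      apply: (@runs_whileT _ _ _ _ _ _ 4) H; first by rewrite ST.
      apply: runs_if; rewrite SD /=.
      do 2?[apply: (@runs_seq _ _ _ _ _ 1)].
      - by apply: runs_pop; rewrite SD UD.
      - by apply: (@runs_push j); rewrite SY UY.
      - by apply: runs_pop; rewrite ST UT.
    by lia.
  have H1 := IH2 _ _ _ (rev (tcode t1) ++ true :: y) s.
  rewrite rev_cons rev_cat cat_rcons -catA in H.
  have {}H1 := IH1 _ _ _ (true :: y) (tcode t2 ++ s) (H1 _ _ _ H).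
  rewrite -catA; apply: runsW; last first.
    apply: (@runs_whileT _ _ _ _ _ _ 4) H1; first by rewrite ST.
    apply: runs_if; rewrite SD /=.
    do 2?[apply: (@runs_seq _ _ _ _ _ 1)].
    - by apply: runs_pop; rewrite SD UD.
    - by apply: (@runs_push j); rewrite SY UY.
    - by apply: runs_push; rewrite ST UT.
  by rewrite size_cat; lia.
by lia.
Qed.

Definition pdrop := Seq (eat rX) (pour rX (fun _ => Skip)).

Lemma runs_drop t s : runs pdrop (st [::] (tcode t ++ s) [::] [::])
  (8 * size (tcode t) + 3) (st [::] s [::] [::]).
Proof.
apply: runsW; last first.
  apply: runs_seq.
    by apply: (@runs_eat rX (fun d y t => st y d [::] t)) => *; rewrite ?st_E ?upd_st.
  apply: (@runs_pour rX _ 0 (fun y _ => st y s [::] [::])) => // *; rewrite ?st_E ?upd_st //.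
  exact: runs_skip.
by rewrite cats0 size_rev; lia.
Qed.

(** [eat] leaves the code reversed on [rX]; pouring restores it on [rD] and copies it to [rY], from
    where two more pourings bring the copy over in the right order. *)
Definition pdup :=
  Seq (eat rX) (Seq (pour rX (fun b => Seq (Push rD b) (Push rY b)))
   (Seq (pour rY (Push rX)) (pour rX (Push rD)))).

Lemma runs_dup t s : runs pdup (st [::] (tcode t ++ s) [::] [::])
  (18 * size (tcode t) + 6) (st [::] (tcode t ++ tcode t ++ s) [::] [::]).
Proof.
apply: runsW; last first.
  apply: runs_seq.
    by apply: (@runs_eat rX (fun d y t => st y d [::] t)) => *; rewrite ?st_E ?upd_st.
  apply: runs_seq.
    apply: (@runs_pour rX _ 2 (fun y r => st y (r ++ s) r [::]) _ _ _ [::]) => // *; rewrite ?st_E ?upd_st //.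
    apply: (@runs_seq _ _ _ _ _ 1 1); first exact: runs_push.
    by apply: runs_push; rewrite !(upd_st, st_E).
  rewrite !cats0 revK; apply: runs_seq.
    apply: (@runs_pour rY _ 1 (fun y r => st r (tcode t ++ s) y [::]) _ _ _ [::]) => // *; rewrite ?st_E ?upd_st //.
    by apply: runs_push; rewrite ?st_E ?upd_st.
  rewrite cats0.
  have := (@runs_pour rX (Push rD) 1 (fun y r => st y (r ++ (tcode t ++ s)) [::] [::])).
  move/(_ _ _ (rev (tcode t)) [::]); rewrite cats0 /= revK; apply => [|b] y r; rewrite ?st_E ?upd_st //.
  by apply: runs_push; rewrite ?st_E ?upd_st.
by rewrite ?size_rev ?cats0 ?size_rev; lia.
Qed.

Definition pswap :=
  Seq (eat rX) (Seq (eat rY) (Seq (pour rX (Push rD)) (pour rY (Push rD)))).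

Lemma runs_swap t1 t2 s : runs pswap (st [::] (tcode t1 ++ tcode t2 ++ s) [::] [::])
  (9 * (size (tcode t1) + size (tcode t2)) + 6)
  (st [::] (tcode t2 ++ tcode t1 ++ s) [::] [::]).
Proof.
apply: runsW; last first.
  apply: runs_seq.
    by apply: (@runs_eat rX (fun d y t => st y d [::] t)) => *; rewrite ?st_E ?upd_st.
  rewrite cats0; apply: runs_seq.
    by apply: (@runs_eat rY (fun d y t => st _ d y t)) => *; rewrite ?st_E ?upd_st.
  rewrite cats0; apply: runs_seq.
    apply: (@runs_pour rX _ 1 (fun y r => st y (r ++ s) (rev (tcode t2)) [::]) _ _ _ [::]) => // *; rewrite ?st_E ?upd_st //.
    by apply: runs_push; rewrite ?st_E ?upd_st.
  rewrite cats0 revK.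
  have := (@runs_pour rY (Push rD) 1 (fun y r => st [::] (r ++ (tcode t1 ++ s)) y [::])).
  move/(_ _ _ (rev (tcode t2)) [::]); rewrite cats0 /= revK; apply => [|b] y r; rewrite ?st_E ?upd_st //.
  by apply: runs_push; rewrite ?st_E ?upd_st.
by rewrite ?size_rev ?cats0 ?size_rev; lia.
Qed.

Fixpoint pushes (s : seq bool) :=
  if s is b :: s' then Seq (pushes s') (Push rD b) else Skip.

Lemma runs_pushes s x d y t : runs (pushes s) (st x d y t) (size s) (st x (s ++ d) y t).
Proof.
elim: s => [|b s IH] /=; first exact: runs_skip.
by rewrite -addn1; apply: runs_seq IH _; apply: runs_push; rewrite ?st_E ?upd_st.
Qed.

(** * Polynomial-time functions *)

(** With a base of at least 2, raising the exponent absorbs constants and sums. *)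
Definition pbound (T : nat -> nat) := exists k, forall n, T n <= (n + 2) ^ k.

Lemma pboundW (T U : nat -> nat) : (forall n, T n <= U n) -> pbound U -> pbound T.
Proof. by move=> h [k hk]; exists k => n; apply: leq_trans (h n) (hk n). Qed.

Lemma pbound_const c : pbound (fun=> c).
Proof.
exists c => n; apply: leq_trans (ltnW (ltn_expl c (isT : 1 < 2))) _.
by apply: leq_exp2r_weak || (case: c => // c; rewrite leq_exp2r //; lia).
Qed.

Lemma pbound_id : pbound (fun n => n).
Proof. by exists 1 => n; rewrite expn1; lia. Qed.

Lemma pbound_exp2 n k l : k <= l -> (n + 2) ^ k <= (n + 2) ^ l.
Proof. by move=> h; rewrite leq_exp2l //; lia. Qed.

Lemma pbound_add T U : pbound T -> pbound U -> pbound (fun n => T n + U n).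
Proof.
move=> [k hk] [l hl]; exists (maxn k l).+1 => n; rewrite expnS.
have := pbound_exp2 n (leq_maxl k l); have := pbound_exp2 n (leq_maxr k l).
have := hk n; have := hl n; set a := (_ ^ maxn _ _).
by move=> h1 h2 h3 h4; apply: (@leq_trans (2 * a)); [lia|rewrite leq_mul2r; lia].
Qed.

Lemma pbound_mul T U : pbound T -> pbound U -> pbound (fun n => T n * U n).
Proof.
by move=> [k hk] [l hl]; exists (k + l) => n; rewrite expnD; apply: leq_mul.
Qed.

Lemma pbound_exp T k : pbound T -> pbound (fun n => T n ^ k).
Proof.
move=> h; elim: k => [|k IH]; first exact: pbound_const.
by apply: pboundW (pbound_mul h IH) => n; rewrite expnS.
Qed.

Lemma pbound_pow T k : pbound T -> pbound (fun n => (T n + 2) ^ k).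
Proof. by move=> h; apply: pbound_exp; apply: pbound_add h (pbound_const 2). Qed.

Lemma pbound_succ T : pbound T -> pbound (fun n => (T n).+1).
Proof. by move=> h; apply: pboundW (pbound_add h (pbound_const 1)) => n; lia. Qed.

Ltac pbnd := repeat first
  [ assumption | apply: pbound_const | apply: pbound_id
  | apply: pbound_add | apply: pbound_mul | apply: pbound_pow
  | apply: pbound_succ | apply: pbound_exp ].

(** No decoding is asked for, but a program has to produce exactly the tree [encode] of its value,
    which is why numbers are normalised below. *)
Class codable (A : Type) := encode : A -> tree.

Definition esize {A} {cA : codable A} (x : A) := size (tcode (encode x)).

#[export] Instance codable_unit : codable unit := fun _ => Leaf.
#[export] Instance codable_bool : codable bool :=
  fun b => if b then Node Leaf Leaf else Leaf.
#[export] Instance codable_prod A B {cA : codable A} {cB : codable B} :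
  codable (A * B) := fun p => Node (encode p.1) (encode p.2).
(** A cons has the code of a pair and begins with [true], so one bit tells it from nil. A natural
    number has the code of a list of units. *)
#[export] Instance codable_seq A {cA : codable A} : codable (seq A) :=
  foldr (fun x t => Node (encode x) t) Leaf.
#[export] Instance codable_nat : codable nat :=
  fun n => iter n (Node Leaf) Leaf.

(* ssreflect's [have := t] would leave the codable instances in t unresolved. *)
Ltac use t := generalize t.

Section Computes.
Context {A B : Type} {cA : codable A} {cB : codable B}.

(** The rest [s] of the stack is arbitrary and preserved, so that other values can wait below the
    argument. *)
Definition computes (c : cmd) (f : A -> B) (T : nat -> nat) := forall x s,
  runs c (st [::] (tcode (encode x) ++ s) [::] [::]) (T (esize x))
         (st [::] (tcode (encode (f x)) ++ s) [::] [::]).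

Variant ptime (f : A -> B) : Prop :=
  Ptime c k of computes c f (fun n => (n + 2) ^ k).

Lemma ptimeI c f T : computes c f T -> pbound T -> ptime f.
Proof. by move=> h [k hk]; apply: (@Ptime _ c k) => x s; apply: runsW (h x s). Qed.

Lemma eq_ptime f g : f =1 g -> ptime f -> ptime g.
Proof. by move=> e [c k h]; apply: (@Ptime _ c k) => x s; rewrite -e. Qed.

Lemma computes_esize c f T x : computes c f T -> esize (f x) <= esize x + T (esize x).
Proof.
move=> /(_ x [::]) [t ht /exec_size] /(_ rD); rewrite !st_E !cats0.
by move=> h; apply: leq_trans h _; rewrite leq_add2l.
Qed.

Lemma ptime_esize f : ptime f -> exists2 T, pbound T & forall x, esize (f x) <= T (esize x).
Proof.
move=> [c k h]; exists (fun n => n + (n + 2) ^ k); first by pbnd.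
by move=> x; apply: computes_esize h.
Qed.

Lemma ptime_same_code f : (forall x, encode (f x) = encode x) -> ptime f.
Proof.
move=> h; apply: (@ptimeI Skip f (fun=> 0)); last by pbnd.
by move=> x s; rewrite h; exact: runs_skip.
Qed.

Lemma ptime_const (b : B) : ptime (fun _ : A => b).
Proof.
apply: (@ptimeI (Seq pdrop (pushes (tcode (encode b)))) _
  (fun n => 8 * n + 3 + size (tcode (encode b)))); last by pbnd.
by move=> x s; apply: runs_seq (runs_drop _ _) (runs_pushes _ _ _ _ _).
Qed.

End Computes.

Lemma esize_gt0 A {cA : codable A} (x : A) : 0 < esize x.
Proof. by rewrite /esize; case: (encode x). Qed.

Lemma esize_pair A B {cA : codable A} {cB : codable B} (x : A) (y : B) :
  esize (x, y) = (esize x + esize y).+1.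
Proof. by rewrite /esize /= size_cat. Qed.

Lemma esize_cons A {cA : codable A} (x : A) (s : seq A) :
  esize (x :: s) = (esize x + esize s).+1.
Proof. by rewrite /esize /= size_cat. Qed.

Lemma esize_nil A {cA : codable A} : @esize (seq A) _ [::] = 1.
Proof. by []. Qed.

Lemma esize_bool (b : bool) : esize b <= 3.
Proof. by case: b. Qed.

Lemma esize_nat n : esize n = (2 * n).+1.
Proof. by rewrite /esize /encode /codable_nat; elim: n => //= n; lia. Qed.

Lemma esize_cat A {cA : codable A} (s1 s2 : seq A) :
  (esize (s1 ++ s2)).+1 = esize s1 + esize s2.
Proof. by elim: s1 => //= x s1 IH; rewrite !esize_cons; lia. Qed.

Lemma esize_rev A {cA : codable A} (s : seq A) : esize (rev s) = esize s.
Proof.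
elim: s => // x s IH; rewrite rev_cons -cats1.
by use (esize_cat (rev s) [:: x]); rewrite !esize_cons esize_nil IH; lia.
Qed.

Lemma esize_drop A {cA : codable A} i (s : seq A) : esize (drop i s) <= esize s.
Proof. by use (esize_cat (take i s) (drop i s)); use (esize_gt0 (take i s)); rewrite cat_take_drop; lia. Qed.

Lemma esize_take A {cA : codable A} i (s : seq A) : esize (take i s) <= esize s.
Proof. by use (esize_cat (take i s) (drop i s)); use (esize_gt0 (drop i s)); rewrite cat_take_drop; lia. Qed.

Lemma size_esize A {cA : codable A} (s : seq A) : size s < esize s.
Proof. by elim: s => // x s IH; rewrite esize_cons /=; use (esize_gt0 x); lia. Qed.

Lemma esize_mem (A : eqType) {cA : codable A} (x : A) (s : seq A) : x \in s -> esize x < esize s.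
Proof.
elim: s => // y s IH; rewrite inE esize_cons => /orP[/eqP ->|/IH]; last lia.
by use (esize_gt0 s); lia.
Qed.

Lemma esize_seq_le (A : eqType) {cA : codable A} (s : seq A) b :
  (forall x, x \in s -> esize x <= b) -> esize s <= size s * b.+1 + 1.
Proof.
elim: s => // x s IH h; rewrite esize_cons /=.
have := h x (mem_head _ _); have := IH (fun y hy => h y (mem_behead (s := x :: s) hy)).
by lia.
Qed.

Section Closure.
Context {A B C : Type} {cA : codable A} {cB : codable B} {cC : codable C}.

Lemma ptime_id : ptime (fun x : A => x).
Proof. exact: ptime_same_code. Qed.

Lemma computes_comp c d (g : B -> C) (f : A -> B) k l :
  computes c f (fun n => (n + 2) ^ k) -> computes d g (fun n => (n + 2) ^ l) ->
  computes (Seq c d) (fun x => g (f x)) (fun n => (n + 2) ^ k + (n + (n + 2) ^ k + 2) ^ l).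
Proof.
move=> hf hg x s; apply: runs_seq (hf x s) _.
apply: runsW (hg _ s); have := computes_esize x hf; move: (esize (f x)) => u hu.
by case: l {hg} => // l; rewrite leq_exp2r // leq_add2r.
Qed.

Lemma ptime_comp (g : B -> C) (f : A -> B) : ptime g -> ptime f -> ptime (fun x => g (f x)).
Proof.
move=> [d l hg] [c k hf]; apply: ptimeI (computes_comp hf hg) _; pbnd.
Qed.

(** The argument is duplicated and each copy brought to the top in turn. Once both results lie on
    the stack, one pushed [true] turns their codes into that of the pair. *)
Lemma ptime_pair (f : A -> B) (g : A -> C) :
  ptime f -> ptime g -> ptime (fun x => (f x, g x)).
Proof.
move=> [c k hf] [d l hg].
apply: (@ptimeI _ _ _ _ (Seq pdup (Seq c (Seq pswap (Seq d (Seq pswap (Push rD true))))))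
  _ (fun n => (18 * n + 6) + ((n + 2) ^ k + (9 * (n + (n + 2) ^ k + n) + 6 +
   ((n + 2) ^ l + (9 * (n + (n + 2) ^ k + (n + (n + 2) ^ l)) + 6 + 1)))))); last by pbnd.
move=> x s; have ef := computes_esize x hf; have eg := computes_esize x hg.
apply: runs_seq (runs_dup _ _) _; apply: runs_seq (hf _ _) _.
apply: runs_seq; first by apply: runsW (runs_swap _ _ _); rewrite /esize in ef *; lia.
apply: runs_seq (hg _ _) _.
apply: runs_seq; first by apply: runsW (runs_swap _ _ _); rewrite /esize in ef eg *; lia.
by apply: runs_push; rewrite ?upd_st ?st_E /= -catA.
Qed.

End Closure.

Section Closure1.
Context {A B C : Type} {cA : codable A} {cB : codable B} {cC : codable C}.

Lemma ptime_fst0 : ptime (fun p : B * C => p.1).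
Proof.
apply: (@ptimeI _ _ _ _ (Seq (Pop rD) (Seq pswap pdrop)) _ (fun n => 1 + (9 * n + 6 + (8 * n + 3)))); last by pbnd.
move=> x s; use (esize_pair x.1 x.2); rewrite -surjective_pairing => e.
rewrite e.
apply: runs_seq; first by apply: runs_pop.
rewrite ?upd_st ?st_E /= -catA.
apply: runs_seq; first by apply: runsW (runs_swap _ _ _); rewrite /esize; lia.
by apply: runsW (runs_drop _ _); rewrite /esize; lia.
Qed.

Lemma ptime_snd0 : ptime (fun p : B * C => p.2).
Proof.
apply: (@ptimeI _ _ _ _ (Seq (Pop rD) pdrop) _ (fun n => 1 + (8 * n + 3))); last by pbnd.
move=> x s; use (esize_pair x.1 x.2); rewrite -surjective_pairing => e.
rewrite e.
apply: runs_seq; first by apply: runs_pop.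
rewrite ?upd_st ?st_E /= -catA.
by apply: runsW (runs_drop _ _); rewrite /esize; lia.
Qed.

End Closure1.

Section Closure2.
Context {A B C : Type} {cA : codable A} {cB : codable B} {cC : codable C}.

Lemma ptime_fst (f : A -> B * C) : ptime f -> ptime (fun x => (f x).1).
Proof. exact: (ptime_comp ptime_fst0). Qed.

Lemma ptime_snd (f : A -> B * C) : ptime f -> ptime (fun x => (f x).2).
Proof. exact: (ptime_comp ptime_snd0). Qed.

Lemma ptime_if (b : A -> bool) (f g : A -> B) :
  ptime b -> ptime f -> ptime g -> ptime (fun x => if b x then f x else g x).
Proof.
move=> [c k hb] [d l hf] [e m hg].
apply: (@ptimeI _ _ _ _ (Seq pdup (Seq c (If rD is_true1
    (Seq (Seq (Pop rD) (Seq (Pop rD) (Pop rD))) d) (Seq (Pop rD) e)))) _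
  (fun n => (18 * n + 6) + ((n + 2) ^ k + (3 + (n + 2) ^ l + (n + 2) ^ m).+1))); last by pbnd.
move=> x s.
apply: runs_seq (runs_dup _ _) _; apply: runs_seq (hb _ _) _.
(* The code of [true] has three bits, that of [false] one; hence three pops or one. *)
apply: runs_if; rewrite st_E; case: (b x) => /=.
  apply: runsW; last first.
    apply: runs_seq (hf _ _).
    apply: (@runs_seq _ _ _ _ _ 1 2); first by apply: runs_pop.
    rewrite ?upd_st ?st_E.
    apply: (@runs_seq _ _ _ _ _ 1 1); first by apply: runs_pop.
    by apply: runs_pop; rewrite ?upd_st ?st_E ?upd_st.
  by lia.
apply: runsW; last first.
  apply: runs_seq (hg _ _).
  by apply: runs_pop; rewrite ?upd_st ?st_E.
by lia.
Qed.

(** As [h :: t] has the code of [(h, t)], a swap and one pushed [true] form the argument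
    [(x, (h, t))] of [g]. *)
Lemma ptime_seq_case (l : A -> seq B) (f : A -> C) (g : A -> B -> seq B -> C) :
  ptime l -> ptime f -> ptime (fun p : A * (B * seq B) => g p.1 p.2.1 p.2.2) ->
  ptime (fun x => if l x is h :: t then g x h t else f x).
Proof.
move=> [c k hl] [d i hf] [e j hg].
apply: (@ptimeI _ _ _ _ (Seq pdup (Seq c (If rD is_true1
    (Seq pswap (Seq (Push rD true) e)) (Seq (Pop rD) d)))) _
  (fun n => (18 * n + 6) + ((n + 2) ^ k + (9 * (n + (n + 2) ^ k + n) + 6 +
     (1 + (((n + (n + 2) ^ k) + n).+1 + 2) ^ j) + (n + 2) ^ i + 1).+1))); last by pbnd.
move=> x s; have el0 := computes_esize x hl.
apply: runs_seq (runs_dup _ _) _; apply: runs_seq (hl _ _) _.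
apply: runs_if; rewrite st_E.
move: el0; set n := esize x; case E: (l x) => [|h t] /= el.
  apply: runsW; last first.
    apply: runs_seq (hf _ _).
    by apply: runs_pop; rewrite ?upd_st ?st_E.
  by rewrite -/n; lia.
apply: (@runsW _ _ (9 * (n + (n + 2) ^ k + n) + 6 + (1 + ((n + (n + 2) ^ k + n).+1 + 2) ^ j))); first by lia.
use (runs_swap (encode (h :: t)) (encode x) s); rewrite /= => hs.
apply: runs_seq; first by apply: runsW hs; move: el; rewrite /n /esize /=; lia.
apply: runs_seq; first by apply: runs_push.
rewrite ?upd_st ?st_E.
have := hg (x, (h, t)) s; rewrite /= -!catA /= -!catA; apply: runsW.
rewrite -/n in el *.
have -> : esize (x, (h, t)) = (n + esize (h :: t)).+1 by rewrite esize_pair.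
by case: (j) => // j'; rewrite leq_exp2r //; lia.
Qed.

End Closure2.

(** The unread list lies above the pair of [e] and the accumulator: one pushed [true] joins them
    into the argument of the body, one pop takes its result apart, and the first bit of the list
    controls the loop. The bound [q] on every prefix prevents the polynomial bounds of the rounds
    from being composed. *)
Lemma ptime_foldl (E A S : Type) {cE : codable E} {cA : codable A} {cS : codable S}
   (f : E -> S -> A -> S) (x : E -> S) (l : E -> seq A) (q : nat -> nat) :
  ptime (fun p : E * S * A => f p.1.1 p.1.2 p.2) -> ptime x -> ptime l ->
  pbound q ->
  (forall e i, esize (foldl (f e) (x e) (take i (l e))) <= q (esize e)) ->
  ptime (fun e => foldl (f e) (x e) (l e)).
Proof.
move=> hf hx hl hq hs.
have [Tl pl el] := ptime_esize hl.
assert (hb : ptime (fun w : (A * seq A) * (E * S) => (w.1.2, (w.2.1, f w.2.1 w.2.2 w.1.1)))).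
  apply: ptime_pair; first by apply/ptime_snd/ptime_fst/ptime_id.
  apply: ptime_pair; first by apply/ptime_fst/ptime_snd/ptime_id.
  apply: (ptime_comp (f := fun w => (w.2, w.1.1)) hf).
  apply: ptime_pair; first by apply/ptime_snd/ptime_id.
  by apply/ptime_fst/ptime_fst/ptime_id.
assert (hi : ptime (fun e => (l e, (e, x e)))).
  by apply: ptime_pair => //; apply: ptime_pair => //; apply: ptime_id.
case: hb => d k hb.
pose w := While rD is_true1 (Seq (Push rD true) (Seq d (Pop rD))).
enough (hw : ptime (fun e => (e, foldl (f e) (x e) (l e)))) by exact: ptime_snd hw.
case: hi => c j hi.
apply: (@ptimeI _ _ _ _ (Seq c (Seq (Pop rD) (Seq w (Pop rD)))) _
  (fun n => (n + 2) ^ j + (1 + (Tl n * ((Tl n + (n + q n) + 2 + 2) ^ k + 3) + 1 + 1)))); last by pbnd.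
move=> e s; apply: runs_seq (hi _ _) _.
apply: runs_seq; first exact: runs_pop.
rewrite ?upd_st ?st_E /=.
apply: runs_seq; last first.
  by apply: (@runs_pop rD (st [::] ([:: false] ++ tcode (encode (e, foldl (f e) (x e) (l e))) ++ s) [::] [::])); rewrite ?upd_st ?st_E.
set n := esize e.
have hsz : size (l e) <= Tl n by use (size_esize (l e)); have := el e; rewrite -/n; lia.
assert (H : forall l1 l2, l e = l1 ++ l2 ->
  runs w (st [::] (tcode (encode l2) ++ tcode (encode (e, foldl (f e) (x e) l1)) ++ s) [::] [::])
     (size l2 * ((Tl n + (n + q n) + 2 + 2) ^ k + 3) + 1)
     (st [::] ([:: false] ++ tcode (encode (e, foldl (f e) (x e) (l e))) ++ s) [::] [::])); last first.
  have := H [::] (l e) erefl; rewrite /= -!catA /= -?catA.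
  by apply: runsW; rewrite leq_add2r leq_mul2r hsz orbT.
move=> l1 l2; elim: l2 l1 => [|a l2 IH] l1 ell.
  by rewrite ell cats0 mul0n; apply: runs_whileF; rewrite st_E.
rewrite /= mulSn.
set T := ((_ + _) ^ k).
apply: (@runsW _ _ ((1 + (T + 1)) + (size l2 * (T + 3) + 1)).+1); first by lia.
apply: runs_whileT; [by rewrite st_E| |by apply: (IH (rcons l1 a)); rewrite cat_rcons].
apply: runs_seq; first exact: runs_push.
rewrite ?upd_st ?st_E.
apply: runs_seq.
  have := hb ((a, l2), (e, foldl (f e) (x e) l1)) s.
  rewrite /= -!catA /= -!catA; apply: runsW; rewrite /T.
  have -> : esize ((a, l2), (e, foldl (f e) (x e) l1)) =
    (esize (a :: l2) + (n + esize (foldl (f e) (x e) l1)).+1).+1 by rewrite !esize_pair esize_cons.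
  have h1 : esize (a :: l2) <= Tl n.
    apply: leq_trans (el e); rewrite ell.
    by use (esize_cat l1 (a :: l2)); use (esize_gt0 l1); lia.
  have h2 : esize (foldl (f e) (x e) l1) <= q n.
    have -> : l1 = take (size l1) (l e) by rewrite ell take_size_cat.
    exact: hs.
  by case: (k) => // k'; rewrite leq_exp2r //; lia.
by apply: runs_pop; rewrite ?upd_st ?st_E /= -!catA foldl_rcons.
Qed.

(* Polynomial time is proved by resolution on the shape of a function. Functions to be computed are
   therefore written with constants that have a lemma in [pt]. *)
Create HintDb pt.
#[export] Hint Resolve ptime_id ptime_const ptime_pair ptime_fst ptime_snd ptime_if : pt.
Ltac pt := unshelve (typeclasses eauto with pt typeclass_instances nocore); exact _.

Lemma ptime_comp2 `{codable E, codable A, codable B, codable C}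
    (f : A -> B -> C) (a : E -> A) (b : E -> B) :
  ptime (fun p : A * B => f p.1 p.2) -> ptime a -> ptime b ->
  ptime (fun e => f (a e) (b e)).
Proof.
move=> hf ha hb; apply: (ptime_comp (f := fun e => (a e, b e)) hf); pt.
Qed.

(* Composition as a plain hint would apply to every goal; here it only serves functions that a
   hypothesis declares polynomial. *)
#[export] Hint Extern 5 (ptime _) =>
  match goal with
  | h : ptime ?f |- ptime (fun e => ?f (@?g e)) => apply (ptime_comp (f := g) h)
  | h : ptime (fun p => ?f p.1 p.2) |- ptime (fun e => ?f (@?a e) (@?b e)) =>
      apply (ptime_comp2 (f := f) (a := a) (b := b) h)
  end : pt.

Lemma ptime_esize_exp `{codable A, codable B} (f : A -> B) :
  ptime f -> exists k, forall x, esize (f x) <= (esize x + 2) ^ k.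
Proof. by move=> /ptime_esize [T [k hk] h]; exists k => x; apply: leq_trans (h x) (hk _). Qed.

Lemma leq_pow n m k : n <= m -> (n + 2) ^ k <= (m + 2) ^ k.
Proof. by case: k => // k h; rewrite leq_exp2r //; lia. Qed.

Lemma ptime_cons `{codable E, codable A} (a : E -> A) l :
  ptime a -> ptime l -> ptime (fun e => a e :: l e).
Proof.
move=> ha hl; apply: (ptime_comp (f := fun e => (a e, l e)) (g := fun p => p.1 :: p.2)); last pt.
exact: ptime_same_code.
Qed.
#[export] Hint Resolve ptime_cons : pt.

Lemma foldl_cons (A : Type) (s t : seq A) :
  foldl (fun s a => a :: s) t s = rev s ++ t.
Proof. by elim: s t => //= a s IH t; rewrite IH rev_cons cat_rcons. Qed.

Lemma ptime_rev `{codable E, codable A} (l : E -> seq A) :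
  ptime l -> ptime (fun e => rev (l e)).
Proof.
move=> hl; have [T hT eT] := ptime_esize hl.
apply: (eq_ptime (f := fun e => foldl (fun s a => a :: s) [::] (l e))).
  by move=> e; rewrite foldl_cons cats0.
apply: (ptime_foldl (f := fun _ s a => a :: s) (q := T)) => //; try pt.
move=> e i; rewrite foldl_cons cats0 esize_rev.
by apply: leq_trans (esize_take _ _) (eT e).
Qed.

Lemma ptime_cat `{codable E, codable A} (l m : E -> seq A) :
  ptime l -> ptime m -> ptime (fun e => l e ++ m e).
Proof.
move=> hl hm; have hr := ptime_rev hl.
have [T hT eT] := ptime_esize hr; have [U hU eU] := ptime_esize hm.
apply: (eq_ptime (f := fun e => foldl (fun s a => a :: s) (m e) (rev (l e)))).
  by move=> e; rewrite foldl_cons revK.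
apply: (ptime_foldl (f := fun _ s a => a :: s) (q := fun n => T n + U n)) => //; try pt.
  by pbnd.
move=> e i; rewrite foldl_cons.
use (esize_cat (rev (take i (rev (l e)))) (m e)); rewrite esize_rev.
use (esize_take i (rev (l e))).
by have := eT e; have := eU e; lia.
Qed.
#[export] Hint Resolve ptime_rev ptime_cat : pt.

Lemma ptime_foldl_small `{codable E, codable A, codable F} b
   (f : E -> F -> A -> F) (x : E -> F) l :
  ptime (fun p : E * F * A => f p.1.1 p.1.2 p.2) -> ptime x -> ptime l ->
  (forall s : F, esize s <= b) -> ptime (fun e => foldl (f e) (x e) (l e)).
Proof.
move=> hf hx hl hb; apply: (ptime_foldl (q := fun=> b)) => //; pbnd.
Qed.

Lemma ptime_all `{codable E, codable A} (p : E -> A -> bool) l :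
  ptime (fun q : E * A => p q.1 q.2) -> ptime l -> ptime (fun e => all (p e) (l e)).
Proof.
move=> hp hl.
apply: (eq_ptime (f := fun e => foldl (fun b a => if b then p e a else false) true (l e))).
  move=> e; transitivity (true && all (p e) (l e)) => //; move: true.
  by elim: (l e) => [|a s IH] b /=; [case: b|rewrite IH; case: b].
apply: (ptime_foldl_small (b := 3) (f := fun e b a => if b then p e a else false)) => //; try pt; exact: esize_bool.
Qed.

Lemma ptime_has `{codable E, codable A} (p : E -> A -> bool) l :
  ptime (fun q : E * A => p q.1 q.2) -> ptime l -> ptime (fun e => has (p e) (l e)).
Proof.
move=> hp hl.
apply: (eq_ptime (f := fun e => foldl (fun b a => if b then true else p e a) false (l e))).
  move=> e; transitivity (false || has (p e) (l e)) => //; move: false.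
  by elim: (l e) => [|a s IH] b /=; [case: b|rewrite IH; case: b].
apply: (ptime_foldl_small (b := 3) (f := fun e b a => if b then true else p e a)) => //; try pt; exact: esize_bool.
Qed.

Lemma ptime_map `{codable E, codable A, codable B} (f : E -> A -> B) l :
  ptime (fun q : E * A => f q.1 q.2) -> ptime l -> ptime (fun e => map (f e) (l e)).
Proof.
move=> hf hl; have [k hk] := ptime_esize_exp hf; have [T hT eT] := ptime_esize hl.
have E1 e (s : seq A) (t : seq B) : foldl (fun t a => f e a :: t) t s = rev (map (f e) s) ++ t.
  by elim: s t => //= a s IH t; rewrite IH rev_cons cat_rcons.
apply: (eq_ptime (f := fun e => rev (foldl (fun t a => f e a :: t) [::] (l e)))).
  by move=> e; rewrite E1 cats0 revK.
apply: ptime_rev.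
apply: (ptime_foldl (f := fun e t a => f e a :: t)
  (q := fun n => T n * ((n + T n).+1 + 2) ^ k.+1 + T n + 1)) => //; try pt.
  by pbnd.
move=> e i; rewrite E1 cats0 esize_rev.
set s := take i (l e).
have hs : esize s <= T (esize e) by apply: leq_trans (esize_take _ _) (eT e).
apply: (@leq_trans (esize s * (((esize e + T (esize e)).+1 + 2) ^ k.+1) + esize s + 1)).
  2: by rewrite leq_add2r; apply: leq_add => //; apply: leq_mul.
elim: s hs => [|a s IH]; first by rewrite /= !esize_nil; lia.
rewrite /= !esize_cons => hs.
have {IH} := IH ltac:(lia); set P := _ ^ k.+1.
have h1 : esize (f e a) <= P.
  apply: leq_trans (hk (e, a)) _; rewrite esize_pair /P expnS.
  by apply: leq_trans (leq_pmull _ _) => //; apply: leq_pow; lia.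
by use (esize_gt0 a); nia.
Qed.
#[export] Hint Resolve ptime_all ptime_has ptime_map : pt.

Lemma ptime_negb `{codable E} (b : E -> bool) : ptime b -> ptime (fun e => ~~ b e).
Proof. by move=> hb; apply: (eq_ptime (f := fun e => if b e then false else true)) => [e|]; [case: (b e)|pt]. Qed.

Lemma ptime_andb `{codable E} (b c : E -> bool) :
  ptime b -> ptime c -> ptime (fun e => b e && c e).
Proof. by move=> hb hc; apply: (eq_ptime (f := fun e => if b e then c e else false)) => [e|]; [case: (b e)|pt]. Qed.

Lemma ptime_orb `{codable E} (b c : E -> bool) :
  ptime b -> ptime c -> ptime (fun e => b e || c e).
Proof. by move=> hb hc; apply: (eq_ptime (f := fun e => if b e then true else c e)) => [e|]; [case: (b e)|pt]. Qed.

Lemma ptime_implb `{codable E} (b c : E -> bool) :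
  ptime b -> ptime c -> ptime (fun e => b e ==> c e).
Proof. by move=> hb hc; apply: (eq_ptime (f := fun e => if b e then c e else true)) => [e|]; [case: (b e)|pt]. Qed.

Lemma ptime_addb `{codable E} (b c : E -> bool) :
  ptime b -> ptime c -> ptime (fun e => b e (+) c e).
Proof.
move=> hb hc.
apply: (eq_ptime (f := fun e => if b e then if c e then false else true else c e)) => [e|]; last pt.
by case: (b e) (c e) => -[].
Qed.
#[export] Hint Resolve ptime_negb ptime_andb ptime_orb ptime_implb ptime_addb : pt.

(** [n.+1] has the code of [(tt, n)]. *)
Lemma ptime_succn `{codable E} (n : E -> nat) : ptime n -> ptime (fun e => (n e).+1).
Proof.
move=> hn; apply: (ptime_comp (f := fun e => (tt, n e)) (g := fun p : unit * nat => p.2.+1)); last pt.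
exact: ptime_same_code.
Qed.

Lemma ptime_behead `{codable E, codable A} (l : E -> seq A) :
  ptime l -> ptime (fun e => behead (l e)).
Proof.
move=> hl; apply: (eq_ptime (f := fun e => if l e is h :: t then t else [::])).
  by move=> e; case: (l e).
by apply: (ptime_seq_case (l := l) (f := fun _ => [::]) (g := fun _ _ t => t)) => //; pt.
Qed.

Lemma ptime_head `{codable E, codable A} (d : E -> A) (l : E -> seq A) :
  ptime d -> ptime l -> ptime (fun e => head (d e) (l e)).
Proof.
move=> hd hl; apply: (eq_ptime (f := fun e => if l e is h :: t then h else d e)).
  by move=> e; case: (l e).
by apply: (ptime_seq_case (l := l) (f := d) (g := fun _ h _ => h)) => //; pt.
Qed.

Lemma ptime_nilp `{codable E, codable A} (l : E -> seq A) :
  ptime l -> ptime (fun e => nilp (l e)).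
Proof.
move=> hl; apply: (eq_ptime (f := fun e => if l e is h :: t then false else true)).
  by move=> e; case: (l e).
by apply: (ptime_seq_case (l := l) (f := fun _ => true) (g := fun _ _ _ => false)) => //; pt.
Qed.

Lemma ptime_size `{codable E, codable A} (l : E -> seq A) :
  ptime l -> ptime (fun e => size (l e)).
Proof.
move=> hl; have [T hT eT] := ptime_esize hl.
have es (s : seq A) n : foldl (fun n _ => n.+1) n s = n + size s.
  by elim: s n => [|a s IH] n /=; rewrite ?addn0 ?IH ?addSnnS.
apply: (eq_ptime (f := fun e => foldl (fun n _ => n.+1) 0 (l e))).
  by move=> e; rewrite es.
apply: (ptime_foldl (f := fun e n _ => n.+1) (q := fun n => (2 * T n).+1)) => //.
- apply: ptime_succn; pt.
- pt.
- by pbnd.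
- move=> e i; rewrite es esize_nat ltnS leq_mul2l /= add0n.
  use (size_esize (take i (l e))); use (esize_take i (l e)).
  by have := eT e; lia.
Qed.
#[export] Hint Resolve ptime_succn ptime_behead ptime_head ptime_nilp ptime_size : pt.

(** [n] and [nseq n tt] have the same code, which turns unary numbers into loop counters. *)
Lemma ptime_units `{codable E} (n : E -> nat) :
  ptime n -> ptime (fun e => nseq (n e) tt).
Proof.
move=> hn; apply: (ptime_comp (f := n) (g := fun n => nseq n tt)) => //.
by apply: ptime_same_code => m; rewrite /encode; elim: m => //= m ->.
Qed.
#[export] Hint Resolve ptime_units : pt.

Lemma ptime_nseq `{codable E, codable A} (n : E -> nat) (a : E -> A) :
  ptime n -> ptime a -> ptime (fun e => nseq (n e) (a e)).
Proof.
move=> hn ha; apply: (eq_ptime (f := fun e => map (fun _ => a e) (nseq (n e) tt))).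
  by move=> e; rewrite map_nseq.
by pt.
Qed.

Lemma ptime_predn `{codable E} (n : E -> nat) : ptime n -> ptime (fun e => (n e).-1).
Proof.
move=> hn; apply: (eq_ptime (f := fun e => size (behead (nseq (n e) tt)))).
  by move=> e; rewrite size_behead size_nseq.
by pt.
Qed.

Lemma ptime_addn `{codable E} (m n : E -> nat) :
  ptime m -> ptime n -> ptime (fun e => m e + n e).
Proof.
move=> hm hn; apply: (eq_ptime (f := fun e => size (nseq (m e) tt ++ nseq (n e) tt))).
  by move=> e; rewrite size_cat !size_nseq.
by pt.
Qed.
#[export] Hint Resolve ptime_nseq ptime_predn ptime_addn : pt.

Lemma ptime_iter `{codable E, codable F} (n : E -> nat) (f : E -> F -> F)
    (x : E -> F) (q : nat -> nat) :
  ptime (fun p : E * F => f p.1 p.2) -> ptime n -> ptime x -> pbound q ->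
  (forall e i, i <= n e -> esize (iter i (f e) (x e)) <= q (esize e)) ->
  ptime (fun e => iter (n e) (f e) (x e)).
Proof.
move=> hf hn hx hq hs.
have ei e k : foldl (fun s _ => f e s) (x e) (nseq k tt) = iter k (f e) (x e).
  elim: k => // k IH; rewrite -addn1 nseqD foldl_cat IH /=.
  by rewrite addn1.
apply: (eq_ptime (f := fun e => foldl (fun s _ => f e s) (x e) (nseq (n e) tt))); first by move=> e; rewrite ei.
apply: (ptime_foldl (f := fun e s _ => f e s) (q := q)) => //; try pt.
move=> e i; set k := minn i (n e).
have -> : take i (nseq (n e) tt) = nseq k tt.
  by apply: (@eq_from_nth _ tt) => [|j _]; [rewrite size_take_min !size_nseq|case: nth; case: nth].
by rewrite ei; apply: hs; apply: geq_minr.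
Qed.

Lemma ptime_muln `{codable E} (m n : E -> nat) :
  ptime m -> ptime n -> ptime (fun e => m e * n e).
Proof.
move=> hm hn; have [T hT eT] := ptime_esize hm; have [U hU eU] := ptime_esize hn.
apply: (eq_ptime (f := fun e => iter (m e) (addn (n e)) 0)).
  by move=> e; rewrite iter_addn_0 mulnC.
apply: (ptime_iter (f := fun e => addn (n e)) (q := fun n => 2 * (U n * T n) + 1)) => //; try pt.
- by pbnd.
- move=> e i hi; rewrite iter_addn_0 esize_nat.
  have := eT e; have := eU e; rewrite !esize_nat => h1 h2.
  by rewrite -addn1 leq_add2r leq_mul2l /=; apply: leq_mul; lia.
Qed.

Lemma ptime_subn `{codable E} (m n : E -> nat) :
  ptime m -> ptime n -> ptime (fun e => m e - n e).
Proof.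
move=> hm hn; have [T hT eT] := ptime_esize hm.
have ei k j : iter j predn k = k - j by elim: j => [|j IH] /=; lia.
apply: (eq_ptime (f := fun e => iter (n e) predn (m e))) => [e|]; first by rewrite ei.
apply: (ptime_iter (f := fun e => predn) (q := T)) => //; try pt.
by move=> e i _; rewrite ei esize_nat; have := eT e; rewrite esize_nat; lia.
Qed.
#[export] Hint Resolve ptime_muln ptime_subn : pt.

Lemma ptime_leq `{codable E} (m n : E -> nat) :
  ptime m -> ptime n -> ptime (fun e => m e <= n e).
Proof.
move=> hm hn; apply: (eq_ptime (f := fun e => nilp (nseq (m e - n e) tt))); last pt.
by move=> e; rewrite /nilp size_nseq.
Qed.
#[export] Hint Resolve ptime_leq : pt.

Lemma ptime_eqn `{codable E} (m n : E -> nat) :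
  ptime m -> ptime n -> ptime (fun e => m e == n e).
Proof.
move=> hm hn; apply: (eq_ptime (f := fun e => (m e <= n e) && (n e <= m e))); last pt.
by move=> e; rewrite eqn_leq.
Qed.
#[export] Hint Resolve ptime_eqn : pt.

Lemma ptime_mem `{codable E} (A : eqType) `{codable A} (x : E -> A) (l : E -> seq A) :
  ptime (fun p : E * A => p.2 == x p.1) -> ptime l -> ptime (fun e => x e \in l e).
Proof.
move=> h hl; apply: (eq_ptime (f := fun e => has (fun y => y == x e) (l e))); last pt.
by move=> e; rewrite has_pred1.
Qed.
#[export] Hint Resolve ptime_mem : pt.

Lemma ptime_drop `{codable E, codable A} (n : E -> nat) (l : E -> seq A) :
  ptime n -> ptime l -> ptime (fun e => drop (n e) (l e)).
Proof.
move=> hn hl; have [T hT eT] := ptime_esize hl.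
have ei (s : seq A) j : iter j behead s = drop j s.
  by elim: j => [|j IH]; rewrite ?drop0 // iterS IH -drop1 drop_drop.
apply: (eq_ptime (f := fun e => iter (n e) behead (l e))) => [e|]; first by rewrite ei.
apply: (ptime_iter (f := fun e => behead) (q := T)) => //; try pt.
by move=> e i _; rewrite ei; apply: leq_trans (esize_drop _ _) (eT e).
Qed.
#[export] Hint Resolve ptime_drop : pt.

Lemma ptime_nth `{codable E, codable A} (d : E -> A) (n : E -> nat) (l : E -> seq A) :
  ptime d -> ptime n -> ptime l -> ptime (fun e => nth (d e) (l e) (n e)).
Proof.
move=> hd hn hl; apply: (eq_ptime (f := fun e => head (d e) (drop (n e) (l e)))); last pt.
by move=> e; rewrite -nth0 nth_drop addn0.
Qed.

Lemma ptime_iota `{codable E} (n : E -> nat) : ptime n -> ptime (fun e => iota 0 (n e)).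
Proof.
move=> hn; have [T hT eT] := ptime_esize hn.
have ei j : iter j (fun s => s ++ [:: size s]) [::] = iota 0 j.
  elim: j => // j IH; rewrite iterS IH size_iota.
  by have := iotaD 0 j 1; rewrite addn1 => ->.
apply: (eq_ptime (f := fun e => iter (n e) (fun s => s ++ [:: size s]) [::])) => [e|]; first by rewrite ei.
apply: (ptime_iter (f := fun e s => s ++ [:: size s]) (q := fun n => T n * (2 * T n + 2) + 1)) => //; try pt.
- by pbnd.
- move=> e i hi; rewrite ei.
  have := eT e; rewrite esize_nat => h.
  apply: leq_trans (@esize_seq_le _ _ _ (2 * T (esize e) + 1) _) _.
    by move=> x; rewrite mem_iota esize_nat; lia.
  by rewrite size_iota; nia.
Qed.
#[export] Hint Resolve ptime_nth ptime_iota : pt.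

Lemma ptime_flatten `{codable E, codable A} (l : E -> seq (seq A)) :
  ptime l -> ptime (fun e => flatten (l e)).
Proof.
move=> hl; have [T hT eT] := ptime_esize hl.
have ef (s : seq (seq A)) (t : seq A) : foldl (fun t a => t ++ a) t s = t ++ flatten s.
  by elim: s t => [|a s IH] t /=; rewrite ?cats0 // IH catA.
apply: (eq_ptime (f := fun e => foldl (fun t a => t ++ a) [::] (l e))).
  by move=> e; rewrite ef.
apply: (ptime_foldl (f := fun _ t a => t ++ a) (q := T)) => //; try pt.
move=> e i; rewrite ef /=; apply: leq_trans (eT e); apply: leq_trans (esize_take i _).
elim: (take i (l e)) => //= s ss IH.
by use (esize_cat s (flatten ss)); use (esize_cons s ss); lia.
Qed.
#[export] Hint Resolve ptime_flatten : pt.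

Lemma ptime_find `{codable E, codable A} (p : E -> A -> bool) (l : E -> seq A) :
  ptime (fun q : E * A => p q.1 q.2) -> ptime l -> ptime (fun e => find (p e) (l e)).
Proof.
move=> hp hl; have [T hT eT] := ptime_esize hl.
pose f e (s : bool * nat) a := if s.1 then s else if p e a then (true, s.2) else (s.1, s.2.+1).
have ef e (s : seq A) n : (foldl (f e) (false, n) s).2 = n + find (p e) s.
  elim: s n => [|a s IH] n /=; first by rewrite addn0.
  rewrite /f /=; case: (p e a); last by rewrite -/f IH addSnnS.
  by rewrite addn0; elim: s {IH}.
apply: (eq_ptime (f := fun e => (foldl (f e) (false, 0) (l e)).2)).
  by move=> e; rewrite ef.
apply: ptime_snd; apply: (ptime_foldl (f := f) (q := fun n => 2 * T n + 5)) => //; try pt.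
- by pbnd.
- move=> e i; set s := take i _; have := ef e s 0.
  case: (foldl _ _ _) => b n /= ->; rewrite esize_pair esize_nat.
  have := esize_bool b; have := find_size (p e) s; use (size_esize s); use (esize_take i (l e)).
  by rewrite -/s; have := eT e; lia.
Qed.
#[export] Hint Resolve ptime_find : pt.

(** * Binary arithmetic *)

(** Least significant bit first and no trailing [false], so that a number has a single code; the
    number itself is enough fuel. *)
Fixpoint bits_fuel (k n : nat) : seq bool :=
  if k is k'.+1 then if n == 0 then [::] else odd n :: bits_fuel k' n./2
  else [::].

Definition bits n := bits_fuel n n.

Definition bval (s : seq bool) := foldr (fun (b : bool) v => b + v.*2) 0 s.

Lemma bits_rec n : bits n = if n == 0 then [::] else odd n :: bits n./2.
Proof.
have fuel k l m : m <= k -> m <= l -> bits_fuel k m = bits_fuel l m.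
  elim: k l m => [|k IH] [|l] [|m] //= hk hl.
  by congr cons; apply: IH; rewrite leq_uphalf_double; lia.
rewrite /bits; case: n => // n; rewrite [in LHS]/=; congr cons; apply: fuel => //.
by rewrite leq_uphalf_double; lia.
Qed.

Lemma bits_bit (b : bool) v : (b || (v != 0)) -> bits (b + v.*2) = b :: bits v.
Proof.
move=> h; rewrite bits_rec; case: eqP => [|_]; first by case: b h => //=; lia.
by rewrite oddD odd_double addbF oddb half_bit_double.
Qed.

Lemma bitsK : cancel bits bval.
Proof.
move=> n; have [m hm] := ubnP n; elim: m n hm => // m IH n hn; rewrite bits_rec.
by case: eqP => [->//|h0] /=; rewrite IH ?odd_double_half //; lia.
Qed.

Lemma nilp_bits v : nilp (bits v) = (v == 0).
Proof. by rewrite bits_rec; case: eqP. Qed.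

(** Removes the trailing zeros that bitwise arithmetic leaves, to return to the form of [bits]. *)
Definition strip (s : seq bool) : seq bool :=
  foldr (fun b r => if b || ~~ nilp r then b :: r else [::]) [::] s.

Lemma strip_bits s : strip s = bits (bval s).
Proof.
elim: s => //= b s ->; rewrite nilp_bits; case: ifP => [h|]; first by rewrite bits_bit.
by case: b => //= /negPn/eqP ->.
Qed.

Lemma size_bits n k : (size (bits n) <= k) = (n < 2 ^ k).
Proof.
elim: k n => [|k IH] n; rewrite bits_rec; case: eqP => [->|h] //=.
- by rewrite expn0; lia.
- by rewrite expn_gt0.
- by rewrite ltnS IH expnS; lia.
Qed.

Lemma bval_lt s : bval s < 2 ^ size s.
Proof. by elim: s => //= b s IH; rewrite expnS; case: b; lia. Qed.

Lemma bval_cat s t : bval (s ++ t) = bval s + 2 ^ size s * bval t.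
Proof. by elim: s => [|b s IH] /=; rewrite ?mul1n // IH expnS; lia. Qed.

Lemma bval_rev_cons b s : bval (rev (b :: s)) = bval (rev s) + 2 ^ size s * b.
Proof. by rewrite rev_cons -cats1 bval_cat size_rev /= double0 addn0. Qed.

Lemma bval_head s : bval s = head false s + (bval (behead s)).*2.
Proof. by case: s. Qed.

Definition zeros (A : Type) (s : seq A) := map (fun _ => false) s.

Lemma bval_zeros A (s : seq A) : bval (zeros s) = 0.
Proof. by elim: s => //= a s ->. Qed.

Lemma esize_bools (s : seq bool) : 2 * size s < esize s <= 4 * size s + 1.
Proof.
by elim: s => //= b s IH; rewrite esize_cons; use (esize_gt0 b); have := esize_bool b; lia.
Qed.

(** The state holds the unread bits of the second summand, the carry, and the output in reverse. *)
Definition addstep (st : seq bool * (bool * seq bool)) (a : bool) :=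
  (behead st.1, ((a && head false st.1) || (st.2.1 && (a || head false st.1)),
    (a (+) head false st.1 (+) st.2.1) :: st.2.2)).

(** The padding by [zeros t] makes the fold long enough to read all of [t]. *)
Definition addbits (s t : seq bool) :=
  let r := foldl addstep (t, (false, [::])) (s ++ zeros t) in rev (r.2.1 :: r.2.2).

(** The carry and the unread bits count with the weight of the next position; the total never
    changes. *)
Lemma foldl_addstep l t c o :
  let r := foldl addstep (t, (c, o)) l in
  [/\ bval (rev r.2.2) + 2 ^ size r.2.2 * (r.2.1 + bval r.1) =
      bval (rev o) + 2 ^ size o * (bval l + bval t + c),
      r.1 = drop (size l) t & size r.2.2 = size o + size l].
Proof.
elim: l t c o => [|a l IH] t c o /=.
  by split; rewrite ?drop0 ?addn0 // add0n addnC [_ + c]addnC addnC.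
have [e1 e2 e3] := IH (behead t) ((a && head false t) || (c && (a || head false t)))
   ((a (+) head false t (+) c) :: o).
split.
- rewrite e1 bval_rev_cons /= expnS [bval t]bval_head; clear.
  by case: a; case: (head false t); case: c => /=; nia.
- by rewrite e2 -drop1 drop_drop addn1.
- by rewrite e3 /=; lia.
Qed.

Lemma bval_addbits s t : bval (addbits s t) = bval s + bval t.
Proof.
rewrite /addbits; have := foldl_addstep (s ++ zeros t) t false [::].
case: foldl => [t' [c' o']] /= [h ht' _]; rewrite bval_rev_cons.
rewrite ht' drop_oversize ?size_cat ?size_map ?leq_addl // in h.
by rewrite /= addn0 mul1n bval_cat bval_zeros muln0 !addn0 in h.
Qed.

Definition substep (st : seq bool * (bool * seq bool)) (a : bool) :=
  (behead st.1, ((~~ a && (head false st.1 || st.2.1)) || (head false st.1 && st.2.1),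
    (a (+) head false st.1 (+) st.2.1) :: st.2.2)).

Definition subbits (s t : seq bool) :=
  let r := foldl substep (t, (false, [::])) (s ++ zeros t) in (r.2.1, rev r.2.2).

Lemma foldl_substep l t c o :
  let r := foldl substep (t, (c, o)) l in
  [/\ bval (rev r.2.2) + 2 ^ size o * (bval t + c) =
      bval (rev o) + 2 ^ size o * bval l + 2 ^ size r.2.2 * (r.2.1 + bval r.1),
      r.1 = drop (size l) t & size r.2.2 = size o + size l].
Proof.
elim: l t c o => [|a l IH] t c o /=.
  by split; rewrite ?drop0 ?addn0 // muln0 addn0 [c + _]addnC.
have [e1 e2 e3] := IH (behead t) ((~~ a && (head false t || c)) || (head false t && c))
   ((a (+) head false t (+) c) :: o).
split.
- move: e1; rewrite bval_rev_cons /= expnS [bval t]bval_head; clear.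
  case: foldl => ? [? ?] /=.
  by case: a; case: (head false t); case: c => /=; nia.
- by rewrite e2 -drop1 drop_drop addn1.
- by rewrite e3 /=; lia.
Qed.

(** The borrow left at the end tells whether [s] is the smaller number, so subtraction also
    compares. *)
Lemma subbitsP s t :
  (subbits s t).1 = (bval s < bval t) /\
  (bval t <= bval s -> bval (subbits s t).2 = bval s - bval t).
Proof.
rewrite /subbits; have := foldl_substep (s ++ zeros t) t false [::].
case: foldl => [t' [c' o']] /= [h ht' _].
rewrite ht' drop_oversize ?size_cat ?size_map ?leq_addl // in h.
rewrite /= addn0 mul1n bval_cat bval_zeros muln0 !addn0 add0n mul1n in h.
have := bval_lt (rev o'); rewrite size_rev => h2.
by move: h; case: c' => /= h; split; nia.
Qed.

Lemma ptime_zeros `{codable E, codable A} (s : E -> seq A) : ptime s -> ptime (fun e => zeros (s e)).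
Proof. by move=> h; rewrite /zeros; pt. Qed.
#[export] Hint Resolve ptime_zeros : pt.

Lemma ptime_addbits `{codable E} (s t : E -> seq bool) :
  ptime s -> ptime t -> ptime (fun e => addbits (s e) (t e)).
Proof.
move=> hs ht; have [T hT eT] := ptime_esize hs; have [U hU eU] := ptime_esize ht.
pose r e := foldl addstep (t e, (false, [::])) (s e ++ zeros (t e)).
have hr : ptime r.
  apply: (ptime_foldl (f := fun e => addstep) (q := fun n => U n + 5 + 4 * (T n + U n) + 1)).
  - by rewrite /addstep; pt.
  - pt.
  - pt.
  - by pbnd.
  move=> e i; set l := take i _; have [_] := foldl_addstep l (t e) false [::].
  case: foldl => t' [c' o'] /= -> so; rewrite !esize_pair.
  have := esize_bools o'; rewrite so add0n; use (esize_drop (size l) (t e)).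
  have : size l <= size (s e) + size (t e).
    by rewrite size_take_min size_cat size_map; lia.
  use (size_esize (s e)); use (size_esize (t e)); have := eT e; have := eU e; have := esize_bool c'.
  by lia.
by rewrite /addbits -/(r _); have h : forall e, r e = r e by []; rewrite -/r; pt.
Qed.

Lemma ptime_subbits `{codable E} (s t : E -> seq bool) :
  ptime s -> ptime t -> ptime (fun e => subbits (s e) (t e)).
Proof.
move=> hs ht; have [T hT eT] := ptime_esize hs; have [U hU eU] := ptime_esize ht.
pose r e := foldl substep (t e, (false, [::])) (s e ++ zeros (t e)).
have hr : ptime r.
  apply: (ptime_foldl (f := fun e => substep) (q := fun n => U n + 5 + 4 * (T n + U n) + 1)).
  - by rewrite /substep; pt.
  - pt.
  - pt.
  - by pbnd.
  move=> e i; set l := take i _; have [_] := foldl_substep l (t e) false [::].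
  case: foldl => t' [c' o'] /= -> so; rewrite !esize_pair.
  have := esize_bools o'; rewrite so add0n; use (esize_drop (size l) (t e)).
  have : size l <= size (s e) + size (t e).
    by rewrite size_take_min size_cat size_map; lia.
  use (size_esize (s e)); use (size_esize (t e)); have := eT e; have := eU e; have := esize_bool c'.
  by lia.
by rewrite /subbits; pt.
Qed.

Lemma ptime_strip `{codable E} (s : E -> seq bool) : ptime s -> ptime (fun e => strip (s e)).
Proof.
move=> hs; have [T hT eT] := ptime_esize hs.
apply: (eq_ptime (f := fun e => foldl (fun r b => if b || ~~ nilp r then b :: r else [::]) [::] (rev (s e)))).
  by move=> e; rewrite foldl_rev.
apply: (ptime_foldl (f := fun e r b => if b || ~~ nilp r then b :: r else [::]) (q := fun n => 4 * T n + 1)); try pt.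
  by pbnd.
move=> e i; rewrite -[take _ _]revK foldl_rev -/(strip _) strip_bits.
set l := rev _; have := esize_bools (bits (bval l)).
have : size (bits (bval l)) <= size l by rewrite size_bits bval_lt.
have : size l <= size (s e) by rewrite size_rev size_take_min size_rev; lia.
by use (size_esize (s e)); have := eT e; lia.
Qed.
#[export] Hint Resolve ptime_addbits ptime_subbits ptime_strip : pt.

(* Natural numbers in binary; nat itself is coded in unary. *)
Inductive bin := Bin of nat.
Definition bin_nat (a : bin) := let: Bin n := a in n.
#[export] Instance codable_bin : codable bin := fun a => encode (bits (bin_nat a)).

Definition bin_of_bits (s : seq bool) := Bin (bval s).
Definition bits_of_bin (a : bin) := bits (bin_nat a).
Definition badd a b := Bin (bin_nat a + bin_nat b).
Definition bsub a b := Bin (bin_nat a - bin_nat b).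
Definition bltn a b := bin_nat a < bin_nat b.
Definition bmul a b := Bin (bin_nat a * bin_nat b).
Definition bdiv a b := Bin (bin_nat a %/ bin_nat b).

Lemma ptime_recode `{codable A, codable B, codable C} (f : A -> B) (g : A -> C) :
  (forall x, encode (g x) = encode (f x)) -> ptime f -> ptime g.
Proof. by move=> e [c k h]; apply: (@Ptime _ _ _ _ _ c k) => x s; rewrite e. Qed.

Lemma ptime_bin_of_bits `{codable E} (s : E -> seq bool) :
  ptime s -> ptime (fun e => bin_of_bits (s e)).
Proof.
move=> /ptime_strip hs; apply: ptime_recode hs => e.
by rewrite strip_bits.
Qed.

Lemma ptime_bits_of_bin `{codable E} (a : E -> bin) :
  ptime a -> ptime (fun e => bits_of_bin (a e)).
Proof. exact: ptime_recode. Qed.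
#[export] Hint Resolve ptime_bin_of_bits ptime_bits_of_bin : pt.

Lemma ptime_badd `{codable E} (a b : E -> bin) :
  ptime a -> ptime b -> ptime (fun e => badd (a e) (b e)).
Proof.
move=> ha hb; apply: (eq_ptime (f := fun e => bin_of_bits (addbits (bits_of_bin (a e)) (bits_of_bin (b e))))); last pt.
by move=> e; rewrite /bin_of_bits bval_addbits !bitsK.
Qed.

Lemma ptime_bltn `{codable E} (a b : E -> bin) :
  ptime a -> ptime b -> ptime (fun e => bltn (a e) (b e)).
Proof.
move=> ha hb; apply: (eq_ptime (f := fun e => (subbits (bits_of_bin (a e)) (bits_of_bin (b e))).1)); last pt.
by move=> e; rewrite (subbitsP _ _).1 !bitsK.
Qed.
#[export] Hint Resolve ptime_badd ptime_bltn : pt.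

Lemma ptime_bsub `{codable E} (a b : E -> bin) :
  ptime a -> ptime b -> ptime (fun e => bsub (a e) (b e)).
Proof.
move=> ha hb; apply: (eq_ptime (f := fun e => if bltn (a e) (b e) then Bin 0 else
  bin_of_bits (subbits (bits_of_bin (a e)) (bits_of_bin (b e))).2)); last pt.
move=> e; rewrite /bltn /bsub /bin_of_bits; have [h1 h2] := subbitsP (bits_of_bin (a e)) (bits_of_bin (b e)).
rewrite !bitsK in h1 h2; case: ltnP => h; last by rewrite h2.
by congr Bin; lia.
Qed.
#[export] Hint Resolve ptime_bsub : pt.

(** Horner's rule, from the most significant bit of the multiplier on. *)
Definition mulstep (a acc : bin) (b : bool) := if b then badd (badd acc acc) a else badd acc acc.

Lemma foldl_mulstep a l acc :
  bin_nat (foldl (mulstep a) acc l) = bin_nat acc * 2 ^ size l + bin_nat a * bval (rev l).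
Proof.
elim: l acc => [|b l IH] acc; first by rewrite /= muln1 muln0 addn0.
by rewrite IH bval_rev_cons /= expnS; case: b => /=; nia.
Qed.

Lemma esize_binE a : esize a = esize (bits (bin_nat a)).
Proof. by []. Qed.

Lemma esize_bin a k : bin_nat a < 2 ^ k -> esize a <= 4 * k + 1.
Proof.
rewrite -size_bits => h; have /andP[_] := esize_bools (bits (bin_nat a)).
by rewrite esize_binE; lia.
Qed.

Lemma bin_lt_esize a : bin_nat a < 2 ^ esize a.
Proof.
rewrite -size_bits; have /andP[] := esize_bools (bits (bin_nat a)).
by rewrite esize_binE; lia.
Qed.

Lemma size_bits_of_bin a : size (bits_of_bin a) <= esize a.
Proof. by rewrite size_bits bin_lt_esize. Qed.

Lemma ptime_bmul `{codable E} (a b : E -> bin) :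
  ptime a -> ptime b -> ptime (fun e => bmul (a e) (b e)).
Proof.
move=> ha hb; have [T hT eT] := ptime_esize ha; have [U hU eU] := ptime_esize hb.
apply: (eq_ptime (f := fun e => foldl (mulstep (a e)) (Bin 0) (rev (bits_of_bin (b e))))).
  move=> e; have := foldl_mulstep (a e) (rev (bits_of_bin (b e))) (Bin 0).
  by rewrite revK bitsK /bmul /=; case: foldl => n /= ->.
apply: (ptime_foldl (f := fun e => mulstep (a e)) (q := fun n => 4 * (T n + U n) + 1)); try pt.
  by pbnd.
move=> e i; apply: esize_bin; rewrite foldl_mulstep add0n.
set l := take i _.
have h1 := bin_lt_esize (a e); have h2 := bval_lt (rev l); rewrite size_rev in h2.
have h3 : size l <= esize (b e).
  rewrite size_take_min size_rev.
  by have := size_bits_of_bin (b e); lia.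
apply: (@leq_trans (2 ^ esize (a e) * 2 ^ size l)); first by nia.
by rewrite -expnD leq_exp2l //; have := eT e; have := eU e; lia.
Qed.
#[export] Hint Resolve ptime_bmul : pt.

(** Long division from the most significant bit on: the remainder stays below [d], so twice the
    remainder plus a bit contains [d] at most once. *)
Definition divstep (d : bin) (qr : bin * bin) (b : bool) :=
  let r := if b then badd (badd qr.2 qr.2) (Bin 1) else badd qr.2 qr.2 in
  if bltn r d then (badd qr.1 qr.1, r) else (badd (badd qr.1 qr.1) (Bin 1), bsub r d).

Lemma foldl_divstep d l : bin_nat d > 0 ->
  let qr := foldl (divstep d) (Bin 0, Bin 0) l in
  bval (rev l) = bin_nat qr.1 * bin_nat d + bin_nat qr.2 /\ bin_nat qr.2 < bin_nat d.
Proof.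
move=> d0; elim/last_ind: l => [|l b] //; rewrite foldl_rcons rev_rcons /=.
case: foldl => q r /= [-> hr]; rewrite /divstep /bltn /=.
set r' := if b then _ else _.
have er : bin_nat r' = b + (bin_nat r).*2 by rewrite /r'; case: (b) => /=; lia.
by case: (ltnP (bin_nat r')) => /=; rewrite er => h; split; nia.
Qed.

(** Covers the divisor 0 as well, since a fold must be bounded on every argument. *)
Lemma foldl_divstep_lt d l :
  let qr := foldl (divstep d) (Bin 0, Bin 0) l in
  bin_nat qr.1 < 2 ^ size l /\ bin_nat qr.2 < 2 ^ size l.
Proof.
elim/last_ind: l => [|l b] //; rewrite foldl_rcons size_rcons expnS /=.
case: foldl => q r /= [hq hr]; rewrite /divstep /bltn /=.
set r' := if b then _ else _.
have er : bin_nat r' = b + (bin_nat r).*2 by rewrite /r'; case: (b) => /=; lia.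
have hb : b + (bin_nat r).*2 < 2 * 2 ^ size l by case: (b); lia.
by case: (ltnP (bin_nat r')) => h /=; rewrite ?er; split; lia.
Qed.

Lemma ptime_bdiv `{codable E} (a b : E -> bin) :
  ptime a -> ptime b -> ptime (fun e => bdiv (a e) (b e)).
Proof.
move=> ha hb; have [T hT eT] := ptime_esize ha.
apply: (eq_ptime (f := fun e => if bltn (Bin 0) (b e) then
   (foldl (divstep (b e)) (Bin 0, Bin 0) (rev (bits_of_bin (a e)))).1 else Bin 0)).
  move=> e; rewrite /bltn /bdiv /=; case: ltnP => h; last first.
    by move: h; rewrite leqn0 => /eqP ->; rewrite divn0.
  have := foldl_divstep (rev (bits_of_bin (a e))) h.
  rewrite revK bitsK; case: foldl => -[q] r /= [-> hr].
  by rewrite divnMDl // divn_small // addn0.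
apply: ptime_if; try pt; apply: ptime_fst.
apply: (ptime_foldl (f := fun e => divstep (b e)) (q := fun n => 8 * (T n) + 3)); try pt.
- by pbnd.
move=> e i; set l := take i _.
have := foldl_divstep_lt (b e) l; case: foldl => q r /= [/esize_bin hq /esize_bin hr].
rewrite esize_pair.
have h3 : size l <= esize (a e).
  rewrite size_take_min size_rev.
  by have := size_bits_of_bin (a e); lia.
by have := eT e; lia.
Qed.
#[export] Hint Resolve ptime_bdiv : pt.

(** * Strictly positive solutions of homogeneous linear systems *)

Definition zpair (z : int) : bool * bin := ((z < 0)%R, Bin `|z|%N).
#[export] Instance codable_int : codable int := fun z => encode (zpair z).
Definition mkz (s : bool) (a : bin) : int :=
  if s then (- Posz (bin_nat a))%R else Posz (bin_nat a).

Lemma ptime_zpair `{codable E} (z : E -> int) : ptime z -> ptime (fun e => zpair (z e)).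
Proof. exact: ptime_recode. Qed.

(** A minus sign on zero is dropped, since zero has a single code. *)
Lemma zpair_mkz s a : zpair (mkz s a) = (s && bltn (Bin 0) a, a).
Proof. by rewrite /zpair /mkz /bltn; case: a => a /=; congr (_, Bin _); case: s; lia. Qed.

Lemma ptime_mkz `{codable E} (s : E -> bool) (a : E -> bin) :
  ptime s -> ptime a -> ptime (fun e => mkz (s e) (a e)).
Proof.
move=> hs ha; apply: (ptime_recode (f := fun e => (s e && bltn (Bin 0) (a e), a e))); last pt.
by move=> e; rewrite -zpair_mkz.
Qed.
#[export] Hint Resolve ptime_zpair ptime_mkz : pt.

(** Named copies of the ring operations, which resolution in [pt] can recognise. *)
Definition zadd (z1 z2 : int) : int := (z1 + z2)%R.
Definition zmul (z1 z2 : int) : int := (z1 * z2)%R.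
Definition zsub (z1 z2 : int) : int := (z1 - z2)%R.
Definition zle0 (z : int) : bool := (z <= 0)%R.
(* Truncated division, only used when it is exact. *)
Definition qdiv (z d : int) : int := mkz (z < 0)%R (Bin (`|z| %/ `|d|)).

Lemma qdivE (q d : int) : (0 < d)%R -> qdiv (q * d)%R d = q.
Proof.
move=> d0; rewrite /qdiv abszM mulnK; last by lia.
by rewrite pmulr_llt0 // /mkz /=; case: ltP; lia.
Qed.

Lemma ptime_zadd `{codable E} (x y : E -> int) :
  ptime x -> ptime y -> ptime (fun e => zadd (x e) (y e)).
Proof.
move=> hx hy; apply: (eq_ptime (f := fun e =>
  if (zpair (x e)).1 (+) (zpair (y e)).1 then
    if bltn (zpair (x e)).2 (zpair (y e)).2
    then mkz (zpair (y e)).1 (bsub (zpair (y e)).2 (zpair (x e)).2)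
    else mkz (zpair (x e)).1 (bsub (zpair (x e)).2 (zpair (y e)).2)
  else mkz (zpair (x e)).1 (badd (zpair (x e)).2 (zpair (y e)).2))); last pt.
move=> e; rewrite /zadd /zpair /bltn /mkz /=.
by case: (ltP (x e) 0%R); case: (ltP (y e) 0%R) => /= ? ?; try (case: (ltnP `|x e| `|y e|) => ?); lia.
Qed.

Lemma ptime_zmul `{codable E} (x y : E -> int) :
  ptime x -> ptime y -> ptime (fun e => zmul (x e) (y e)).
Proof.
move=> hx hy; apply: (eq_ptime (f := fun e =>
  mkz ((zpair (x e)).1 (+) (zpair (y e)).1) (bmul (zpair (x e)).2 (zpair (y e)).2))); last pt.
move=> e; rewrite /zmul /zpair /mkz /=.
by case: (ltP (x e) 0%R); case: (ltP (y e) 0%R) => /=; nia.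
Qed.

Lemma ptime_zsub `{codable E} (x y : E -> int) :
  ptime x -> ptime y -> ptime (fun e => zsub (x e) (y e)).
Proof.
move=> hx hy; have := ptime_zadd hx (ptime_zmul (ptime_const (-1)%R) hy).
apply: eq_ptime => e; rewrite /zadd /zmul /zsub; lia.
Qed.

Lemma ptime_zle0 `{codable E} (x : E -> int) : ptime x -> ptime (fun e => zle0 (x e)).
Proof.
move=> hx; apply: (eq_ptime (f := fun e => (zpair (x e)).1 || ~~ bltn (Bin 0) (zpair (x e)).2)); last pt.
by move=> e; rewrite /zle0 /zpair /bltn /=; lia.
Qed.

Lemma ptime_qdiv `{codable E} (x y : E -> int) :
  ptime x -> ptime y -> ptime (fun e => qdiv (x e) (y e)).
Proof.
move=> hx hy; apply: (eq_ptime (f := fun e =>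
  mkz (zpair (x e)).1 (bdiv (zpair (x e)).2 (zpair (y e)).2))); last pt.
by [].
Qed.
#[export] Hint Resolve ptime_zadd ptime_zmul ptime_zsub ptime_zle0 ptime_qdiv : pt.

Lemma int_lt_esize (z : int) : `|z| < 2 ^ esize z.
Proof.
have -> : esize z = (esize (z < 0)%R + esize (Bin `|z|)).+1 by rewrite -esize_pair.
apply: leq_trans (bin_lt_esize (Bin `|z|)) _; rewrite leq_exp2l //; lia.
Qed.

Lemma esize_int (z : int) k : `|z| < 2 ^ k -> esize z <= 4 * k + 5.
Proof.
have -> : esize z = (esize (z < 0)%R + esize (Bin `|z|)).+1 by rewrite -esize_pair.
by move=> /(@esize_bin (Bin `|z|)); have := esize_bool (z < 0)%R; lia.
Qed.

Definition zsum (l : seq int) := foldl zadd 0%R l.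

Lemma zsumE l : zsum l = (\sum_(z <- l) z)%R.
Proof.
suff h s : foldl zadd s l = (s + \sum_(z <- l) z)%R by rewrite /zsum h add0r.
elim: l s => [|z l IH] s /=; first by rewrite big_nil addr0.
by rewrite IH big_cons /zadd addrA.
Qed.

Lemma zsum_lt l : `|zsum l| < 2 ^ esize l.
Proof.
rewrite zsumE; elim: l => [|z l IH]; first by rewrite big_nil.
rewrite big_cons esize_cons; have h1 := int_lt_esize z.
have h2 : 2 ^ esize z + 2 ^ esize l <= 2 ^ (esize z + esize l).+1.
  rewrite expnS mul2n -addnn leq_add // leq_exp2l //; lia.
move: h1 h2 IH; move: (\sum_(_ <- _) _)%R (2 ^ _) (2 ^ _) (2 ^ _) => s a b c; lia.
Qed.

Lemma ptime_zsum `{codable E} (l : E -> seq int) : ptime l -> ptime (fun e => zsum (l e)).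
Proof.
move=> hl; have [T hT eT] := ptime_esize hl.
apply: (ptime_foldl (f := fun _ => zadd) (q := fun n => 4 * T n + 5)); try pt.
  by pbnd.
move=> e i; rewrite -/(zsum _); apply: esize_int; apply: leq_trans (zsum_lt _) _.
by rewrite leq_exp2l //; apply: leq_trans (esize_take _ _) (eT e).
Qed.

Lemma ptime_Posz `{codable E} (n : E -> nat) : ptime n -> ptime (fun e => Posz (n e)).
Proof.
move=> hn; apply: (eq_ptime (f := fun e => zsum (nseq (n e) 1%R))).
  by move=> e; rewrite zsumE; elim: (n e) => [|k IH]; rewrite /= ?big_nil // big_cons IH; lia.
by apply: ptime_zsum; pt.
Qed.
#[export] Hint Resolve ptime_zsum ptime_Posz : pt.

Definition dot n (u v : seq int) : int :=
  zsum [seq zmul (nth 0%R u j) (nth 0%R v j) | j <- iota 0 n].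

Definition mkmx n (F : nat -> nat -> int) : seq (seq int) :=
  [seq [seq F i j | j <- iota 0 n] | i <- iota 0 n].

Definition entry (N : seq (seq int)) i j := nth 0%R (nth [::] N i) j.

Definition matvec n (N : seq (seq int)) (v : seq int) : seq int :=
  [seq dot n (nth [::] N i) v | i <- iota 0 n].

Definition eqz (i j : nat) : int := if i == j then 1%R else 0%R.

(* The rank-one update keeping (proj n rows).1 and (proj n rows).2 equal to gram B
   and gproj B for a maximal independent B among the rows. *)
Definition proj_step n (GN : int * seq (seq int)) (a : seq int) :=
  let w := matvec n GN.2 a in
  let g := dot n a w in
  if zle0 g then GN else
  (g, mkmx n (fun i j =>
    qdiv (zsub (zmul g (entry GN.2 i j)) (zmul (nth 0%R w i) (nth 0%R w j))) GN.1)).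

Definition proj n (rows : seq (seq int)) :=
  foldl (proj_step n) (1%R, mkmx n eqz) rows.

(** At the cut all y_i are at most 4 n^2, so sum y <= 4 n^3 and (4 n^2 x_j)^2 <= n (4 n^3), which
    gives x_j <= 1/2. *)
Definition threshold n := 4 * (n * n).

(* Doubling every column but j amounts to doubling the unknown x_j. *)
Definition scale_row n j (r : seq int) :=
  [seq (if i == j then nth 0%R r i else zadd (nth 0%R r i) (nth 0%R r i)) | i <- iota 0 n].

Definition incr n j (y : seq int) := [seq zadd (nth 0%R y i) (eqz i j) | i <- iota 0 n].

(** When all entries of the projected vector are positive, [find] returns [n]; the state is then
    final, and further iterations change nothing. *)
Definition lp_step n (st : seq (seq int) * seq int) :=
  let j := find zle0 (matvec n (proj n st.1).2 st.2) in
  if n <= j then st else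
  let y := incr n j st.2 in
  if zle0 (zsub (Posz (threshold n)) (nth 0%R y j))
  then (map (scale_row n j) st.1, nseq n 0%R) else (st.1, y).

(* At most n^3 rescalings happen, each after at most n * threshold n increments. *)
Definition lp_iters n := (n * (n * n)).+1 * (n * threshold n).

Definition lp_run n rows k := iter k (lp_step n) (rows, nseq n 0%R).

Definition lp_feasible n (rows : seq (seq int)) : bool :=
  let st := lp_run n rows (lp_iters n) in
  n <= find zle0 (matvec n (proj n st.1).2 st.2).

Lemma dotE n u v : dot n u v = (\sum_(j < n) nth 0 u j * nth 0 v j)%R.
Proof. by rewrite /dot zsumE big_map -(big_mkord xpredT (fun j => nth 0 u j * nth 0 v j)%R) /index_iota subn0. Qed.

Lemma nth_mkseq_iota (A : Type) (d : A) (F : nat -> A) n i : i < n ->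
  nth d [seq F j | j <- iota 0 n] i = F i.
Proof. by move=> h; rewrite (nth_map 0) ?size_iota // nth_iota. Qed.

Lemma nth_matvec n N v i : i < n -> nth 0%R (matvec n N v) i = dot n (nth [::] N i) v.
Proof. by move=> h; rewrite nth_mkseq_iota. Qed.

Lemma entry_mkmx n F i j : i < n -> j < n -> entry (mkmx n F) i j = F i j.
Proof. by move=> hi hj; rewrite /entry nth_mkseq_iota // nth_mkseq_iota. Qed.

Lemma ptime_matvec `{codable E} (n : E -> nat) u v :
  ptime n -> ptime u -> ptime v -> ptime (fun e => matvec (n e) (u e) (v e)).
Proof. by move=> hn hu hv; rewrite /matvec; pt. Qed.
#[export] Hint Resolve ptime_matvec : pt.

Lemma ptime_eqz `{codable E} (i j : E -> nat) :
  ptime i -> ptime j -> ptime (fun e => eqz (i e) (j e)).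
Proof. by move=> hn hu; rewrite /eqz; pt. Qed.

Lemma ptime_entry `{codable E} N (i j : E -> nat) :
  ptime N -> ptime i -> ptime j -> ptime (fun e => entry (N e) (i e) (j e)).
Proof. by move=> hN hn hu; rewrite /entry; pt. Qed.

Lemma ptime_mkmx `{codable E} (n : E -> nat) (F : E -> nat -> nat -> int) :
  ptime n -> ptime (fun p : E * nat * nat => F p.1.1 p.1.2 p.2) ->
  ptime (fun e => mkmx (n e) (F e)).
Proof.
move=> hn hF; rewrite /mkmx; apply: ptime_map; last pt.
apply: (ptime_map (f := fun q j => F q.1 q.2 j)); pt.
Qed.
#[export] Hint Resolve ptime_eqz ptime_entry ptime_mkmx : pt.

Lemma ptime_proj_step `{codable E} (n : E -> nat) GN a :
  ptime n -> ptime GN -> ptime a -> ptime (fun e => proj_step (n e) (GN e) (a e)).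
Proof. by move=> hn hG ha; rewrite /proj_step; pt. Qed.

Lemma ptime_scale_row `{codable E} (n j : E -> nat) r :
  ptime n -> ptime j -> ptime r -> ptime (fun e => scale_row (n e) (j e) (r e)).
Proof. by move=> hn hG ha; rewrite /scale_row; pt. Qed.

Lemma ptime_incr `{codable E} (n j : E -> nat) r :
  ptime n -> ptime j -> ptime r -> ptime (fun e => incr (n e) (j e) (r e)).
Proof. by move=> hn hG ha; rewrite /incr; pt. Qed.
#[export] Hint Resolve ptime_proj_step ptime_scale_row ptime_incr : pt.

Lemma esize_mkmx n F B : (forall i j, i < n -> j < n -> `|F i j| < 2 ^ B) ->
  esize (mkmx n F) <= n * (n * (4 * B + 6) + 2) + 1.
Proof.
move=> h; apply: leq_trans (@esize_seq_le _ _ _ (n * (4 * B + 6) + 1) _) _.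
  move=> r /mapP[i]; rewrite mem_iota => hi ->.
  apply: leq_trans (@esize_seq_le _ _ _ (4 * B + 5) _) _.
    by move=> z /mapP[j]; rewrite mem_iota => hj ->; apply: esize_int; apply: h.
  by rewrite size_map size_iota; lia.
by rewrite size_map size_iota; lia.
Qed.

Local Open Scope ring_scope.

(** * Gram determinants and projections *)

Section GramRing.
Variables (R : comNzRingType) (n : nat).

Definition gram k (B : 'M[R]_(k, n)) : R := \det (B *m B^T).

(* det(B B^T) times the orthogonal projection onto the kernel of B. *)
Definition gproj k (B : 'M[R]_(k, n)) : 'M[R]_n :=
  (gram B)%:M - B^T *m \adj (B *m B^T) *m B.

Lemma gproj_sym k (B : 'M[R]_(k, n)) : (gproj B)^T = gproj B.
Proof.
rewrite /gproj linearB /= tr_scalar_mx !trmx_mul trmxK trmx_adj.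
by rewrite trmx_mul trmxK mulmxA.
Qed.

Lemma gproj_kill k (B : 'M[R]_(k, n)) : gproj B *m B^T = 0.
Proof.
rewrite /gproj mulmxBl -!mulmxA mul_adj_mx mul_scalar_mx -scalemx1 -scalemxAr mulmx1.
by rewrite subrr.
Qed.

Lemma gproj_fix k p (B : 'M[R]_(k, n)) (x : 'M_(n, p)) :
  B *m x = 0 -> gproj B *m x = gram B *: x.
Proof. by move=> h; rewrite /gproj mulmxBl -!mulmxA h !mulmx0 subr0 mul_scalar_mx. Qed.

Lemma gproj_idem k (B : 'M[R]_(k, n)) : gproj B *m gproj B = gram B *: gproj B.
Proof.
apply: gproj_fix; have /(congr1 trmx) := gproj_kill B.
by rewrite trmx_mul trmxK gproj_sym trmx0.
Qed.

Lemma gproj_compl k (B : 'M[R]_(k, n)) :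
  (gram B)%:M - gproj B = B^T *m \adj (B *m B^T) *m B.
Proof. by rewrite /gproj opprB addrC subrK. Qed.

Lemma gram_empty (B : 'M[R]_(0, n)) : gram B = 1.
Proof. by rewrite /gram det_mx00. Qed.

Lemma gproj_empty (B : 'M[R]_(0, n)) : gproj B = 1%:M.
Proof. by rewrite /gproj gram_empty [\adj _]thinmx0 mulmx0 mul0mx subr0. Qed.

End GramRing.

Lemma map_gram (aR rR : comNzRingType) (f : {rmorphism aR -> rR}) n k (B : 'M[aR]_(k, n)) :
  gram (map_mx f B) = f (gram B).
Proof. by rewrite /gram map_trmx -map_mxM det_map_mx. Qed.

Lemma map_gproj (aR rR : comNzRingType) (f : {rmorphism aR -> rR}) n k (B : 'M[aR]_(k, n)) :
  map_mx f (gproj B) = gproj (map_mx f B).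
Proof.
by rewrite /gproj map_gram map_mxB map_scalar_mx !map_mxM map_mx_adj map_mxM map_trmx.
Qed.

Section GramField.
Variables (F : fieldType) (n k : nat) (B : 'M[F]_(k, n)) (a : 'rV[F]_n).
Hypothesis G0 : gram B != 0.
Let N := gproj B.
Let g := (a *m N *m a^T) 0 0.

(** Block elimination: the enlarged Gram determinant is [gram B] times the Schur complement of [S],
    and this product is [g]. *)
Lemma gram_col : gram (col_mx B a) = g.
Proof.
set S := B *m B^T; set c := B *m a^T.
have uS : S \in unitmx by rewrite unitmxE unitfE.
have e1 : col_mx B a *m (col_mx B a)^T = block_mx S c c^T (a *m a^T).
  by rewrite tr_col_mx mul_col_row trmx_mul trmxK.
have symS : S^T = S by rewrite trmx_mul trmxK.
have e2 : block_mx 1%:M 0 (- (c^T *m invmx S)) 1%:M *m (col_mx B a *m (col_mx B a)^T)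
   = block_mx S c 0 (a *m a^T - c^T *m invmx S *m c).
  rewrite e1 mulmx_block !mul1mx !mul0mx !addr0 mulNmx mulmxKV // addNr.
  by rewrite mulNmx addrC.
have : \det (block_mx 1%:M 0 (- (c^T *m invmx S)) 1%:M *m (col_mx B a *m (col_mx B a)^T))
   = gram (col_mx B a) by rewrite det_mulmx det_lblock !det1 !mul1r.
rewrite e2 det_ublock => <-; rewrite det_mx11 -/(gram B).
have eadj : \adj S = gram B *: invmx S.
  by rewrite /invmx uS scalerA divff // scale1r.
have -> : g = (gram B *: (a *m a^T - c^T *m invmx S *m c)) 0 0.
  rewrite /g /N /gproj -/S eadj mulmxBr mulmxBl mul_mx_scalar -!scalemxAl scalerBr.
  congr ((_ - _ : 'M__) 0 0).
  by rewrite -!(scalemxAr, scalemxAl) /c trmx_mul trmxK -!mulmxA.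
by rewrite [RHS]mxE.
Qed.

(** The hypotheses characterise d times the orthogonal projection onto the kernel of [C]: both
    [d *: M1] and [d *: M2] equal [M1 *m M2]. *)
Lemma gproj_unique m (C : 'M[F]_(m, n)) (d : F) (M1 M2 : 'M[F]_n) (X1 X2 : 'M_(n, m)) :
  d != 0 -> M1^T = M1 -> M2^T = M2 -> M1 *m C^T = 0 -> M2 *m C^T = 0 ->
  d%:M - M1 = X1 *m C -> d%:M - M2 = X2 *m C -> M1 = M2.
Proof.
move=> d0 s1 s2 k1 k2 e1 e2.
have h (M M' : 'M[F]_n) (X : 'M_(n, m)) : M *m C^T = 0 -> M'^T = M' -> d%:M - M' = X *m C -> d *: M = M *m M'.
  move=> kM sM e; have : M *m (d%:M - M') = 0.
    have -> : d%:M - M' = (d%:M - M')^T by rewrite linearB /= tr_scalar_mx sM.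
    by rewrite e trmx_mul mulmxA kM mul0mx.
  by rewrite mulmxBr mul_mx_scalar => /eqP; rewrite subr_eq0 => /eqP.
have h1 := h _ _ _ k1 s2 e2; have h2 := h _ _ _ k2 s1 e1.
have {}h2 : d *: M2 = M1 *m M2.
  by rewrite -[M2 in LHS]s2 -linearZ /= h2 trmx_mul s1 s2.
by apply: (scalerI d0); rewrite h1 h2.
Qed.

(** A Gram-Schmidt step: [w] is [gram B] times the component of [a] orthogonal to the rows of [B],
    and the projection onto [w] is subtracted. *)
Lemma gproj_col : g != 0 ->
  gram B *: gproj (col_mx B a) = g *: N - (a *m N)^T *m (a *m N).
Proof.
move=> g0; set w := a *m N.
suff -> : gproj (col_mx B a) = (gram B)^-1 *: (g *: N - w^T *m w).
  by rewrite scalerA divff // scale1r.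
have wT : w^T = N *m a^T by rewrite trmx_mul gproj_sym.
have eg : a *m N *m a^T = g%:M by apply: mx11_scalar.
have NN : N = (gram B)%:M - B^T *m \adj (B *m B^T) *m B by [].
have wE : (gram B)^-1 *: w = a - (gram B)^-1 *: (a *m B^T *m \adj (B *m B^T)) *m B.
  rewrite /w NN mulmxBr mul_mx_scalar scalerBr scalerA mulVf // scale1r.
  by rewrite -!scalemxAl !mulmxA.
(* The two matrices given last express both complements through the rows of [B] and [a]. *)
apply: (@gproj_unique _ (col_mx B a) g _ _
  ((col_mx B a)^T *m \adj (col_mx B a *m (col_mx B a)^T))
  (row_mx ((g / gram B) *: (B^T *m \adj (B *m B^T)) - w^T *m ((gram B)^-1 *: (a *m B^T *m \adj (B *m B^T)))) w^T)) => //.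
- exact: gproj_sym.
- by rewrite linearZ linearB /= linearZ /= gproj_sym trmx_mul trmxK.
- exact: gproj_kill.
- rewrite tr_col_mx mul_mx_row -!scalemxAl mulmxBl mulmxBl -!scalemxAl.
  rewrite gproj_kill scaler0 -!mulmxA.
  rewrite gproj_kill !mulmx0 subrr [a *m (N *m a^T)]mulmxA eg mul_mx_scalar wT.
  rewrite subrr !scaler0.
  by apply: row_mx0.
- by rewrite -gram_col gproj_compl.
- rewrite mul_row_col scalerBr scalerA scalemxAr wE mulmxBr mulmxBl mulmxA.
  have -> : (g / gram B) *: (B^T *m \adj (B *m B^T)) *m B = g%:M - (g / gram B) *: N.
    rewrite -scalemxAl -gproj_compl scalerBr -[in X in X - _ = _]scalemx1 scalerA.
    by rewrite divfK // scalemx1.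
  rewrite [_^-1 * g]mulrC; move: (_ *: N) (w^T *m a) (w^T *m _ *m B) => X P Q.
  by apply/matrixP => i j; rewrite !mxE; ring.
Qed.

End GramField.

Section GramInt.
Variables (n k : nat) (B : 'M[int]_(k, n)) (a : 'rV[int]_n).
Hypothesis G0 : gram B != 0.
Let N := gproj B.
Let g := (a *m N *m a^T) 0 0.
Let toQ m1 m2 := @map_mx int rat intr m1 m2.

Let gQ : ((toQ a) *m gproj (toQ B) *m (toQ a)^T) 0 0 = g%:~R.
Proof. by rewrite -map_gproj map_trmx -!map_mxM mxE. Qed.

Let G0Q : gram (toQ B) != 0.
Proof. by rewrite map_gram intr_eq0. Qed.

Lemma gram_col_int : gram (col_mx B a) = g.
Proof.
by apply: (@intr_inj rat); rewrite -gQ -(gram_col _ G0Q) -map_col_mx map_gram.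
Qed.

(** Proved over the rationals, where [gram B] is invertible. Over the integers it says that the
    division in [proj_step] is exact. *)
Lemma gproj_col_int : g != 0 ->
  gram B *: gproj (col_mx B a) = g *: N - (a *m N)^T *m (a *m N).
Proof.
move=> g0; have := @gproj_col _ _ _ (toQ B) (toQ a) G0Q.
rewrite gQ intr_eq0 => /(_ g0); rewrite -map_col_mx map_gram -!map_gproj.
rewrite -map_mxM map_trmx -map_mxM -!map_mxZ -map_mxB.
move=> /matrixP h; apply/matrixP => i j; apply: (@intr_inj rat).
by have := h i j; rewrite [LHS]mxE [RHS]mxE.
Qed.

End GramInt.

Definition vecz n (u : seq int) : 'rV[int]_n := \row_j nth 0 u j.
Definition matz n (N : seq (seq int)) : 'M[int]_n := \matrix_(i, j) entry N i j.

Lemma dot_vecz n u v : dot n u v = (vecz n u *m (vecz n v)^T) 0 0.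
Proof. by rewrite dotE mxE; apply: eq_bigr => j _; rewrite !mxE. Qed.

Lemma vecz_matvec n N u : (matz n N)^T = matz n N ->
  vecz n (matvec n N u) = vecz n u *m matz n N.
Proof.
move=> sN; apply/rowP => i; rewrite !mxE nth_matvec // dotE; apply: eq_bigr => j _.
have := congr1 (fun M : 'M_n => M j i) sN; rewrite !mxE => e.
by rewrite -e mulrC.
Qed.

Lemma mxsq_ge0 (R : realDomainType) n (w : 'rV[R]_n) : 0 <= (w *m w^T) 0 0.
Proof. by rewrite mxE sumr_ge0 // => j _; rewrite !mxE -expr2 sqr_ge0. Qed.

Lemma mxsq_eq0 (R : realDomainType) n (w : 'rV[R]_n) : (w *m w^T) 0 0 = 0 -> w = 0.
Proof.
rewrite mxE => h; apply/rowP => j; rewrite !mxE.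
have /psumr_eq0P := h => /(_ (fun j _ => _)) H.
have : forall j : 'I_n, true -> w 0 j * w^T j 0 = 0.
  by apply: H => i; rewrite mxE -expr2 sqr_ge0.
by move=> /(_ j isT); rewrite mxE => /eqP; rewrite mulf_eq0 orbb => /eqP.
Qed.

(** The last clause is Hadamard's inequality; the maximum with 1 covers the rows that are dropped as
    dependent. *)
Definition proj_spec n (rows : seq (seq int)) (GN : int * seq (seq int)) :=
  [/\ 0 < GN.1,
      exists F, GN.2 = mkmx n F,
      exists k (B : 'M[int]_(k, n)), [/\ GN.1 = gram B, matz n GN.2 = gproj B &
        forall i, exists2 a, a \in rows & row i B = vecz n a],
      forall a, a \in rows -> vecz n a *m matz n GN.2 = 0 &
      GN.1 <= \prod_(a <- rows) Num.max 1 (dot n a a)].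

Lemma proj_spec_step n rows GN a :
  proj_spec n rows GN -> proj_spec n (rcons rows a) (proj_step n GN a).
Proof.
case: GN => G N [/= G0 [F eN] [k [B [eG eB hB]]] kill bG].
have sN : (matz n N)^T = matz n N by rewrite eB gproj_sym.
have NN : matz n N *m matz n N = G *: matz n N by rewrite eB gproj_idem eG.
rewrite /proj_step /=; set w := matvec n N a; set g := dot n a w.
have ew : vecz n w = vecz n a *m matz n N by rewrite vecz_matvec.
have eg : g = (vecz n a *m matz n N *m (vecz n a)^T) 0 0.
  by rewrite /g dot_vecz ew trmx_mul sN mulmxA.
have ww : vecz n w *m (vecz n w)^T = G *: (vecz n a *m matz n N *m (vecz n a)^T).
  by rewrite ew trmx_mul sN mulmxA -[_ *m matz n N *m matz n N]mulmxA NN -scalemxAr -scalemxAl.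
(* Hence g >= 0, and g = 0 only if w = 0, that is, if [a] depends on the earlier rows. *)
have Gg : G * g = (vecz n w *m (vecz n w)^T) 0 0 by rewrite ww [RHS]mxE -eg.
have g_ge0 : 0 <= g by rewrite -(pmulr_rge0 _ G0) Gg mxsq_ge0.
have P0 : 1 <= \prod_(a <- rows) Num.max 1 (dot n a a).
  by rewrite -big_filter; elim/big_ind: _ => //= [x y hx hy|i _]; [nia|rewrite le_max lexx].
have subB : forall i, exists2 b, b \in rcons rows a & row i B = vecz n b.
  by move=> i; have [b hb e] := hB i; exists b; rewrite // mem_rcons inE hb orbT.
rewrite /zle0; case: ifP => hg.
  have g_eq0 : g = 0 by lia.
  split => //=.
  - by exists F.
  - by exists k, B; split.
  - move=> b; rewrite mem_rcons inE => /orP[/eqP ->|]; last exact: kill.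
    by rewrite -ew; apply: mxsq_eq0; rewrite -Gg g_eq0 mulr0.
  - rewrite -cats1 big_cat big_seq1 /=; apply: le_trans bG _.
    by apply: ler_peMr; rewrite ?le_max ?lexx // (le_trans ler01 P0).
have g0 : 0 < g by lia.
have gB0 : gram B != 0 by rewrite -eG; lia.
have eg' : g = (vecz n a *m gproj B *m (vecz n a)^T) 0 0 by rewrite -eB.
have g'0 : (vecz n a *m gproj B *m (vecz n a)^T) 0 0 != 0 by rewrite -eg'; lia.
have := gproj_col_int gB0 g'0; rewrite -eB -eG -eg -ew => eB'.
have eN' : matz n (mkmx n (fun i j => qdiv (zsub (zmul g (entry N i j))
    (zmul (nth 0 w i) (nth 0 w j))) G)) = gproj (col_mx B (vecz n a)).
  apply/matrixP => i j; rewrite mxE entry_mkmx // -[RHS](qdivE _ G0).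
  have := congr1 (fun M : 'M_n => M i j) eB'; rewrite /= [LHS]mxE => e.
  rewrite mulrC e; congr qdiv.
  rewrite [RHS]mxE [X in _ = X + _]mxE [X in _ = _ + X]mxE [matz _ _ i j]mxE.
  by rewrite [X in _ = _ - X]mxE big_ord1 !mxE.
split => //=.
- by eexists.
- exists (k + 1)%N, (col_mx B (vecz n a)); split => //.
    by rewrite gram_col_int.
  move=> i; case: (splitP i) => [i' e|i' e].
    have -> : i = lshift 1 i' by apply: val_inj.
    have [b hb eb] := subB i'; exists b => //.
    by rewrite rowKu.
  have -> : i = rshift k i' by apply: val_inj.
  exists a; first by rewrite mem_rcons mem_head.
  by rewrite rowKd row_id.
- move=> b; rewrite mem_rcons inE eN' => /orP[/eqP ->|hb].
    have := gproj_kill (col_mx B (vecz n a)).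
    rewrite tr_col_mx mul_mx_row -[0]row_mx0 => /eq_row_mx[_ /(congr1 trmx)].
    by rewrite trmx_mul trmxK gproj_sym trmx0.
  have bN := kill _ hb.
  have /eqP : G *: (vecz n b *m gproj (col_mx B (vecz n a))) = 0.
    rewrite scalemxAr eB' mulmxBr -scalemxAr bN scaler0 sub0r mulmxA.
    by rewrite ew trmx_mul sN !mulmxA bN !mul0mx oppr0.
  by rewrite scalemx_eq0 => /orP[/eqP|/eqP//]; lia.
- rewrite -cats1 big_cat big_seq1 /=.
  apply: (@le_trans _ _ (G * dot n a a)).
    (* The square of G a - w is G (G (a . a) - g), so g <= G (a . a). *)
    have := mxsq_ge0 (G *: vecz n a - vecz n w).
    rewrite linearB linearZ /= mulmxBl !mulmxBr -!scalemxAr -!scalemxAl ww.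
    have -> : vecz n a *m (vecz n w)^T = vecz n a *m matz n N *m (vecz n a)^T.
      by rewrite ew trmx_mul sN mulmxA.
    have -> : vecz n w *m (vecz n a)^T = vecz n a *m matz n N *m (vecz n a)^T.
      by rewrite ew.
    have -> : (G *: (G *: (vecz n a *m (vecz n a)^T)) - G *: (vecz n a *m matz n N *m (vecz n a)^T) -
     (G *: (vecz n a *m matz n N *m (vecz n a)^T) -
      G *: (vecz n a *m matz n N *m (vecz n a)^T))) 0 0 = G * (G * dot n a a - g).
      rewrite eg dot_vecz; move: (vecz n a *m _) (vecz n a *m _ *m _) => P Q.
      by rewrite !mxE; ring.
    by rewrite pmulr_rge0 //; lia.
  by apply: ler_pM => //; [lia|rewrite dot_vecz mxsq_ge0|rewrite le_max lexx orbT].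
Qed.

Lemma proj_specP n rows : proj_spec n rows (proj n rows).
Proof.
rewrite /proj; elim/last_ind: rows => [|rows a IH].
  split => //=; last by rewrite big_nil.
  - by exists eqz.
  - exists 0%N, 0; split; [by rewrite gram_empty| |by case].
    rewrite gproj_empty; apply/matrixP => i j; rewrite !mxE entry_mkmx // /eqz.
    by rewrite -val_eqE /=; case: (_ == _).
by rewrite foldl_rcons; apply: proj_spec_step.
Qed.

Lemma nth_lt_esize (u : seq int) j : (`|nth 0%R u j| < 2 ^ esize u)%N.
Proof.
case: (ltnP j (size u)) => h; last by rewrite nth_default // expn_gt0.
apply: leq_trans (int_lt_esize _) _; rewrite leq_exp2l //.
by apply: ltnW; apply: esize_mem; apply: mem_nth.
Qed.

Lemma dot_lt n (a : seq int) : dot n a a <= Posz (2 ^ (n + 2 * esize a)).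
Proof.
rewrite dotE; apply: (@le_trans _ _ (\sum_(j < n) Posz (2 ^ (2 * esize a)))).
  apply: ler_sum => j _; have := nth_lt_esize a j.
  rewrite mul2n -addnn expnD; move: (2 ^ esize a)%N (nth 0 a j) => p z h.
  nia.
rewrite sumr_const card_ord expnD; have h := ltn_expl n (isT : (1 < 2)%N).
by move: (2 ^ (2 * _))%N => p; rewrite -mulr_natr; nia.
Qed.

Lemma proj_den_lt n rows :
  (proj n rows).1 <= Posz (2 ^ (size rows * n + 2 * esize rows)).
Proof.
case: (proj_specP n rows) => _ _ _ _ /le_trans; apply.
elim: rows => [|a rows IH]; first by rewrite big_nil; lia.
rewrite big_cons esize_cons /=.
have -> : (2 ^ ((size rows).+1 * n + 2 * (esize a + esize rows).+1) =
  4 * (2 ^ (n + 2 * esize a) * 2 ^ (size rows * n + 2 * esize rows)))%N.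
  by rewrite -expnD -[4%N]/(2 ^ 2)%N -expnD; congr (2 ^ _)%N; lia.
have h1 := dot_lt n a.
have h2 : (0 < 2 ^ (n + 2 * esize a))%N by rewrite expn_gt0.
have h3 : 1 <= \prod_(a <- rows) Num.max 1 (dot n a a).
  by elim/big_ind: _ => //= [x y hx hy|i _]; [nia|rewrite le_max lexx].
have h4 : Num.max 1 (dot n a a) <= Posz (2 ^ (n + 2 * esize a)) by rewrite ge_max h1 andbT; lia.
move: IH h3 h4; move: (\prod_(_ <- _) _) (Num.max _ _) (2 ^ _)%N (2 ^ _)%N => x y z w.
by case: (lerP 0 y); nia.
Qed.

(** On the diagonal, [N *m N = G *: N] says that the squares in column q sum to G N_qq; this gives 0
    <= N_qq <= G and then bounds every entry. *)
Lemma proj_entry_le n rows i j : (i < n)%N -> (j < n)%N ->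
  `|entry (proj n rows).2 i j| <= (proj n rows).1.
Proof.
move=> hi hj; case: (proj_specP n rows) => G0 _ [k [B [eG eB _]]] _ _.
have NN := gproj_idem B; have sN := gproj_sym B; rewrite -eB -eG in NN sN.
set G := (proj n rows).1 in G0 NN *; set N := matz n _ in NN sN.
have eN i' j' : N i' j' = entry (proj n rows).2 i' j' by rewrite mxE.
have diag (q : 'I_n) : \sum_p N p q ^+ 2 = G * N q q.
  have := congr1 (fun M : 'M_n => M q q) NN; rewrite /= [RHS]mxE => <-.
  rewrite mxE; apply: eq_bigr => p _.
  have := congr1 (fun M : 'M_n => M p q) sN; rewrite /= [LHS]mxE => <-.
  by rewrite expr2.
have le1 (p q : 'I_n) : N p q ^+ 2 <= G * N q q.
  by rewrite -diag (bigD1 p) //= lerDl sumr_ge0 // => s _; rewrite sqr_ge0.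
have d (q : 'I_n) : 0 <= N q q <= G by have := le1 q q; nia.
have := le1 (Ordinal hi) (Ordinal hj); have := d (Ordinal hj).
by rewrite !eN /=; nia.
Qed.

Lemma ptime_proj `{codable E} (n : E -> nat) rows :
  ptime n -> ptime rows -> ptime (fun e => proj (n e) (rows e)).
Proof.
move=> hn hr; have [T hT eT] := ptime_esize hn; have [U hU eU] := ptime_esize hr.
pose Bd m := (U m * T m + 2 * U m).+1.
apply: (ptime_foldl (f := fun e => proj_step (n e))
  (q := fun m => (4 * Bd m + 5 + (T m * (T m * (4 * Bd m + 6) + 2) + 1)).+1)); try pt.
  by rewrite /Bd; pbnd.
move=> e i; rewrite -/(proj _ _); set s := take i _.
have es : (esize s <= U (esize e))%N by apply: leq_trans (esize_take _ _) (eU e).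
have nT : (n e <= T (esize e))%N by have := eT e; rewrite esize_nat; lia.
have ss : (size s <= U (esize e))%N by use (size_esize s); lia.
have [F eF] : exists F, (proj (n e) s).2 = mkmx (n e) F by case: (proj_specP (n e) s).
have bG : (`|(proj (n e) s).1| < 2 ^ Bd (esize e))%N.
  have := proj_den_lt (n e) s; case: (proj_specP (n e) s) => + _ _ _ _.
  have h : (2 ^ (size s * n e + 2 * esize s) < 2 ^ Bd (esize e))%N.
    by rewrite ltn_exp2l // /Bd ltnS leq_add //; [apply: leq_mul|rewrite leq_mul2l es].
  by move: h; move: (2 ^ _)%N (2 ^ _)%N => x y; lia.
have eN : (esize (proj (n e) s).2 <= n e * (n e * (4 * Bd (esize e) + 6) + 2) + 1)%N.
  rewrite eF; apply: esize_mkmx => p q hp hq.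
  have := proj_entry_le s hp hq; rewrite {1}eF entry_mkmx //.
  by move: bG; move: (2 ^ _)%N => x; lia.
have := esize_int bG; rewrite [proj _ _]surjective_pairing esize_pair => h.
rewrite ltnS; apply: leq_add => //; apply: leq_trans eN _.
by rewrite leq_add2r; apply: leq_mul => //; rewrite leq_add2r leq_mul2r nT orbT.
Qed.
#[export] Hint Resolve ptime_proj : pt.

Lemma ptime_lp_step `{codable E} (n : E -> nat) st :
  ptime n -> ptime st -> ptime (fun e => lp_step (n e) (st e)).
Proof. by move=> hn hG; rewrite /lp_step /threshold; pt. Qed.
#[export] Hint Resolve ptime_lp_step : pt.

Definition small_seq (L k : nat) (u : seq int) :=
  (size u <= L)%N /\ forall z, z \in u -> (`|z| < 2 ^ k)%N.

Lemma small_nth L k u i : small_seq L k u -> (`|nth 0%R u i| < 2 ^ k)%N.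
Proof.
move=> [_ h]; case: (ltnP i (size u)) => hi; first by apply: h; apply: mem_nth.
by rewrite nth_default // expn_gt0.
Qed.

Lemma small_seqW L k l u : (k <= l)%N -> small_seq L k u -> small_seq L l u.
Proof. by move=> h [h1 h2]; split => // z /h2 h3; apply: leq_trans h3 _; rewrite leq_exp2l. Qed.

Lemma esize_small L k u : small_seq L k u -> (esize u <= L * (4 * k + 6) + 1)%N.
Proof.
move=> [h1 h2]; apply: leq_trans (@esize_seq_le _ _ _ (4 * k + 5) _) _.
  by move=> z /h2 /esize_int.
by rewrite leq_add2r; apply: leq_mul => //; lia.
Qed.

Lemma mem_rows_esize (rows : seq (seq int)) (a : seq int) : a \in rows ->
  (size a <= esize rows)%N /\ forall z, z \in a -> (esize z <= esize rows)%N.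
Proof.
move=> ha; have h : (esize a <= esize rows)%N by apply: ltnW; apply: esize_mem ha.
split; first by apply: leq_trans h; apply: ltnW; apply: size_esize.
by move=> z hz; apply: leq_trans h; apply: ltnW; apply: esize_mem hz.
Qed.

(** A step at most doubles the entries of the rows and adds 1 to one entry of y, so numbers grow by
    at most one bit per step. *)
Lemma lp_run_small n rows L k t :
  (n <= L)%N -> (forall a, a \in rows -> small_seq L k a) ->
  let st := lp_run n rows t in
  [/\ size st.1 = size rows, forall a, a \in st.1 -> small_seq L (k + t) a &
      small_seq L t st.2].
Proof.
move=> nL hr; elim: t => [|t [h1 h2 h3]].
  split => //; first by rewrite addn0.
  by split; rewrite /= ?size_nseq // => z; rewrite mem_nseq => /andP[_ /eqP ->].
rewrite /lp_run iterS -/(lp_run _ _ _) /lp_step.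
set st := lp_run n rows t in h1 h2 h3 *.
case: ifP => _; first by split => // [a /h2|]; [|move: h3]; apply: small_seqW; rewrite ?addnS.
set j := find _ _; case: ifP => _ /=; split => //.
- by rewrite size_map.
- move=> r /mapP[a /h2 ha ->]; split; first by rewrite size_map size_iota.
  move=> z /mapP[i _ ->]; have := small_nth i ha; rewrite addnS expnS /zadd.
  by move: (nth 0 a i) (2 ^ _)%N => w p; case: ifP => _; lia.
- by split; rewrite ?size_nseq // => z; rewrite mem_nseq => /andP[_ /eqP ->]; rewrite expn_gt0.
- by move=> a /h2; apply: small_seqW; rewrite addnS.
- split; first by rewrite size_map size_iota.
  move=> z /mapP[i _ ->]; have := small_nth i h3; rewrite expnS /zadd /eqz.
  have : (0 < 2 ^ t)%N by rewrite expn_gt0.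
  by move: (nth 0 _ i) (2 ^ _)%N => w p; case: ifP => _; lia.
Qed.

Lemma ptime_lp_run `{codable E} (n t : E -> nat) rows :
  ptime n -> ptime t -> ptime rows -> ptime (fun e => lp_run (n e) (rows e) (t e)).
Proof.
move=> hn ht hr; have [T hT eT] := ptime_esize hn; have [U hU eU] := ptime_esize hr.
have [V hV eV] := ptime_esize ht.
pose L m := (T m + U m)%N.
pose row_bd m := (L m * (4 * (U m + V m) + 6) + 1)%N.
apply: (ptime_iter (f := fun e => lp_step (n e))
  (q := fun m => (U m * (row_bd m).+1 + 1 + row_bd m).+1)); try pt.
  by rewrite /row_bd /L; pbnd.
move=> e i hi; rewrite -/(lp_run _ _ _).
have nT : (n e <= L (esize e))%N by have := eT e; rewrite esize_nat /L; lia.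
have hr0 a : a \in rows e -> small_seq (L (esize e)) (U (esize e)) a.
  move=> /mem_rows_esize [h1 h2]; have hU' := eU e.
  split; first by rewrite /L; lia.
  by move=> z /h2 hz; apply: leq_trans (int_lt_esize z) _; rewrite leq_exp2l //; exact: leq_trans hz hU'.
have iV : (i <= V (esize e))%N by have := eV e; rewrite esize_nat; lia.
have [h1 h2 h3] := lp_run_small i nT hr0.
rewrite [lp_run _ _ _]surjective_pairing esize_pair ltnS; apply: leq_add.
  apply: leq_trans (@esize_seq_le _ _ _ (row_bd (esize e)) _) _.
    by move=> a /h2 /(@small_seqW _ _ (U (esize e) + V (esize e))) h; apply: esize_small; apply: h; lia.
  by rewrite h1 leq_add2r leq_mul2r /=; use (size_esize (rows e)); have := eU e; lia.
by apply: esize_small; apply: small_seqW h3; lia.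
Qed.
#[export] Hint Resolve ptime_lp_run : pt.

Lemma ptime_lp_feasible `{codable E} (n : E -> nat) rows :
  ptime n -> ptime rows -> ptime (fun e => lp_feasible (n e) (rows e)).
Proof. by move=> hn hr; rewrite /lp_feasible /lp_iters /threshold; pt. Qed.
#[export] Hint Resolve ptime_lp_feasible : pt.

(** * Correctness of the feasibility test *)

Lemma find_zle0 n (z : seq int) : size z = n -> (n <= find zle0 z)%N ->
  forall j, (j < n)%N -> 0 < nth 0 z j.
Proof.
move=> <- h j hj; rewrite ltNge; apply: negbT.
by have := before_find 0 (leq_trans hj h).
Qed.

Lemma nth_find_zle0 n (z : seq int) : size z = n -> (find zle0 z < n)%N ->
  nth 0 z (find zle0 z) <= 0.
Proof. by move=> <- h; apply: (@nth_find _ 0 zle0); rewrite has_find. Qed.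

Lemma size_matvec n N y : size (matvec n N y) = n.
Proof. by rewrite size_map size_iota. Qed.

Definition annihilates (R : pzRingType) n (rows : seq (seq int)) (x : 'rV[R]_n) :=
  forall a, a \in rows -> map_mx intr (vecz n a) *m x^T = 0.

Lemma annihilatesP (R : pzRingType) n rows (x : 'rV[R]_n) :
  annihilates rows x <->
  (forall a, a \in rows -> \sum_(j < n) (nth 0 a j)%:~R * x 0 j = 0).
Proof.
split=> h a /h => [/(congr1 (fun M : 'M_1 => M 0 0))|e].
  by rewrite !mxE => e; rewrite -[RHS]e; apply: eq_bigr => j _; rewrite !mxE.
apply/matrixP => i j; rewrite !mxE -[RHS]e; apply: eq_bigr => k _.
by rewrite !mxE (ord1 j).
Qed.

Lemma annihilates_scale (R : comPzRingType) n rows j (x : 'rV[R]_n) :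
  annihilates (map (scale_row n j) rows) x ->
  annihilates rows (\row_i (if i == j :> nat then x 0 i else x 0 i *+ 2)).
Proof.
move=> /annihilatesP h; apply/annihilatesP => a ha.
rewrite -[RHS](h _ (map_f (scale_row n j) ha)); apply: eq_bigr => i _.
rewrite mxE nth_mkseq_iota //; case: eqP => // _.
by rewrite /zadd intrD mulrDl mulrnAr mulr2n.
Qed.

Lemma annihilates_unscale (R : comPzRingType) n rows j (x : 'rV[R]_n) :
  annihilates rows x -> annihilates (map (scale_row n j) rows)
    (\row_i (if i == j :> nat then x 0 i *+ 2 else x 0 i)).
Proof.
move=> /annihilatesP h; apply/annihilatesP => _ /mapP[a ha ->].
transitivity (\sum_(i < n) ((nth 0 a i)%:~R * x 0 i) *+ 2); last by rewrite sumrMnl h // mul0rn.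
apply: eq_bigr => i _; rewrite mxE nth_mkseq_iota //; case: eqP => // _.
  by rewrite mulrnAr.
by rewrite /zadd intrD mulrDl mulr2n.
Qed.

(** At the end the integral vector N y is positive and annihilated by the current rows; undoing the
    rescalings only doubles some of its entries. *)
Lemma lp_feasible_sound n rows : lp_feasible n rows ->
  exists2 x : 'rV[int]_n, (forall j, 0 < x 0 j) & annihilates rows x.
Proof.
rewrite /lp_feasible; move: (lp_iters n) => t; set st := lp_run n rows t => hz.
have inv : forall x : 'rV[int]_n, (forall j, 0 < x 0 j) -> annihilates st.1 x ->
   exists2 x : 'rV[int]_n, (forall j, 0 < x 0 j) & annihilates rows x.
  rewrite /st {st hz}; elim: t => [|t IH] x x0 hx; first by exists x.
  move: hx; rewrite /lp_run iterS -/(lp_run _ _ _) /lp_step.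
  case: ifP => _; first exact: IH.
  case: ifP => _ /=; last exact: IH.
  move=> /annihilates_scale; apply: IH => i; rewrite mxE.
  by case: ifP => _; rewrite ?pmulrn_lgt0.
have [_ _ [k [B [eG eB _]]] kill _] := proj_specP n st.1.
set N := (proj n st.1).2 in hz eB kill; set y := st.2 in hz.
have sN : (matz n N)^T = matz n N by rewrite eB gproj_sym.
apply: (inv (vecz n (matvec n N y))).
  by move=> j; rewrite mxE; apply: find_zle0 hz _ _; rewrite ?size_matvec.
move=> a ha; have -> : map_mx intr (vecz n a) = vecz n a.
  by apply/matrixP => i j; rewrite !mxE intz.
by rewrite vecz_matvec // trmx_mul sN mulmxA kill // mul0mx.
Qed.

Lemma mx_cauchy_schwarz (R : realDomainType) n (u v : 'rV[R]_n) :
  (u *m v^T) 0 0 ^+ 2 <= (u *m u^T) 0 0 * (v *m v^T) 0 0.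
Proof.
set a := (v *m v^T) 0 0; set b := (u *m v^T) 0 0; set c := (u *m u^T) 0 0.
have a0 : 0 <= a by apply: mxsq_ge0.
have [a_eq0|an0] := eqVneq a 0.
  by rewrite /b (mxsq_eq0 a_eq0) trmx0 mulmx0 mxE expr0n a_eq0 mulr0.
(* This square equals a (a c - b^2). *)
have := mxsq_ge0 (a *: u - b *: v).
rewrite [(_ - _)^T]linearB /= [(a *: u)^T]linearZ [(b *: v)^T]linearZ /= mulmxBl !mulmxBr -!scalemxAr -!scalemxAl.
have -> : v *m u^T = u *m v^T by rewrite [RHS]mx11_scalar -tr_scalar_mx -mx11_scalar trmx_mul trmxK.
rewrite /a /b /c in a0 an0 *; move: (u *m u^T) (u *m v^T) (v *m v^T) a0 an0 => P Q S.
rewrite !mxE => a0 an0 h.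
have {}a0 : 0 < S 0 0 by rewrite lt_def an0.
rewrite -subr_ge0 -(pmulr_rge0 _ a0).
apply: le_trans h _; rewrite le_eqVlt; apply/orP; left; apply/eqP; ring.
Qed.

Section CutBound.
Variables (R : realFieldType) (n : nat) (N : 'M[R]_n) (G : R) (x y : 'rV[R]_n) (Y : R).
Hypotheses (G0 : 0 < G) (sN : N^T = N) (NN : N *m N = G *: N).
Hypotheses (Nx : N *m x^T = G *: x^T) (x01 : forall j, 0 <= x 0 j <= 1).
Hypothesis (yNy : (y *m N *m y^T) 0 0 <= G * Y).

(** [N] is G times a projection Q that fixes x, so (y . x)^2 = (Q y . x)^2 <= |Q y|^2 |x|^2 by
    Cauchy-Schwarz. *)
Lemma cut_bound : (y *m x^T) 0 0 ^+ 2 <= Y * n%:R.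
Proof.
have h := mx_cauchy_schwarz (y *m N) x.
have e1 : y *m N *m x^T = G *: (y *m x^T) by rewrite -mulmxA Nx -scalemxAr.
have e2 : y *m N *m (y *m N)^T = G *: (y *m N *m y^T).
  by rewrite trmx_mul sN mulmxA -[_ *m N *m N]mulmxA NN -scalemxAr -scalemxAl.
rewrite e1 e2 in h.
have xx : (x *m x^T) 0 0 <= n%:R.
  rewrite mxE -[n in X in _ <= X]card_ord -sum1_card natr_sum; apply: ler_sum => j _.
  by rewrite mxE; have := x01 j; nra.
have xx0 := mxsq_ge0 x.
have y0 : 0 <= (y *m N *m y^T) 0 0.
  by have := mxsq_ge0 (y *m N); rewrite e2 [X in 0 <= X]mxE pmulr_rge0.
move: h yNy xx xx0 y0; move: (y *m x^T) (y *m N *m y^T) (x *m x^T) => P Q S.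
rewrite !mxE; move: (P 0 0) (Q 0 0) (S 0 0) => a b c h yb xx xx0 b0.
have {}h : G * a ^+ 2 <= b * c.
  by rewrite -(ler_pM2l G0); move: h; rewrite exprMn expr2; lra.
have h2 : b * c <= G * (Y * n%:R).
  by rewrite mulrA; apply: ler_pM.
by rewrite -(ler_pM2l G0); apply: le_trans h h2.
Qed.
End CutBound.

Section Complete.
Variables (R : realFieldType) (n : nat) (delta : R).

(* The last inequality says that t is at most the number of increments spent on
   the c rescalings made so far plus the current sum of y. *)
Definition progress t (st : seq (seq int) * seq int) :=
  exists c (x : 'rV[R]_n),
  [/\ annihilates st.1 x, (forall j, 0 < x 0 j <= 1),
      delta * 2 ^+ c <= \prod_j x 0 j,
      (forall j, 0 <= vecz n st.2 0 j < Posz (threshold n)) /\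
      (vecz n st.2 *m matz n (proj n st.1).2 *m (vecz n st.2)^T) 0 0
        <= (proj n st.1).1 * \sum_j vecz n st.2 0 j &
      Posz t <= Posz (c * (n * threshold n)) + \sum_j vecz n st.2 0 j].

Definition found (st : seq (seq int) * seq int) :=
  (n <= find zle0 (matvec n (proj n st.1).2 st.2))%N.

Lemma vecz_incr (j : 'I_n) y : vecz n (incr n j y) = vecz n y + delta_mx 0 j.
Proof.
apply/rowP => i; rewrite !mxE nth_mkseq_iota // /zadd /eqz eqxx /=.
have -> : (i == j) = (i == j :> nat) by [].
by case: (i == j :> nat).
Qed.

Lemma vecz_zeros : vecz n (nseq n 0) = 0.
Proof. by apply/rowP => i; rewrite !mxE nth_nseq if_same. Qed.

Lemma progress_step t st : ~~ found st -> progress t st -> progress t.+1 (lp_step n st).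
Proof.
rewrite /found -ltnNge /lp_step => hf [c [x [hx x01 hp [ybd hQ] ht]]].
rewrite leqNgt hf [~~ _]/=.
have := nth_find_zle0 (size_matvec n _ st.2) hf.
move: (find _ _) hf => j hf.
rewrite -[j]/(nat_of_ord (Ordinal hf)); move: {j hf}(Ordinal hf) => j'.
have [G0 _ [k [B [eG eB hB]]] _ _] := proj_specP n st.1.
have jj := proj_entry_le st.1 (ltn_ord j') (ltn_ord j').
set G := (proj n st.1).1 in G0 hQ eG jj *; set NN := (proj n st.1).2 in hQ eB jj *.
set N := matz n NN in hQ eB.
have sN : N^T = N by rewrite eB gproj_sym.
have NN2 : N *m N = G *: N by rewrite eB gproj_idem eG.
rewrite nth_matvec // dot_vecz => zj.
have ezj : (vecz n (nth [::] NN j') *m (vecz n st.2)^T) 0 0 = (vecz n st.2 *m N) 0 j'.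
  rewrite !mxE; apply: eq_bigr => i _; rewrite !mxE mulrC; congr (_ * _).
  by have := congr1 (fun M : 'M_n => M j' i) sN; rewrite !mxE.
rewrite ezj in zj.
set y := vecz n st.2 in ybd hQ ht zj.
have eQ : ((y + delta_mx 0 j') *m N *m (y + delta_mx 0 j')^T) 0 0 =
   (y *m N *m y^T) 0 0 + (y *m N) 0 j' *+ 2 + N j' j'.
  rewrite linearD /= trmx_delta mulmxDl mulmxDl !mulmxDr -!rowE -!colE.
  have -> : row j' N *m y^T = (col j' (y *m N))^T.
    by rewrite tr_col trmx_mul sN row_mul.
  rewrite ![(_ + _ : 'M_1) 0 0]mxE.
  by move: (y *m N *m y^T) (y *m N) => P Q; rewrite !mxE mulr2n; ring.
have eS : \sum_i (y + delta_mx 0 j') 0 i = \sum_i y 0 i + 1.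
  under eq_bigr do rewrite mxE; rewrite big_split /=; congr (_ + _).
  rewrite (bigD1 j') //= mxE !eqxx big1 ?addr0 // => i /negPf ne.
  by rewrite mxE eqxx ne.
have hQ' : ((y + delta_mx 0 j') *m N *m (y + delta_mx 0 j')^T) 0 0 <= G * \sum_i (y + delta_mx 0 j') 0 i.
  have Njj : N j' j' <= G by rewrite mxE; apply: le_trans jj; apply: ler_norm.
  by rewrite eQ eS mulrDr mulr1; lia.
have ybd' i : 0 <= (y + delta_mx 0 j') 0 i <= Posz (threshold n).
  have := ybd i; rewrite [(y + _) 0 i]mxE [delta_mx _ _ _ _]mxE.
  by move: (y 0 i) => v hv; rewrite eqxx; case: (i == _) => /=; lia.
have yj : vecz n (incr n j' st.2) 0 j' = nth 0 (incr n j' st.2) j' by rewrite mxE.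
rewrite -yj vecz_incr -/y /zle0 /zsub subr_le0; case: ifP => hcut; last first.
  rewrite /progress /= vecz_incr -/y.
  exists c, x; split => //; last by rewrite eS; lia.
  split => // i; case: (eqVneq i j') => [->|ne]; first by move: hcut (ybd' j'); move: ((y + _) 0 j') => v; lia.
  have -> : (y + delta_mx 0 j') 0 i = y 0 i by rewrite !mxE (negPf ne) andbF addr0.
  exact: ybd.
(* Bounds the sum of y in the cut, and also the number of increments charged to this rescaling. *)
have sumle : \sum_i (y + delta_mx 0 j') 0 i <= Posz (n * threshold n).
  apply: (@le_trans _ _ (\sum_(i < n) Posz (threshold n))).
    by apply: ler_sum => i _; have /andP[] := ybd' i.
  by rewrite sumr_const card_ord -mulr_natr; lia.
have n0 : (0 < n)%N := leq_ltn_trans (leq0n j') (ltn_ord j').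
have xj : x 0 j' <= 1 / 2%:R.
  have Nx : map_mx intr N *m x^T = G%:~R *: x^T.
    rewrite eB map_gproj eG -map_gram; apply: gproj_fix.
    apply/row_matrixP => i; rewrite row_mul row0 -map_row.
    by have [a ha ->] := hB i; apply: hx.
  have := @cut_bound R n (map_mx intr N) G%:~R x (map_mx intr (y + delta_mx 0 j'))
     (\sum_i (y + delta_mx 0 j') 0 i)%:~R _ _ _ Nx.
  rewrite ltr0z => /(_ G0); rewrite map_trmx sN => /(_ erefl).
  rewrite -map_mxM NN2 map_mxZ => /(_ erefl).
  have h01 i : 0 <= x 0 i <= 1 by have := x01 i; lra.
  move=> /(_ h01); rewrite -map_mxM map_trmx -map_mxM [X in X <= _ -> _]mxE.
  rewrite -intrM ler_int => /(_ hQ') hsq.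
  have lb : (threshold n)%:R * x 0 j' <= (map_mx intr (y + delta_mx 0 j') *m x^T) 0 0.
    have -> : (map_mx intr (y + delta_mx 0 j') *m x^T) 0 0 =
        \sum_i ((y + delta_mx 0 j') 0 i)%:~R * x 0 i.
      by rewrite mxE; apply: eq_bigr => i _; rewrite [map_mx _ _ _ _]mxE [x^T _ _]mxE.
    rewrite (bigD1 j') //=.
    have -> : (y + delta_mx 0 j') 0 j' = Posz (threshold n).
      by move: hcut (ybd' j'); move: ((y + _) 0 j') => v; lia.
    rewrite lerDl sumr_ge0 // => i _; rewrite mulr_ge0 //.
      by rewrite ler0z; have /andP[] := ybd' i.
    by have /andP[/ltW] := x01 i.
  have sumle' : (\sum_i (y + delta_mx 0 j') 0 i)%:~R <= (n * threshold n)%:R :> R.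
    by rewrite -[(_ * _)%:R]/((Posz (n * threshold n))%:~R) ler_int.
  move: hsq lb sumle'; move: (_ *m x^T) (_%:~R) => P s; move: (P 0 0) => p.
  have := x01 j'; move: (x 0 j') => u hu.
  have nR : 0 < n%:R :> R by rewrite ltr0n.
  rewrite /threshold !natrM; move: (n%:R) nR => m m0 h1 h2 h3.
  have h4 : (4%:R * (m * m) * u) ^+ 2 <= m * (4%:R * (m * m)) * m.
    apply: (@le_trans _ _ (p ^+ 2)).
      by rewrite ler_sqr ?nnegrE //; nra.
    by apply: le_trans h1 _; rewrite ler_pM2r.
  have h5 : 4%:R * (m * m * m * m) * (4%:R * u ^+ 2) <= 4%:R * (m * m * m * m) * 1.
    by move: h4; rewrite expr2; nra.
  have m4 : 0 < 4%:R * (m * m * m * m) by rewrite !mulr_gt0.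
  by rewrite ler_pM2l // in h5; nra.
exists c.+1, (\row_i (if i == j' :> nat then x 0 i *+ 2 else x 0 i)); split => /=.
- exact: annihilates_unscale.
- move=> i; rewrite mxE; case: eqP => [e|_]; last exact: x01.
  have -> : i = j' by apply: val_inj.
  by have := x01 j'; rewrite -mulr_natr; lra.
- rewrite (bigD1 j') //= mxE eqxx exprS mulrCA.
  under eq_bigr => i ne do rewrite mxE (negPf (ne : (i != j' :> nat))).
  by rewrite (bigD1 j') //= in hp; rewrite -[x 0 j' *+ 2]mulr_natl -mulrA ler_pM2l.
- rewrite vecz_zeros; split; last by rewrite !mul0mx mxE big1 ?mulr0 // => i _; rewrite mxE.
  by move=> i; rewrite mxE lexx /threshold; lia.
- rewrite vecz_zeros [X in _ + X]big1; last by move=> i _; rewrite mxE.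
  by rewrite eS in sumle; lia.
Qed.

End Complete.

Lemma det_norm_le n (M : 'M[int]_n) : (forall i j, `|M i j| <= 1) -> `|\det M| <= n`!%:R.
Proof.
move=> hM; apply: le_trans (ler_norm_sum _ _ _) _.
rewrite -card_Sn -sum1_card natr_sum; apply: ler_sum => s _.
rewrite normrM normrX normrN1 expr1n mul1r normr_prod.
by apply: prodr_ile1 => i _; rewrite normr_ge0 hM.
Qed.

Lemma adj_norm_le n (M : 'M[int]_n) i j : (forall i j, `|M i j| <= 1) ->
  `|(\adj M) i j| <= n.-1`!%:R.
Proof.
move=> hM; rewrite mxE /cofactor normrM normrX normrN1 expr1n mul1r.
by apply: det_norm_le => p q; rewrite !mxE.
Qed.

(** * Solutions with entries between 1 and n! *)

Section Vertex.
Variables (R : realFieldType) (m n : nat) (A : 'M[int]_(m, n)).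
Hypothesis A_small : forall i j, `|A i j| <= 1.
Let AR : 'M[R]_(m, n) := map_mx intr A.

Let tight (x : 'rV[R]_n) : {set 'I_n} := [set j | x 0 j == 1].
Let tightmx (T : {set 'I_n}) : 'M[int]_n := diag_mx (\row_j (j \in T)%:R).
Let C (T : {set 'I_n}) : 'M[int]_(m + n, n) := col_mx A (tightmx T).

Let mul_tight (S : comPzRingType) (T : {set 'I_n}) (v : 'rV[S]_n) j :
  (map_mx intr (tightmx T) *m v^T) j 0 = (j \in T)%:R * v 0 j.
Proof.
rewrite map_diag_mx mul_diag_mx [LHS]mxE [X in X * _]mxE [X in X%:~R * _]mxE.
rewrite [X in _ * X]mxE; congr (_ * _).
by case: (j \in T).
Qed.

(** Cramer's rule: rows of [C] that form an invertible matrix send x to a vector with entries 0 and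
    1, so x_j is a sum of at most n cofactors, each at most (n-1)! in size, over a nonzero integral
    determinant. *)
Let vertex_bounded (x : 'rV[R]_n) : AR *m x^T = 0 ->
  row_full (map_mx intr (C (tight x)) : 'M[R]_(m + n, n)) -> forall j, x 0 j <= n`!%:R.
Proof.
move=> Ax full j.
pose f := fullrankfun full; pose C' := rowsub f (C (tight x)).
have C'R : map_mx intr C' = rowsub f (map_mx intr (C (tight x)) : 'M[R]_(m + n, n)).
  by rewrite map_mxsub.
have uC : map_mx intr C' \in @unitmx R n by rewrite C'R fullrowsub_unit.
have d0 : \det C' != 0 by move: uC; rewrite unitmxE unitfE det_map_mx intr_eq0.
have C'small p q : `|C' p q| <= 1.
  rewrite mxE mxE; case: split => k //; rewrite !mxE.
  by case: (_ \in _); case: (_ == _).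
have b1 p : `|(map_mx intr C' *m x^T) p 0| <= 1.
  rewrite C'R mul_rowsub_mx mxE /C map_col_mx mul_col_mx Ax mxE.
  case: split => k; first by rewrite mxE normr0 ler01.
  by rewrite mul_tight inE; case: eqP => [->|]; rewrite ?mul0r ?mul1r ?normr0 ?normr1 ?ler01.
have eq : (\det C')%:~R * x 0 j = \sum_p ((\adj C') j p)%:~R * (map_mx intr C' *m x^T) p 0.
  have := mulmxA (map_mx intr (\adj C')) (map_mx intr C') x^T.
  rewrite -map_mxM mul_adj_mx map_scalar_mx mul_scalar_mx.
  move=> /(congr1 (fun M : 'cV_n => M j 0)); rewrite [RHS]mxE [X in _ = _ * X -> _]mxE => <-.
  by rewrite mxE; apply: eq_bigr => p _; rewrite [X in X * _]mxE.
have n0 : (0 < n)%N := leq_ltn_trans (leq0n j) (ltn_ord j).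
apply: (@le_trans _ _ (`|(\det C')%:~R * x 0 j|)).
  rewrite normrM; apply: le_trans (ler_norm _) _; rewrite ler_peMl //.
  by rewrite -intr_norm -[1]/(1%:~R) ler_int; move: d0; move: (\det C') => d; lia.
rewrite eq; apply: le_trans (ler_norm_sum _ _ _) _.
have -> : n`!%:R = \sum_(p < n) n.-1`!%:R :> R.
  rewrite sumr_const card_ord -mulrnA.
  by congr (_ *+ _); case: (n) n0 => // k _; rewrite factS mulnC.
apply: ler_sum => p _; rewrite normrM -[leRHS]mulr1; apply: ler_pM => //.
rewrite -intr_norm -[_`!%:R]/((Posz _)%:~R) ler_int.
by have := adj_norm_le j p C'small; rewrite natz.
Qed.

(** While the equations and the tight constraints x_j = 1 do not determine x, some kernel vector
    vanishes on the tight coordinates; moving along it makes a further constraint tight. *)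
Lemma vertex_exists (x : 'rV[R]_n) : AR *m x^T = 0 -> (forall j, 1 <= x 0 j) ->
  exists2 y : 'rV[R]_n, AR *m y^T = 0 & forall j, 1 <= y 0 j <= n`!%:R.
Proof.
have [k] := ubnP (n - #|tight x|)%N; elim: k x => // k IH x hk Ax x1.
case full: (row_full (map_mx intr (C (tight x)) : 'M[R]_(m + n, n))).
  by exists x => // j; rewrite x1 vertex_bounded.
have [v vC v0] : exists2 v : 'rV[R]_n, map_mx intr (C (tight x)) *m v^T = 0 & v != 0.
  have : kermx (map_mx intr (C (tight x)) : 'M[R]_(m + n, n))^T != 0.
    by rewrite kermx_eq0 /row_free mxrank_tr; apply/negPf; rewrite -[RHS]full.
  case/rowV0Pn => v /sub_kermxP hv v0; exists v => //.
  by apply: trmx_inj; rewrite trmx_mul trmxK hv trmx0.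
have {v vC v0} [v [Av vT [j vj]]] : exists v : 'rV[R]_n,
    [/\ AR *m v^T = 0, forall j, j \in tight x -> v 0 j = 0 & exists j, v 0 j < 0].
  move: vC; rewrite /C map_col_mx mul_col_mx -[0]col_mx0 => /eq_col_mx[Av Tv].
  have vT j : j \in tight x -> v 0 j = 0.
    move=> hj; have := mul_tight (tight x) v j; rewrite Tv hj mul1r => <-.
    by rewrite mxE.
  have [j vj] : exists j, v 0 j != 0 by apply/rV0Pn.
  case: (ltrP (v 0 j) 0) => h; first by exists v; split => //; exists j.
  exists (- v); split; first by rewrite linearN mulmxN Av oppr0.
    by move=> i /vT e; rewrite mxE e oppr0.
  by exists j; rewrite mxE oppr_lt0 lt_def vj.
(* The first coordinate to come down to 1 limits the move. *)
case: (@arg_minP _ _ _ _ (fun i => v 0 i < 0) (fun i => (x 0 i - 1) / - v 0 i) vj) => i vi hi.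
set t := (x 0 i - 1) / - v 0 i in hi.
have t0 : 0 <= t by rewrite divr_ge0 ?subr_ge0 // oppr_ge0 ltW.
apply: (IH (x + t *: v)).
- have sub : tight x \proper tight (x + t *: v).
    apply/properP; split.
      by apply/subsetP => p hp; rewrite inE !mxE (vT p hp) mulr0 addr0; move: hp; rewrite inE.
    have tv : t * v 0 i = 1 - x 0 i.
      by rewrite /t; field; rewrite lt_eqF.
    exists i; first by rewrite inE !mxE tv addrC subrK.
    by apply/negP => /vT e; rewrite e ltxx in vi.
  have := proper_card sub; have := max_card (tight (x + t *: v)).
  by rewrite card_ord; move: hk; lia.
- by rewrite linearD linearZ /= mulmxDr -scalemxAr Ax Av scaler0 addr0.
- move=> p; rewrite !mxE; case: (ltrP (v 0 p) 0) => hp; last first.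
    by apply: le_trans (x1 p) _; rewrite lerDl mulr_ge0.
  have := hi p hp; rewrite ler_pdivlMr ?oppr_gt0 //.
  by rewrite mulrN; lra.
Qed.

End Vertex.

(** Turns the lower bound (n!)^(-n) on the product of the entries into the number n^3 of possible
    doublings. *)
Lemma fact_exp n : (n`! ^ n <= 2 ^ (n * (n * n)))%N.
Proof.
have h : (n`! <= 2 ^ (n * n))%N.
  apply: (@leq_trans (n ^ n)%N); last first.
    rewrite expnM; case: n => // n; rewrite leq_exp2r //.
    by apply: ltnW; apply: ltn_expl.
  elim: n => // n IH; rewrite factS expnS leq_mul2l /=; apply: leq_trans IH _.
  by case: n => // n; rewrite leq_exp2r.
by rewrite mulnC expnM; case: n h => // n h; rewrite leq_exp2r.
Qed.

Lemma found_step n st : found n st -> lp_step n st = st.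
Proof. by rewrite /found /lp_step => ->. Qed.

Theorem lp_feasible_complete (R : realFieldType) n rows (x : 'rV[R]_n) :
  (forall a j, a \in rows -> `|nth 0 a j| <= 1) ->
  (forall j, 0 < x 0 j) -> annihilates rows x -> lp_feasible n rows.
Proof.
move=> small x0 hx; case: (posnP n) => [n0|n0]; first by rewrite /lp_feasible n0.
pose A : 'M[int]_(size rows, n) := \matrix_(i, j) nth 0 (nth [::] rows i) j.
have annA (y : 'rV[R]_n) : map_mx intr A *m y^T = 0 <-> annihilates rows y.
  split=> h; last first.
    apply/matrixP => i j; move/annihilatesP: h => /(_ _ (mem_nth [::] (ltn_ord i))) e.
    rewrite !mxE -[RHS]e; apply: eq_bigr => k _; rewrite !mxE; congr (_ * y _ _).
    exact: ord1.
  apply/annihilatesP => a /(nthP [::])[i hi <-].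
  have := congr1 (fun M : 'cV_(size rows) => M (Ordinal hi) 0) h; rewrite /= !mxE => e.
  by rewrite -[RHS]e; apply: eq_bigr => k _; rewrite !mxE.
have Asmall i j : `|A i j| <= 1 by rewrite mxE small // mem_nth.
(* Dividing by the least entry makes all entries at least 1, as [vertex_exists] requires. *)
have [y [Ay y1]] : exists y : 'rV[R]_n, map_mx intr A *m y^T = 0 /\ forall j, 1 <= y 0 j.
  pose j0 := Ordinal n0.
  case: (@arg_minP _ _ _ j0 xpredT (fun j => x 0 j) isT) => i _ hi.
  exists ((x 0 i)^-1 *: x); split.
    by rewrite linearZ /= -scalemxAr; move/annA: hx => ->; rewrite scaler0.
  by move=> j; rewrite mxE mulrC ler_pdivlMr // mul1r hi.
have {y Ay y1} [y Ay y1] := vertex_exists Asmall Ay y1.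
pose M : R := n`!%:R; have M0 : 0 < M by rewrite ltr0n fact_gt0.
have prog t : found n (lp_run n rows t) \/ progress n (M^-1 ^+ n) t (lp_run n rows t).
  elim: t => [|t [h|h]].
  - right; exists 0%N, (M^-1 *: y); split => /=.
    + by apply/annA; rewrite linearZ /= -scalemxAr Ay scaler0.
    + move=> j; rewrite mxE; have /andP[h1 h2] := y1 j.
      rewrite mulr_gt0 ?invr_gt0 //=; last by lra.
      by rewrite mulrC ler_pdivrMr // mul1r.
    + rewrite expr0 mulr1 -[n in M^-1 ^+ n]card_ord -prodr_const; apply: ler_prod => j _.
      have Mi : 0 <= M^-1 by rewrite invr_ge0 ltW.
      by rewrite Mi mxE ler_peMr //; have /andP[] := y1 j.
    + rewrite vecz_zeros; split; last by rewrite !mul0mx mxE big1 ?mulr0 // => i _; rewrite mxE.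
      by move=> i; rewrite mxE lexx /threshold; lia.
    + by rewrite vecz_zeros mul0n big1 // => i _; rewrite mxE.
  - by left; rewrite /lp_run iterS found_step.
  - case: (boolP (found n (lp_run n rows t))) => h'.
      by left; rewrite /lp_run iterS found_step.
    by right; rewrite /lp_run iterS; apply: progress_step.
rewrite /lp_feasible; case: (prog (lp_iters n)) => // -[c [z [_ z01 hp [ybd _] ht]]].
(* A run that never stops has made [lp_iters n] increments, hence more than n^3 rescalings. *)
exfalso; set st := lp_run _ _ _ in ybd ht.
have sumle : \sum_j vecz n st.2 0 j < Posz (n * threshold n).
  apply: (@lt_le_trans _ _ (\sum_(i < n) Posz (threshold n))).
    apply: ltr_sum; first by apply/hasP; exists (Ordinal n0); rewrite ?mem_index_enum.
    by move=> i _; have /andP[] := ybd i.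
  by rewrite sumr_const card_ord -mulr_natr; lia.
have hc : ((n * (n * n)).+1 <= c)%N.
  move: ht sumle; rewrite /lp_iters; move: (\sum_j _) (n * threshold n)%N => s u h1 h2.
  rewrite leqNgt; apply/negP => h3.
  have : (c.+1 * u <= (n * (n * n)).+1 * u)%N by rewrite leq_mul2r h3 orbT.
  by rewrite mulSn; lia.
have prod1 : \prod_j z 0 j <= 1.
  by apply: prodr_ile1 => j _; have /andP[h1 h2] := z01 j; rewrite ltW.
have : 2 ^+ c <= M ^+ n.
  rewrite exprVn in hp; rewrite -[leRHS]mulr1 -ler_pdivrMl ?exprn_gt0 //.
  by apply: le_trans hp prod1.
rewrite /M -!natrX ler_nat => h; have := leq_trans h (fact_exp n).
by rewrite leq_exp2l //; lia.
Qed.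

Local Open Scope nat_scope.

(** * The decision procedure *)

Notation triple := (nat * nat * nat)%type.

(** Read backwards, a number starts with its terminator [false], which opens a new counter; every
    [true] then increments it. *)
Definition read_num (acc : seq nat) (b : bool) :=
  if b then (head 0 acc).+1 :: behead acc else 0 :: acc.

Definition read_nums (l : seq bool) : seq nat := foldl read_num [::] l.

(** [st.1] keeps the numbers of an unfinished triple, the latest first. *)
Definition read_triple (st : seq nat * seq triple) (a : nat) :=
  if 2 <= size st.1 then ([::], (nth 0 st.1 1, nth 0 st.1 0, a) :: st.2)
  else (a :: st.1, st.2).

Definition read_triples (l : seq nat) : seq triple :=
  (foldl read_triple ([::], [::]) l).2.

Definition closed_at n (T : seq triple) (t : triple) :=
  [&& (t.2, t.1.2, t.1.1) \in T, (t.1.1, t.1.1, t.1.2) \in T,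
      (t.1.1, t.1.1, t.2) \in T,
      (t.1.1 == t.2) ==> ((t.1.2, t.1.1, t.1.2) \in T) &
      all (fun l => (((t.1.1, l, t.1.1) \in T) ==> ((l, t.1.2, t.2) \in T)) &&
                    (((t.1.2, l, t.1.2) \in T) ==> ((t.1.1, l, t.2) \in T)))
          (iota 0 n)].

(** A fork (A, B, A) means that A and B are almost surely equal. Their length would be 0, so
    equations that involve such a pair are left out. *)
Definition separated (T : seq triple) i j := (i != j) && ((i, j, i) \notin T).

(** The empty list reads as a zero row, that is, as no equation. *)
Definition triple_row n (T : seq triple) (t : triple) : seq int :=
  if [&& separated T t.1.1 t.1.2, separated T t.1.2 t.2 & separated T t.1.1 t.2]
  then [seq zsub (zadd (eqz v (t.1.1 * n + t.1.2)) (eqz v (t.1.2 * n + t.2)))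
              (eqz v (t.1.1 * n + t.2)) | v <- iota 0 (n * n)]
  else [::].

Definition sym_row n i j : seq int :=
  [seq zsub (eqz v (i * n + j)) (eqz v (j * n + i)) | v <- iota 0 (n * n)].

Definition system n (T : seq triple) : seq (seq int) :=
  map (triple_row n T) T ++
  flatten [seq [seq sym_row n i j | j <- iota 0 n] | i <- iota 0 n].

Definition decide n (T : seq triple) : bool :=
  all (closed_at n T) T && lp_feasible (n * n) (system n T).

(* The input is read from its last letter on, since load reverses it. *)
Definition decide_bits (l : seq bool) : bool :=
  decide (head 0 (read_nums l)) (read_triples (behead (read_nums l))).

Lemma esize_read_nums l : esize (read_nums l) <= 4 * size l + 1.
Proof.
rewrite /read_nums; elim/last_ind: l => [|l b IH] //.
rewrite foldl_rcons size_rcons; move: (foldl _ _ _) IH => s IH; rewrite /read_num.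
case: b; last by rewrite esize_cons esize_nat; lia.
rewrite esize_cons esize_nat; case: s IH => [|a s]; first by rewrite esize_nil /=; lia.
by rewrite esize_cons esize_nat /=; lia.
Qed.

Lemma esize_read_triple l :
  let st := foldl read_triple ([::], [::]) l in
  size st.1 <= 2 /\ esize st.1 + esize st.2 = (esize l).+1.
Proof.
elim/last_ind: l => [|l a] //; rewrite foldl_rcons /=; case: foldl => b T /= [hb IH].
have e : esize (rcons l a) = (esize l + esize a).+1.
  by use (esize_cat l [:: a]); rewrite cats1 esize_cons esize_nil; lia.
rewrite e /read_triple /=; case: b hb IH => [|x [|y [|? ?]]] //= _;
  rewrite ?esize_cons ?esize_pair ?esize_nil => IH; split => //; lia.
Qed.

Lemma ptime_read_nums `{codable E} (l : E -> seq bool) :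
  ptime l -> ptime (fun e => read_nums (l e)).
Proof.
move=> hl; have [T hT eT] := ptime_esize hl.
apply: (ptime_foldl (f := fun _ => read_num) (q := fun n => 4 * T n + 1)); try pt.
  by pbnd.
move=> e i; rewrite -/(read_nums _); apply: leq_trans (esize_read_nums _) _.
rewrite leq_add2r leq_mul2l /=; apply: leq_trans (eT e).
by apply: ltnW; apply: leq_trans (esize_take i (l e)); exact: size_esize.
Qed.
#[export] Hint Resolve ptime_read_nums : pt.

Lemma ptime_read_triples `{codable E} (l : E -> seq nat) :
  ptime l -> ptime (fun e => read_triples (l e)).
Proof.
move=> hl; have [T hT eT] := ptime_esize hl; apply: ptime_snd.
apply: (ptime_foldl (f := fun _ => read_triple) (q := fun n => T n + 3)); try pt.
  by pbnd.
move=> e i; set l' := take i _; have := esize_read_triple l'.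
case: foldl => b U /= [_]; rewrite esize_pair.
by use (esize_take i (l e)); rewrite -/l'; have := eT e; lia.
Qed.
#[export] Hint Resolve ptime_read_triples : pt.

Lemma ptime_triple_row `{codable E} (n : E -> nat) T t :
  ptime n -> ptime T -> ptime t -> ptime (fun e => triple_row (n e) (T e) (t e)).
Proof. by move=> hn hT ht; rewrite /triple_row; pt. Qed.

Lemma ptime_sym_row `{codable E} (n i j : E -> nat) :
  ptime n -> ptime i -> ptime j -> ptime (fun e => sym_row (n e) (i e) (j e)).
Proof. by move=> hn hi hj; rewrite /sym_row; pt. Qed.
#[export] Hint Resolve ptime_triple_row ptime_sym_row : pt.

Lemma ptime_system `{codable E} (n : E -> nat) T :
  ptime n -> ptime T -> ptime (fun e => system (n e) (T e)).
Proof. by move=> hn hT; rewrite /system; pt. Qed.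
#[export] Hint Resolve ptime_system : pt.

Lemma ptime_decide `{codable E} (n : E -> nat) T :
  ptime n -> ptime T -> ptime (fun e => decide (n e) (T e)).
Proof. by move=> hn hT; rewrite /decide; pt. Qed.
#[export] Hint Resolve ptime_decide : pt.

Lemma ptime_decide_bits : ptime decide_bits.
Proof. by rewrite /decide_bits; pt. Qed.

Definition load : cmd :=
  Seq (Push rD false) (pour rX (fun b => pushes (true :: tcode (encode b)))).

Lemma runs_load (w : seq bool) : runs load (st w [::] [::] [::]) (7 * size w + 2)
  (st [::] (tcode (encode (rev w))) [::] [::]).
Proof.
apply: runsW; last first.
  apply: runs_seq; first exact: runs_push.
  rewrite ?upd_st ?st_E.
  have := @runs_pour rX (fun b => pushes (true :: tcode (encode b))) 4
    (fun y (r : seq bool) => st y (tcode (encode r)) [::] [::]) _ _ w [::].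
  rewrite cats0; apply => [y r|b y r]; first by rewrite st_E.
  rewrite upd_st; apply: runsW (runs_pushes _ _ _ _ _).
  by case: b.
by lia.
Qed.

Lemma size_encode_nat n : size (encode_nat n) = n.+1.
Proof. by rewrite size_rcons size_nseq. Qed.

Lemma size_encode_relation (N : finType) (s : seq (N * N * N)) : uniq s ->
  size (encode_relation s) <= 3 * #|N| ^ 4 + #|N|.+1.
Proof.
move=> us; rewrite size_cat size_encode_nat addnC leq_add2r size_flatten /shape -map_comp.
have hs : size s <= #|N| ^ 3.
  by rewrite -(card_uniqP us); apply: leq_trans (max_card _) _; rewrite !card_prod expnSr expnS expn1.
apply: (@leq_trans (size s * (3 * #|N|))); last by rewrite expnS; nia.
elim: s {us hs} => //= t s IH; rewrite mulSn; apply: leq_add => //.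
rewrite !size_cat !size_encode_nat.
have h (x : N) : (enum_rank x).+1 <= #|N| by exact: ltn_ord.
by rewrite !mulSn mul0n addn0; do !apply: leq_add.
Qed.

Lemma horner_monic_pow (k n : nat) : (('X + 2%:P) ^+ k : {poly nat})%R.[n]%R = (n + 2) ^ k.
Proof.
elim: k => [|k IH]; first by rewrite expr0 hornerC.
by rewrite exprS hornerM hornerD hornerX hornerC IH expnS.
Qed.

Theorem decision_machine : exists (M : turing_machine) (p : {poly nat}),
  forall (N : finType) (s : seq (N * N * N)) (Q : Prop), uniq s ->
  (decide_bits (rev (encode_relation s)) <-> Q) ->
  decides_within M (encode_relation s) p.[#|N|]%R Q.
Proof.
case: ptime_decide_bits => c k hc.
have [K hK] : pbound (fun n => (3 * (7 * (3 * n ^ 4 + n.+1) + 2 +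
    (4 * (3 * n ^ 4 + n.+1) + 1 + 2) ^ k)).+1) by pbnd.
exists (machine (Seq load c)), (('X + 2%:P) ^+ K)%R => N s Q us hQ.
have hw := size_encode_relation us; set w := encode_relation s in hw hQ *.
have [t ht ex] : runs (Seq load c) (st w [::] [::] [::])
    (7 * size w + 2 + (esize (rev w) + 2) ^ k)
    (st [::] (tcode (encode (decide_bits (rev w)))) [::] [::]).
  apply: runs_seq (runs_load w) _.
  by have := hc (rev w) [::]; rewrite !cats0.
have [t' ht' dec] : exists2 t', t' <= (3 * t).+1 &
    decides_within (machine (Seq load c)) w t' Q.
  exists (3 * t).+1 => //.
  by move: ex; case: decide_bits hQ => hQ ex; apply: machine_decides ex hQ.
case: dec => b [u [hu1 hu2 hu3]]; exists b, u; split => //.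
rewrite horner_monic_pow; apply: leq_trans (hK _).
apply: leq_trans hu1 (leq_trans ht' _); rewrite ltnS leq_mul2l /=.
apply: leq_trans ht _; apply: leq_add; first by rewrite leq_add2r leq_mul2l.
apply: leq_pow; have /andP[_ h] := esize_bools (rev w).
by apply: leq_trans h _; rewrite size_rev leq_add2r leq_mul2l.
Qed.

Section Reading.
Variables (N : finType).

Definition rank (i : N) : nat := enum_rank i.
Definition ranks (t : N * N * N) : triple := (rank t.1.1, rank t.1.2, rank t.2).

Lemma rank_inj : injective rank.
Proof. by move=> i j /val_inj /enum_rank_inj. Qed.

Lemma rank_lt i : rank i < #|N|.
Proof. exact: ltn_ord. Qed.

Lemma rank_surj k : k < #|N| -> exists i, k = rank i.
Proof. by move=> h; exists (enum_val (Ordinal h)); rewrite /rank enum_valK. Qed.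

Lemma ranks_inj : injective ranks.
Proof. by move=> [[i j] k] [[i' j'] k'] [/rank_inj -> /rank_inj -> /rank_inj ->]. Qed.

Lemma read_encode_nat a w :
  foldr (fun b acc => read_num acc b) [::] (encode_nat a ++ w) =
  a :: foldr (fun b acc => read_num acc b) [::] w.
Proof.
rewrite foldr_cat /encode_nat -cats1 foldr_cat /=.
by elim: a => //= a ->.
Qed.

Lemma decide_bits_encode (s : seq (N * N * N)) :
  decide_bits (rev (encode_relation s)) = decide #|N| (rev (map ranks s)).
Proof.
rewrite /decide_bits /read_nums foldl_rev /encode_relation read_encode_nat /=.
congr (decide _ _).
have -> : foldr (fun b acc => read_num acc b) [::] (flatten [seq encode_nat (enum_rank t.1.1) ++
     encode_nat (enum_rank t.1.2) ++ encode_nat (enum_rank t.2) | t <- s]) =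
   flatten [seq [:: rank t.1.1; rank t.1.2; rank t.2] | t <- s].
  by elim: s => //= t s IH; rewrite -!catA !read_encode_nat IH.
have h U : foldl read_triple ([::], U) (flatten [seq [:: rank t.1.1; rank t.1.2; rank t.2] | t <- s])
    = ([::], rev (map ranks s) ++ U).
  by elim: s U => //= t s IH U; rewrite IH rev_cons cat_rcons.
by rewrite /read_triples h cats0.
Qed.

End Reading.

Section Decide.
Variables (N : finType) (r : {set N * N * N}) (T : seq triple).
Hypothesis rT : forall i j k, ((rank i, rank j, rank k) \in T) = ((i, j, k) \in r).
Hypothesis T_ranks : forall t, t \in T -> exists i j k : N, t = (rank i, rank j, rank k) :> triple.
Let n := #|N|.

(** For a representable relation, (i, i, j) says that the covariance is positive and (i, j, i) that
    the events are almost surely equal. The rules are reversal of a fork with its positive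
    covariances, symmetry of equality, and substitution of equals at an end and in the middle. *)
Definition fork_axioms := [/\
  forall i j k, (i, j, k) \in r ->
    [/\ (k, j, i) \in r, (i, i, j) \in r & (i, i, k) \in r],
  forall i j, (i, j, i) \in r -> (j, i, j) \in r,
  forall i j k l, (i, j, k) \in r -> (i, l, i) \in r -> (l, j, k) \in r &
  forall i j k l, (i, j, k) \in r -> (j, l, j) \in r -> (i, l, k) \in r].

Definition apart i j := (i != j) && ((i, j, i) \notin r).

(** Stated over any commutative monoid, as it is used with real logarithms, with the unknowns of the
    system and with natural numbers. *)
Definition additive_on (V : nmodType) (x : N -> N -> V) :=
  (forall i j, x i j = x j i) /\
  (forall i j k, (i, j, k) \in r -> apart i j -> apart j k -> apart i k ->
     (x i j + x j k)%R = x i k).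

Lemma separatedE i j : separated T (rank i) (rank j) = apart i j.
Proof. by rewrite /separated /apart rT (inj_eq (@rank_inj N)). Qed.

Lemma closedP : reflect fork_axioms (all (closed_at n T) T).
Proof.
apply: (iffP allP) => [h|[h1 h2 h3 h4] t /[dup] ht /T_ranks[i [j [k et]]]].
  have {}h i j k : (i, j, k) \in r -> closed_at n T (rank i, rank j, rank k).
    by rewrite -rT => /h.
  split.
  - by move=> i j k /h /and5P[/= + + + _ _]; rewrite !rT.
  - by move=> i j /h /and5P[/= _ _ _ + _]; rewrite eqxx rT.
  - move=> i j k l /h /and5P[/= _ _ _ _ /allP /(_ (rank l))].
    by rewrite mem_iota rank_lt !rT => /(_ isT) /andP[/implyP].
  - move=> i j k l /h /and5P[/= _ _ _ _ /allP /(_ (rank l))].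
    by rewrite mem_iota rank_lt !rT => /(_ isT) /andP[_ /implyP].
rewrite et in ht *; rewrite rT in ht; have [a1 a2 a3] := h1 _ _ _ ht.
rewrite /closed_at /= !rT a1 a2 a3 (inj_eq (@rank_inj N)) /=; apply/andP; split.
  by apply/implyP => /eqP e; apply: h2; rewrite {2}e.
apply/allP => p; rewrite mem_iota => /andP[_ /rank_surj[l ->]]; rewrite !rT.
by apply/andP; split; apply/implyP; [exact: h3|exact: h4].
Qed.

Lemma index_lt (i j : N) : rank i * n + rank j < n * n.
Proof. by have := rank_lt i; have := rank_lt j; rewrite -/n; nia. Qed.

Definition index_of i j : 'I_(n * n) := Ordinal (index_lt i j).

Lemma index_eq (a b c d : N) :
  (rank a * n + rank b == rank c * n + rank d) = (a == c) && (b == d).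
Proof.
apply/eqP/andP => [e|[/eqP -> /eqP ->]//].
have hb := rank_lt b; have hd := rank_lt d; rewrite -/n in hb hd.
have e2 : rank b = rank d by have := congr1 (modn^~ n) e; rewrite !modnMDl !modn_small.
have n0 : 0 < n by lia.
have e1 : rank a = rank c.
  by move/eqP: e; rewrite e2 eqn_add2r eqn_pmul2r // => /eqP.
by rewrite (rank_inj e1) (rank_inj e2).
Qed.

Lemma sum_eqz (R : pzRingType) (x : 'rV[R]_(n * n)) i j :
  (\sum_(v < n * n) (eqz v (rank i * n + rank j))%:~R * x 0 v = x 0 (index_of i j))%R.
Proof.
rewrite (bigD1 (index_of i j)) //= /eqz eqxx mul1r big1 ?addr0 // => v.
by rewrite -val_eqE /= => /negPf ->; rewrite mul0r.
Qed.

Lemma sym_row_sum (R : pzRingType) (x : 'rV[R]_(n * n)) i j :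
  (\sum_(v < n * n) (nth 0 (sym_row n (rank i) (rank j)) v)%:~R * x 0 v =
   x 0 (index_of i j) - x 0 (index_of j i))%R.
Proof.
rewrite -!sum_eqz -sumrB; apply: eq_bigr => v _.
by rewrite nth_mkseq_iota // /zsub intrB mulrBl.
Qed.

Lemma triple_row_sum (R : pzRingType) (x : 'rV[R]_(n * n)) i j k :
  (\sum_(v < n * n) (nth 0 (triple_row n T (rank i, rank j, rank k)) v)%:~R * x 0 v =
   if [&& apart i j, apart j k & apart i k] then
   x 0 (index_of i j) + x 0 (index_of j k) - x 0 (index_of i k) else 0)%R.
Proof.
rewrite /triple_row /= !separatedE; case: ifP => _; last first.
  by rewrite big1 // => v _; rewrite nth_nil mul0r.
rewrite -!sum_eqz -big_split -sumrB; apply: eq_bigr => v _ /=.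
by rewrite nth_mkseq_iota // /zsub /zadd intrB intrD mulrBl mulrDl.
Qed.

Lemma annihilates_system (R : comPzRingType) (x : 'rV[R]_(n * n)) :
  annihilates (system n T) x <-> additive_on (fun i j => x 0 (index_of i j))%R.
Proof.
split=> [/annihilatesP h|[h1 h2]]; last apply/annihilatesP => a.
  split=> [i j|i j k hr h1 h2 h3].
    apply/eqP; rewrite -subr_eq0 -sym_row_sum; apply/eqP; apply: h.
    rewrite mem_cat; apply/orP; right; apply/flattenP.
    exists [seq sym_row n (rank i) j | j <- iota 0 n].
      by apply/mapP; exists (rank i); rewrite // mem_iota rank_lt.
    by apply/mapP; exists (rank j); rewrite // mem_iota rank_lt.
  apply/eqP; rewrite -subr_eq0.
  have := triple_row_sum x i j k; rewrite h1 h2 h3 /= => <-; apply/eqP; apply: h.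
  by rewrite mem_cat; apply/orP; left; apply: map_f; rewrite rT.
rewrite mem_cat => /orP[/mapP[t /[dup] ht /T_ranks[i [j [k et]]] ->]|].
  rewrite et triple_row_sum; case: ifP => // /and3P[a1 a2 a3].
  by rewrite h2 ?subrr // -rT -et.
move=> /flattenP[_ /mapP[p + ->] /mapP[q + ->]]; rewrite !mem_iota.
by move=> /andP[_ /rank_surj[i ->]] /andP[_ /rank_surj[j ->]]; rewrite sym_row_sum h1 subrr.
Qed.

(** An entry 2 would need the pairs (i, j) and (j, k) to coincide, so i = j, which [separated]
    excludes. Entries of size at most 1 are what the bound n! on solutions rests on. *)
Lemma system_small a j : a \in system n T -> (`|nth 0 a j| <= 1)%R.
Proof.
case: (ltnP j (size a)) => hj; last by rewrite nth_default.
rewrite mem_cat => /orP[/mapP[t /T_ranks[i [k [l et]]] ea]|].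
  rewrite ea et /triple_row /= !separatedE in hj *; move: hj.
  case: ifP => // /and3P[/andP[ne1 _] /andP[ne2 _] _]; rewrite size_map size_iota => hj.
  rewrite nth_mkseq_iota // /zsub /zadd /eqz.
  case: eqP => [->|_]; last by do 2!case: eqP.
  by rewrite index_eq (negPf ne1) /=; case: eqP.
move=> /flattenP[_ /mapP[p _ ->] /mapP[q _ ea]]; rewrite ea size_map size_iota in hj *.
by rewrite nth_mkseq_iota // /zsub /eqz; do 2!case: eqP.
Qed.

Lemma decide_sound : decide n T -> fork_axioms /\
  exists2 x : N -> N -> nat, (forall i j, 0 < x i j) & additive_on x.
Proof.
move=> /andP[/closedP ax /lp_feasible_sound[x x0 /annihilates_system[h1 h2]]].
split=> //; exists (fun i j => `|x 0%R (index_of i j)|%N) => [i j|].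
  by have := x0 (index_of i j); lia.
split=> [i j|i j k a1 a2 a3 a4]; first by rewrite h1.
rewrite -(h2 i j k) //; have := x0 (index_of i j); have := x0 (index_of j k).
move: (x 0%R (index_of i j)) (x 0%R (index_of j k)) => u v v0 u0.
change (`|u| + `|v| = `|(u + v)%R|); lia.
Qed.

Lemma decide_complete (R : realFieldType) (x : N -> N -> R) :
  fork_axioms -> (forall i j, (0 < x i j)%R) -> additive_on x -> decide n T.
Proof.
move=> /closedP ax x0 [h1 h2]; apply/andP; split => //.
(* The filler 1 is positive, as all entries of [y] have to be. *)
pose y : 'rV[R]_(n * n) := (\row_v (if [pick p : N * N | index_of p.1 p.2 == v]
   is Some p then x p.1 p.2 else 1))%R.
have yE i j : y 0%R (index_of i j) = x i j.
  rewrite mxE; case: pickP => [[a b] /=|/(_ (i, j))]; last by rewrite eqxx.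
  by rewrite -val_eqE /= index_eq => /andP[/eqP -> /eqP ->].
apply: (@lp_feasible_complete R _ _ y).
- by move=> a j; apply: system_small.
- by move=> v; rewrite mxE; case: pickP => // _; rewrite ltr01.
- apply/annihilates_system; split=> [i j|i j k *]; rewrite !yE //; exact: h2.
Qed.

End Decide.

Local Open Scope ring_scope.

(** * Signs with prescribed correlations *)

Section Walsh.
Variables (R : realFieldType) (N : finType).
Implicit Types (S U o : {set N}) (a b c : N).

Definition spin a o : R := if a \in o then 1 else -1.
Definition walsh S o : R := \prod_(a in S) spin a o.

Lemma spin_sqr a o : spin a o * spin a o = 1.
Proof. by rewrite /spin; case: ifP => _; rewrite ?mulr1 ?mulrNN ?mulr1. Qed.

Lemma walsh_norm S o : `|walsh S o| = 1.
Proof.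
by rewrite normr_prod big1 // => a _; rewrite /spin; case: ifP; rewrite ?normrN normr1.
Qed.

Lemma walsh0 o : walsh set0 o = 1.
Proof. by rewrite /walsh big_set0. Qed.

Lemma walsh1 a o : walsh [set a] o = spin a o.
Proof. by rewrite /walsh big_set1. Qed.

Lemma walsh2 a b o : a != b -> walsh [set a; b] o = spin a o * spin b o.
Proof. by move=> ne; rewrite /walsh big_setU1 ?inE // big_set1. Qed.

Lemma walsh3 a b c o : a != b -> a != c -> b != c ->
  walsh [set a; b; c] o = spin a o * spin b o * spin c o.
Proof.
move=> ab ac bc; rewrite -[[set a; b; c]]setUA /walsh big_setU1 ?inE ?negb_or ?ab //=.
by rewrite -mulrA big_setU1 ?inE // big_set1.
Qed.

Definition flip a o : {set N} := if a \in o then o :\ a else a |: o.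

Lemma flipK a : involutive (flip a).
Proof.
move=> o; rewrite /flip; case: (boolP (a \in o)) => h; first by rewrite !inE eqxx /= setD1K.
by rewrite !inE eqxx /= setU1K.
Qed.

Lemma spin_flip a b o : spin b (flip a o) = if b == a then - spin b o else spin b o.
Proof.
rewrite /spin /flip; case: (eqVneq b a) => [->|ne].
  by case: (boolP (a \in o)) => h; rewrite !inE eqxx //= opprK.
by case: (boolP (a \in o)) => h; rewrite !inE (negPf ne).
Qed.

Lemma walsh_flip a S o : walsh S (flip a o) = if a \in S then - walsh S o else walsh S o.
Proof.
rewrite /walsh; case: (boolP (a \in S)) => h.
  rewrite !(bigD1 a h) /= spin_flip eqxx mulNr; congr (- (_ * _)).
  by apply: eq_bigr => b /andP[_ /negPf ne]; rewrite spin_flip ne.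
apply: eq_bigr => b hb; rewrite spin_flip; case: eqP => // e.
by rewrite -e hb in h.
Qed.

(** Flipping an element on which S and U differ changes the sign of every term, so the sum is its
    own opposite. *)
Lemma walsh_ortho S U : S != U -> \sum_o walsh S o * walsh U o = 0.
Proof.
move=> ne; have [a ha] : exists a, (a \in S) != (a \in U).
  apply/existsP; apply: contraNT ne; rewrite negb_exists => /forallP h.
  by apply/eqP/setP => a; have := h a; rewrite negbK => /eqP.
set s := \sum_o _; suff h : s = - s.
  by lra.
rewrite /s {1}(reindex_inj (inv_inj (flipK a))) -sumrN; apply: eq_bigr => o _.
by rewrite !walsh_flip; move: ha; case: (a \in S); case: (a \in U) => // _; rewrite ?mulNr ?mulrN.
Qed.

Let card_sets : #|{set N}| = (2 ^ #|N|)%N.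
Proof. by rewrite -[RHS](congr1 (expn 2) (cardsT N)) -card_powerset powersetT cardsT. Qed.

Lemma walsh_sqr S : \sum_o walsh S o * walsh S o = (2 ^ #|N|)%:R.
Proof.
rewrite -card_sets -sum1_card natr_sum; apply: eq_bigr => o _.
by rewrite -expr2 -real_normK ?num_real // walsh_norm expr1n.
Qed.

Variable f : {set N} -> R.
Let q : R := ((2 ^ #|N|)%:R)^-1.

(** Inverse Walsh transform of [f], by which [f U] becomes the expectation of the character
    [walsh U]. *)
Definition density o : R := q * \sum_S f S * walsh S o.

Let q0 : 0 < q. Proof. by rewrite invr_gt0 ltr0n expn_gt0. Qed.

Lemma density_walsh U : \sum_o density o * walsh U o = f U.
Proof.
under eq_bigr do rewrite /density -mulrA mulr_suml.
rewrite -mulr_sumr exchange_big (bigD1 U) //= [X in _ + X]big1 ?addr0.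
  under eq_bigr do rewrite -mulrA; rewrite -mulr_sumr walsh_sqr mulrCA /q mulVf ?mulr1 //.
  by rewrite pnatr_eq0 -lt0n expn_gt0.
by move=> S ne; under eq_bigr do rewrite -mulrA; rewrite -mulr_sumr walsh_ortho // mulr0.
Qed.

Hypotheses (f0 : f set0 = 1) (f_small : forall S, S != set0 -> `|f S| <= q).

(** There are 2^|N| coefficients, and all but the constant 1 are at most q = 2^(-|N|) in size, so
    the constant dominates the rest. *)
Lemma density_ge0 o : 0 <= density o.
Proof.
rewrite /density mulr_ge0 ?(ltW q0) // (bigD1 set0) //= f0 walsh0 mulr1.
suff h : `|\sum_(S | S != set0) f S * walsh S o| <= 1.
  by have := ler_norml (\sum_(S | S != set0) f S * walsh S o) 1; rewrite h => /esym/andP[]; lra.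
apply: le_trans (ler_norm_sum _ _ _) _.
apply: (@le_trans _ _ (\sum_(S : {set N}) q)); last first.
  by rewrite sumr_const card_sets -mulr_natl /q divff // pnatr_eq0 -lt0n expn_gt0.
apply: (@le_trans _ _ (\sum_(S : {set N} | S != set0) q)).
  by apply: ler_sum => S ne; rewrite normrM walsh_norm mulr1 f_small.
by rewrite [leRHS](bigID (fun S => S != set0)) /= lerDl sumr_ge0 // => S _; exact: ltW.
Qed.

Lemma density_sum : \sum_o density o = 1.
Proof. by rewrite -[RHS]f0 -density_walsh; apply: eq_bigr => o _; rewrite walsh0 mulr1. Qed.

Hypothesis f1 : forall a, f [set a] = 0.

Definition corr a b : R := if a == b then 1 else f [set a; b].
Definition triple_moment a b c : R := \sum_o density o * (spin a o * spin b o * spin c o).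

Lemma moment1 a : \sum_o density o * spin a o = 0.
Proof. by rewrite -[RHS](f1 a) -density_walsh; apply: eq_bigr => o _; rewrite walsh1. Qed.

Lemma moment2 a b : \sum_o density o * (spin a o * spin b o) = corr a b.
Proof.
rewrite /corr; case: (eqVneq a b) => [->|ne].
  by rewrite -density_sum; apply: eq_bigr => o _; rewrite spin_sqr mulr1.
by rewrite -density_walsh; apply: eq_bigr => o _; rewrite walsh2.
Qed.

Lemma corr_sym a b : corr a b = corr b a.
Proof. by rewrite /corr eq_sym setUC. Qed.

Lemma triple_moment_eq a c : triple_moment a a c = 0.
Proof. by rewrite -(moment1 c); apply: eq_bigr => o _; rewrite spin_sqr mul1r. Qed.

Lemma triple_moment_swap a b c : triple_moment a b c = triple_moment b c a.
Proof. by apply: eq_bigr => o _; congr (_ * _); ring. Qed.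

Lemma triple_moment_ne a b c : a != b -> a != c -> b != c -> triple_moment a b c = f [set a; b; c].
Proof.
by move=> *; rewrite -density_walsh; apply: eq_bigr => o _; rewrite walsh3.
Qed.

(** As (1 + spin)/2 is the indicator of membership, the probability of an intersection is a
    polynomial in the moments of the spins. *)
Let half (P : pred {set N}) (h : {set N} -> R) :
  (forall o, h o = (P o)%:R) -> \sum_(o | P o) density o = \sum_o density o * h o.
Proof.
move=> e; rewrite big_mkcond; apply: eq_bigr => o _; rewrite e.
by case: (P o); rewrite ?mulr1 ?mulr0.
Qed.

Let ind a o : (1 + spin a o) / 2 = (a \in o)%:R.
Proof. by rewrite /spin; case: (a \in o) => /=; lra. Qed.

Lemma prob1 a : \sum_(o : {set N} | a \in o) density o = 1 / 2.
Proof.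
rewrite (half (h := fun o => (1 + spin a o) / 2)) //.
transitivity ((\sum_o (density o + density o * spin a o)) / 2).
  by rewrite mulr_suml; apply: eq_bigr => o _; ring.
by rewrite big_split /= density_sum moment1 addr0.
Qed.

Lemma prob2 a b : \sum_(o : {set N} | (a \in o) && (b \in o)) density o = (1 + corr a b) / 4.
Proof.
rewrite (half (h := fun o => (1 + spin a o) / 2 * ((1 + spin b o) / 2))); last first.
  by move=> o; rewrite !ind -natrM mulnb.
transitivity ((\sum_o (density o + density o * spin a o + density o * spin b o
    + density o * (spin a o * spin b o))) / 4).
  by rewrite mulr_suml; apply: eq_bigr => o _; field.
by rewrite !big_split /= density_sum !moment1 moment2 !addr0.
Qed.

(** The order a, c, b is that of the triple intersection in [forkE]. *)
Lemma prob3 a b c : \sum_(o : {set N} | [&& a \in o, c \in o & b \in o]) density o =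
  (1 + corr a b + corr b c + corr a c + triple_moment a b c) / 8.
Proof.
rewrite (half (h := fun o => (1 + spin a o) / 2 * ((1 + spin b o) / 2) * ((1 + spin c o) / 2))); last first.
  by move=> o; rewrite !ind -!natrM !mulnb -andbA [(c \in o) && _]andbC.
transitivity ((\sum_o (density o + density o * spin a o + density o * spin b o + density o * spin c o
    + density o * (spin a o * spin b o) + density o * (spin b o * spin c o)
    + density o * (spin a o * spin c o) + density o * (spin a o * spin b o * spin c o))) / 8).
  by rewrite mulr_suml; apply: eq_bigr => o _; field.
by rewrite !big_split /= density_sum !moment1 !moment2 !addr0.
Qed.

End Walsh.

(** * Realization by events of probability 1/2 *)

Section Realization.
Variables (R : realFieldType) (N : finType) (r : {set N * N * N}) (x : N -> N -> nat).
Hypotheses (ax : fork_axioms r) (x0 : forall i j, (0 < x i j)%N) (xadd : additive_on r x).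
Implicit Types (i j k a b c : N) (U : {set N}).

(** An index that is not live occurs in no fork; it will get the empty event. *)
Definition live i := (i, i, i) \in r.
(** Indices of almost surely equal events share one spin. [pick] depends only on the class of [i],
    so the whole class has the same representative. *)
Definition rep i := odflt i [pick j | (i, j, i) \in r].

Let q : R := ((2 ^ #|N|)%:R)^-1.

(* Singletons get coefficient 0, so every event gets probability 1/2; a triple gets
   coefficient 0 exactly when it supports a fork. *)
Definition spectrum U : R :=
  if U == set0 then 1 else
  if [pick p | [&& p.1 != p.2, U == [set p.1; p.2] & (p.1, p.1, p.2) \in r]] is Some p
  then q ^+ x p.1 p.2 else
  if (#|U| == 3) && ~~ [exists t in r, U == [set t.1.1; t.1.2; t.2]] then q else 0.

Let rho := corr spectrum.
Let moment3 := triple_moment spectrum.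

Let rho_sym a b : rho a b = rho b a. Proof. exact: corr_sym. Qed.
Let q0 : 0 < q. Proof. by rewrite invr_gt0 ltr0n expn_gt0. Qed.
Let q1 : q <= 1.
Proof. by rewrite invf_le1 ?ltr0n ?expn_gt0 // ler1n expn_gt0. Qed.
Let q_lt1 a : q < 1.
Proof.
rewrite invf_lt1 ?ltr0n ?expn_gt0 // ltr1n -[1%N](expn0 2) ltn_exp2l //.
by apply/card_gt0P; exists a.
Qed.

Let q_exp i j : 0 < q ^+ x i j <= q.
Proof.
rewrite exprn_gt0 //=; case: (x i j) (x0 i j) => // n _.
by rewrite exprS ler_piMr ?(ltW q0) // exprn_ile1 ?(ltW q0).
Qed.

Lemma spectrum0 : spectrum set0 = 1.
Proof. by rewrite /spectrum eqxx. Qed.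

Lemma spectrum_small U : U != set0 -> `|spectrum U| <= q.
Proof.
rewrite /spectrum => /negPf ->; case: pickP => [p _|_].
  by have /andP[h1 h2] := q_exp p.1 p.2; rewrite gtr0_norm.
by case: ifP => _; rewrite ?normr0 ?gtr0_norm // ltW.
Qed.

Let no_pair U : (#|U| != 2)%N ->
  [pick p : N * N | [&& p.1 != p.2, U == [set p.1; p.2] & (p.1, p.1, p.2) \in r]] = None.
Proof.
case: pickP => // p /and3P[ne /eqP -> _].
by rewrite cards2 ne.
Qed.

Lemma spectrum1 a : spectrum [set a] = 0.
Proof.
rewrite /spectrum no_pair ?cards1 //=.
by rewrite -cards_eq0 cards1.
Qed.

Lemma edge_flip i j : (i, i, j) \in r -> (j, j, i) \in r.
Proof. by case: ax => h _ _ _ /h[/h[]]. Qed.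

Lemma spectrum2 a b : a != b ->
  spectrum [set a; b] = if (a, a, b) \in r then q ^+ x a b else 0.
Proof.
move=> ne; rewrite /spectrum -cards_eq0 cards2 ne /=; case: pickP => [[c d]|h] /=.
  move=> /and3P[ne' /eqP e h].
  have : (c \in [set a; b]) && (d \in [set a; b]) by rewrite e !inE !eqxx orbT.
  (* [pick] may return the pair in either order; edges and [x] are symmetric, so both give the same
     value. *)
  rewrite !inE => /andP[/orP[] /eqP ec /orP[] /eqP ed]; move: ne' h; rewrite ec ed ?eqxx //.
    by move=> _ ->.
  by move=> _ /edge_flip ->; case: xadd => ->.
by have := h (a, b); rewrite /= ne eqxx /= => ->.
Qed.

Let card3 a b c : a != b -> a != c -> b != c -> #|[set a; b; c]| = 3.
Proof. by move=> ab ac bc; rewrite -setUA cardsU1 !inE negb_or ab ac cards2 bc. Qed.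

Lemma spectrum3 a b c : a != b -> a != c -> b != c ->
  spectrum [set a; b; c] =
  if [exists t in r, [set a; b; c] == [set t.1.1; t.1.2; t.2]] then 0 else q.
Proof.
move=> ab ac bc; have h := card3 ab ac bc.
by rewrite /spectrum no_pair ?h // -cards_eq0 h /=; case: [exists t, _].
Qed.

Lemma fork_live i j k : (i, j, k) \in r -> [/\ live i, live j & live k].
Proof.
case: ax => h _ _ _.
have first a b c : (a, b, c) \in r -> live a by move=> /h[_ /h[_ ? _] _].
move=> /[dup] /h[h1 h2 _] h3; split; [exact: first h3| |exact: first h1].
exact: first (edge_flip h2).
Qed.

Lemma rep_same i : live i -> (i, rep i, i) \in r.
Proof. by rewrite /rep; case: pickP => // h; rewrite /live h. Qed.

Lemma fork_relabel i j k i' j' k' : (i, i', i) \in r -> (j, j', j) \in r -> (k, k', k) \in r ->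
  (i, j, k) \in r -> (i', j', k') \in r.
Proof.
case: ax => h _ h3 h4 hi hj hk /h3/(_ hi)/h4/(_ hj)/h[/h3/(_ hk)/h[]]//.
Qed.

Lemma same_rep i j : (i, j, i) \in r -> rep i = rep j.
Proof.
case: ax => _ sym _ tr hij; rewrite /rep.
have e k : ((i, k, i) \in r) = ((j, k, j) \in r).
  apply/idP/idP => h; last exact: tr hij h.
  exact: tr (sym _ _ hij) h.
rewrite (eq_pick e); case: pickP => // /(_ j).
by have [_ _] := fork_live hij; have [_ hj _] := fork_live hij; rewrite -[_ \in _]/(live j) hj.
Qed.

Lemma rep_fork i j k : live i -> live j -> live k ->
  ((i, j, k) \in r) = ((rep i, rep j, rep k) \in r).
Proof.
case: ax => _ sym _ _ hi hj hk.
by apply/idP/idP; apply: fork_relabel; rewrite ?rep_same // sym // rep_same.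
Qed.

Definition canonical a := live a && (rep a == a).

Lemma rep_canonical i : live i -> canonical (rep i).
Proof.
move=> h; have hr := rep_same h; have [_ hl _] := fork_live hr.
by rewrite /canonical hl -(same_rep hr) eqxx.
Qed.

Lemma canonical_apart a b : canonical a -> canonical b -> a != b -> apart r a b.
Proof.
move=> /andP[_ /eqP ea] /andP[_ /eqP eb] ne; rewrite /apart ne.
by apply: contraNN ne => /same_rep; rewrite ea eb => ->.
Qed.

Lemma rho_lt1 a b : a != b -> rho a b < 1.
Proof.
move=> ne; rewrite /rho /corr (negPf ne) spectrum2 //; case: ifP => _; last exact: ltr01.
by have /andP[_ h] := q_exp a b; apply: le_lt_trans h (q_lt1 a).
Qed.

Lemma rho_gt0 a b : live a -> (0 < rho a b) = ((a, a, b) \in r).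
Proof.
move=> h; rewrite /rho /corr; case: (eqVneq a b) => [<-|ne].
  by rewrite ltr01 -[_ \in _]/(live a) h.
rewrite spectrum2 //; case: ifP => _; last by rewrite ltxx.
by have /andP[] := q_exp a b.
Qed.

(** At probability 1/2 the two independence equations read rho a c + m = rho a b rho b c and rho a c
    - m = rho a b rho b c, with m the third moment. *)
Definition walsh_fork a b c :=
  [/\ 0 < rho a b, 0 < rho b c, rho a c = rho a b * rho b c & moment3 a b c = 0].

Lemma fork_walsh a b c : canonical a -> canonical b -> canonical c ->
  (a, b, c) \in r -> walsh_fork a b c.
Proof.
move=> ca cb cc h; have [h1 _ _ _] := ax; have [hs hab hac] := h1 _ _ _ h.
have [_ hcb _] := h1 _ _ _ hs; have hbc := edge_flip hcb.
have [la lb lc] := fork_live h.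
rewrite /walsh_fork !rho_gt0 //; split => //.
  case: (eqVneq a b) => [->|ab]; first by rewrite [rho b b]/corr eqxx mul1r.
  case: (eqVneq b c) => [->|bc]; first by rewrite [rho c c]/corr eqxx mulr1.
  have [ac|ac] := eqVneq a c.
    by have /andP[_] := canonical_apart ca cb ab; rewrite [in X in (_, _, X)]ac h.
  rewrite /rho /corr (negPf ab) (negPf bc) (negPf ac) !spectrum2 // hab hbc hac -exprD.
  by congr (q ^+ _); case: xadd => _ /(_ a b c) <- //; exact: canonical_apart.
case: (eqVneq a b) => [->|ab]; first exact: triple_moment_eq spectrum1 _ _.
case: (eqVneq b c) => [->|bc].
  by rewrite /moment3 triple_moment_swap; exact: triple_moment_eq spectrum1 _ _.
case: (eqVneq a c) => [->|ac].
  by rewrite /moment3 -triple_moment_swap; exact: triple_moment_eq spectrum1 _ _.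
rewrite /moment3 triple_moment_ne // spectrum3 // ifT //.
by apply/existsP; exists (a, b, c); rewrite h eqxx.
Qed.

Let fork_middle a b c u w : a != b -> b != c -> a != c ->
  [set a; b; c] = [set u; b; w] -> (u, b, w) \in r -> (a, b, c) \in r.
Proof.
move=> ab bc ac e h.
have : (a \in [set u; b; w]) && (c \in [set u; b; w]) by rewrite -e !inE !eqxx !orbT.
rewrite !inE (negPf ab) [c == b]eq_sym (negPf bc) !orbF.
case/andP => /orP[] /eqP ea /orP[] /eqP ec; move: ac h; rewrite ea ec ?eqxx //.
by case: ax => hs _ _ _ _ /hs[].
Qed.

Let absurd_product (z y : R) : 0 < z -> 0 < y -> z < 1 -> y != z * (z * y).
Proof.
move=> z0 y0 z1; rewrite gt_eqF // mulrA gtr_pMl //.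
by apply: mulr_ilt1; rewrite ?ltW.
Qed.

(** A vanishing third moment means that the three indices support some fork. Were its middle a, then
    rho b c = rho a b rho a c = (rho a b)^2 rho b c, against 0 < rho a b < 1; c is excluded
    likewise. *)
Lemma walsh_forkK a b c : canonical a -> canonical b -> canonical c ->
  walsh_fork a b c -> (a, b, c) \in r.
Proof.
move=> ca cb cc [pab pbc e m].
have [hs _ _ _] := ax; have [la _] := andP ca; have [lb _] := andP cb; have [lc _] := andP cc.
case: (eqVneq a b) => [eab|ab]; first by move: pbc; rewrite rho_gt0 // eab.
case: (eqVneq b c) => [ebc|bc].
  by move: pab; rewrite rho_gt0 // -ebc => /edge_flip/hs[].
case: (eqVneq a c) => [eac|ac].
  move: e (rho_lt1 ab) pab; rewrite [rho b c]rho_sym -eac {1}/rho /corr eqxx.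
  move: (rho a b) => z; nra.
move: m; rewrite /moment3 triple_moment_ne // spectrum3 //; case: existsP => [|_ /eqP]; last first.
  by rewrite gt_eqF.
case=> -[[u v] w] /andP[/= h /eqP es] _.
have : v \in [set a; b; c] by rewrite es !inE eqxx orbT.
rewrite !inE -orbA => /or3P[] /eqP ev; move: es h; rewrite ev.
- rewrite -[[set a; b; c]]/(a |: [set b] :|: [set c]) [[set a] :|: [set b]]setUC => es h.
  have /(fork_walsh cb ca cc)[_ _ + _] := fork_middle (negbT (etrans (eq_sym _ _) (negPf ab))) ac bc es h.
  by rewrite e [rho b a]rho_sym => /eqP; rewrite (negPf (absurd_product pab pbc (rho_lt1 ab))).
- exact: fork_middle.
rewrite setUAC => es h.
have cb' : c != b by rewrite eq_sym.
have /(fork_walsh ca cc cb)[_ _ + _] := fork_middle ac cb' ab es h.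
rewrite e [rho c b]rho_sym mulrC [rho a b * _]mulrC => /eqP.
by rewrite (negPf (absurd_product pbc pab (rho_lt1 bc))).
Qed.

Lemma mem_walsh_fork i j k : (i, j, k) \in r <->
  [/\ live i, live j, live k & walsh_fork (rep i) (rep j) (rep k)].
Proof.
split=> [h|[hi hj hk h]].
  have [hi hj hk] := fork_live h; split => //.
  by apply: fork_walsh; rewrite ?rep_canonical // -rep_fork.
by rewrite rep_fork //; apply: walsh_forkK => //; exact: rep_canonical.
Qed.

End Realization.

(* Imported only here: its sets take over the notations of finset. *)
From mathcomp Require Import all_classical all_reals all_analysis.

Local Open Scope classical_set_scope.
Local Open Scope ring_scope.

(** * Conjunctive forks *)

Section ForkFacts.
Context {d : measure_display} {T : measurableType d} {R : realType}.
Variable P : probability T R.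

Definition pr (E : set T) : R := fine (P E).
Definition cov A B : R := pr (A `&` B) - pr A * pr B.
Definition var A : R := pr A * (1 - pr A).

Lemma prK E : measurable E -> P E = (pr E)%:E.
Proof. by move=> mE; rewrite /pr fineK // fin_num_measure. Qed.

Lemma pr_ge0 E : 0 <= pr E.
Proof. by rewrite /pr fine_ge0. Qed.

Lemma pr_split E F : measurable E -> measurable F ->
  pr E = pr (E `&` ~` F) + pr (E `&` F).
Proof.
move=> mE mF; apply: EFin_inj; rewrite EFinD -!prK //; last 2 first.
- exact: measurableI.
- by apply: measurableI => //; exact: measurableC.
exact: measureDI.
Qed.

Lemma prI_le E F : measurable E -> measurable F -> pr (E `&` F) <= pr E.
Proof. by move=> mE mF; rewrite (pr_split mE mF) lerDr pr_ge0. Qed.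

Lemma prI_le2 E F : measurable E -> measurable F -> pr (E `&` F) <= pr F.
Proof. by move=> mE mF; rewrite setIC; exact: prI_le. Qed.

Lemma prC E : measurable E -> pr (~` E) = 1 - pr E.
Proof.
move=> mE; apply: EFin_inj; rewrite EFinB -!prK //; last exact: measurableC.
exact: probability_setC.
Qed.

Lemma pr_le1 E : measurable E -> pr E <= 1.
Proof. by move=> mE; have := prC mE; have := pr_ge0 (~` E); lra. Qed.

(** Clears the denominators; the comparisons of conditional probabilities become positive
    covariances. *)
Lemma forkE A B C : measurable A -> measurable B -> measurable C ->
  conjunctive_fork P A B C <->
  [/\ 0 < pr B < 1,
      pr (A `&` C `&` B) * pr B = pr (A `&` B) * pr (C `&` B),
      (pr (A `&` C) - pr (A `&` C `&` B)) * (1 - pr B) =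
        (pr A - pr (A `&` B)) * (pr C - pr (C `&` B)),
      0 < cov A B & 0 < cov C B].
Proof.
move=> mA mB mC; have mAC := measurableI _ _ mA mC.
rewrite /conjunctive_fork /cond_prob -!/(pr _) prC // /cov.
have e (E : set T) : measurable E -> pr (E `&` ~` B) = pr E - pr (E `&` B).
  by move=> mE; rewrite [pr E in RHS](pr_split mE mB); ring.
rewrite !e //; move: (pr (A `&` C `&` B)) (pr (A `&` C)) (pr (A `&` B)) (pr (C `&` B)) (pr A) (pr B) (pr C) => abc ac ab bc a b c.
have gt_cov u v : 0 < b < 1 -> (v / b > (u - v) / (1 - b)) = (0 < v - u * b).
  move=> /andP[b0 b1]; have b1' : 0 < 1 - b by lra.
  rewrite ltr_pdivrMr // mulrAC ltr_pdivlMr // -subr_gt0.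
  by congr (0 < _); ring.
split=> -[h h1 h2 h3 h4]; have [b0 b1] := andP h; have b1' : 0 < 1 - b by lra.
- rewrite -!gt_cov //; split => //.
    by move: h1 => /(congr1 (fun z => z * b * b)); rewrite divfK ?gt_eqF // => ->; field; rewrite gt_eqF.
  by move: h2 => /(congr1 (fun z => z * (1 - b) * (1 - b))); rewrite divfK ?gt_eqF // => ->; field; rewrite gt_eqF.
- rewrite !gt_cov //; split => //.
    have -> : ab / b * (bc / b) = (ab * bc) / b / b by field; rewrite gt_eqF.
    by rewrite -h1 mulfK ?gt_eqF.
  have -> : (a - ab) / (1 - b) * ((c - bc) / (1 - b)) = ((a - ab) * (c - bc)) / (1 - b) / (1 - b) by field; rewrite gt_eqF.
  by rewrite -h2 mulfK ?gt_eqF.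
Qed.

Lemma covC A B : cov A B = cov B A.
Proof. by rewrite /cov setIC mulrC. Qed.

(** The two independence equations with weights 1 - P(B) and P(B) eliminate the probability of the
    triple intersection. *)
Lemma fork_cov A B C (mA : measurable A) (mB : measurable B) (mC : measurable C) : conjunctive_fork P A B C ->
  [/\ 0 < cov A B, 0 < cov C B & var B * cov A C = cov A B * cov C B].
Proof.
move=> /(forkE mA mB mC)[h h1 h2 h3 h4]; split => //.
have [b0 b1] := andP h; rewrite /var /cov; move: h1 h2.
move: (pr (A `&` C `&` B)) (pr (A `&` C)) (pr (A `&` B)) (pr (C `&` B)) (pr A) (pr B) (pr C) => abc ac ab bc a b c h1 h2.
have -> : b * (1 - b) * (ac - a * c) = (1 - b) * (abc * b) + b * ((ac - abc) * (1 - b)) - b * (1 - b) * (a * c) by ring.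
by rewrite h1 h2; ring.
Qed.

Lemma cov_pr A B (mA : measurable A) (mB : measurable B) : 0 < cov A B -> 0 < pr A < 1.
Proof.
rewrite /cov => h; have h1 := prI_le mA mB; have h2 := prI_le2 mA mB.
by have := pr_ge0 A; have := pr_ge0 B; have := pr_le1 mA; nra.
Qed.

(** Given A or its complement, A is trivial, so both independence equations hold by themselves. *)
Lemma fork_edge A C (mA : measurable A) (mC : measurable C) : conjunctive_fork P A A C <-> 0 < cov A C.
Proof.
split=> [/(forkE mA mA mC)[_ _ _ _]|h].
  by rewrite /cov setIC mulrC.
have hA := cov_pr mA mC h; apply/(forkE mA mA mC).
have e : A `&` C `&` A = A `&` C by rewrite setIC setIA setIid.
rewrite e setIid [C `&` A]setIC; split => //.
- by rewrite mulrC.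
- by rewrite !subrr !mul0r.
- by rewrite /cov setIid; have [] := andP hA; nra.
- by rewrite /cov setIC mulrC.
Qed.

(** The covariance is at most P(A)(1 - P(B)) and at most P(B)(1 - P(A)), and these bounds multiply
    to the product of the variances; equality makes both bounds sharp. *)
Lemma var_cov A B (mA : measurable A) (mB : measurable B) : 0 < cov A B -> cov A B ^+ 2 <= var A * var B /\
  (cov A B ^+ 2 = var A * var B -> pr (A `&` B) = pr A /\ pr (A `&` B) = pr B).
Proof.
move=> h; have hA := cov_pr mA mB h.
have hB : 0 < pr B < 1.
  move: h; rewrite /cov => h; have h1 := prI_le mA mB; have h2 := prI_le2 mA mB.
  by have := pr_ge0 A; have := pr_ge0 B; have := pr_le1 mB; nra.
have h1 := prI_le mA mB; have h2 := prI_le2 mA mB; move: h h1 h2 hA hB.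
rewrite /var /cov; move: (pr (A `&` B)) (pr A) (pr B) => p a b h h1 h2 /andP[a0 a1] /andP[b0 b1].
have c1 : p - a * b <= a * (1 - b) by nra.
have c2 : p - a * b <= b * (1 - a) by nra.
have u0 : 0 < a * (1 - b) by nra.
have v0 : 0 < b * (1 - a) by nra.
have eq : a * (1 - a) * (b * (1 - b)) = (a * (1 - b)) * (b * (1 - a)) by ring.
rewrite eq; split; first by rewrite expr2; apply: ler_pM => //; exact: ltW.
move=> e.
have e1 : p - a * b = a * (1 - b).
  apply/eqP; rewrite eq_le c1 /= leNgt; apply/negP => lt.
  have : (p - a * b) ^+ 2 < a * (1 - b) * (b * (1 - a)).
    rewrite expr2; apply: le_lt_trans (_ : _ <= (p - a * b) * (b * (1 - a))) _.
      by rewrite ler_pM2l.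
    by rewrite ltr_pM2r.
  by rewrite e ltxx.
have e2 : p - a * b = b * (1 - a).
  apply/eqP; rewrite eq_le c2 /= leNgt; apply/negP => lt.
  have : (p - a * b) ^+ 2 < a * (1 - b) * (b * (1 - a)).
    rewrite expr2; apply: le_lt_trans (_ : _ <= (a * (1 - b)) * (p - a * b)) _.
      by rewrite ler_pM2r.
    by rewrite ltr_pM2l.
  by rewrite e ltxx.
by split; lra.
Qed.

(** The conditional probabilities of A given B and given its complement are equal to their squares,
    hence 0 or 1, and their strict order makes them 1 and 0. *)
Lemma fork_same A B (mA : measurable A) (mB : measurable B) : conjunctive_fork P A B A <->
  0 < pr B < 1 /\ (pr (A `&` B) = pr A /\ pr (A `&` B) = pr B).
Proof.
have e : A `&` A `&` B = A `&` B by rewrite setIid.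
split=> [/(forkE mA mB mA)[h]|[h [h1 h2]]].
  rewrite e setIid /cov => h1 h2 h3 _; split => //.
  have hA := cov_pr mA mB (h3 : 0 < cov A B).
  have := pr_ge0 (A `&` B); have := prI_le mA mB; move: h h1 h2 h3 hA.
  move: (pr (A `&` B)) (pr A) (pr B) => p a b /andP[b0 b1] h1 h2 h3 /andP[a0 a1] pa p0.
  have p1 : 0 < p by nra.
  have pb : p = b by apply: (mulfI (lt0r_neq0 p1)).
  split => //; apply/eqP; rewrite eq_sym -subr_eq0; apply/eqP.
  by apply: (mulIf (_ : 1 - b - (a - p) != 0)); [rewrite gt_eqF //; lra|lra].
apply/(forkE mA mB mA); rewrite e setIid /cov -h1 -h2; have [] := andP h.
by rewrite -h2 => *; split; [exact/andP| ring|ring|nra|nra].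
Qed.

(** A and A' differ by a null set. *)
Lemma same_pr A A' X : measurable A -> measurable A' -> measurable X ->
  pr (A `&` A') = pr A -> pr (A `&` A') = pr A' -> pr (A `&` X) = pr (A' `&` X).
Proof.
move=> mA mA' mX h1 h2.
suff half (E F : set T) : measurable E -> measurable F -> pr (E `&` F) = pr E ->
    pr (E `&` X) = pr (E `&` F `&` X).
  by rewrite (half A A') // (half A' A) // ![A' `&` A]setIC // h2.
move=> mE mF h; have mEX := measurableI _ _ mE mX.
rewrite (pr_split mEX mF) setIAC [E `&` X `&` F]setIAC.
have mEF : measurable (E `&` ~` F) by apply: measurableI => //; exact: measurableC.
have := prI_le mEF mX; have := pr_ge0 (E `&` ~` F `&` X); have := pr_split mE mF.
by rewrite h => e1 e2 e3; lra.
Qed.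

Lemma fork_sym A B C : conjunctive_fork P A B C -> conjunctive_fork P C B A.
Proof. by move=> [h h1 h2 h3 h4]; split; rewrite // setIC // mulrC. Qed.

Lemma same_fork A A' B C : measurable A -> measurable A' -> measurable B -> measurable C ->
  conjunctive_fork P A B C -> conjunctive_fork P A A' A -> conjunctive_fork P A' B C.
Proof.
move=> mA mA' mB mC hf /(fork_same mA mA')[_ [h1 h2]].
have s := same_pr mA mA' _ h1 h2; apply/(forkE mA' mB mC).
move/(forkE mA mB mC): hf; rewrite /cov -![A `&` C `&` B]setIA -![A' `&` C `&` B]setIA.
by rewrite -!s -?h1 -?h2 ?h1 //; exact: measurableI.
Qed.

Lemma same_fork_mid A B B' C : measurable A -> measurable B -> measurable B' -> measurable C ->
  conjunctive_fork P A B C -> conjunctive_fork P B B' B -> conjunctive_fork P A B' C.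
Proof.
move=> mA mB mB' mC hf /(fork_same mB mB')[_ [h1 h2]].
have s := same_pr mB mB' _ h1 h2; apply/(forkE mA mB' mC).
move/(forkE mA mB mC): hf; rewrite /cov ![_ `&` B]setIC ![_ `&` B']setIC.
by rewrite -!s -?h2 ?h1 //; exact: measurableI.
Qed.

End ForkFacts.

(** * Necessity: closure rules and logarithmic lengths *)

Section Necessity.
Variables (R : realType) (N : finType) (r : {set N * N * N}).
Variables (d : measure_display) (T : measurableType d) (P : probability T R) (A : N -> set T).
Hypothesis mA : forall i, measurable (A i).
Hypothesis rA : forall i j k, (i, j, k) \in r <-> conjunctive_fork P (A i) (A j) (A k).

Lemma representable_fork_axioms : fork_axioms r.
Proof.
split.
- move=> i j k /rA h; have [h1 h2 h3] := fork_cov (mA i) (mA j) (mA k) h.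
  have [hj _ _ _ _] := h.
  split; apply/rA; first exact: fork_sym.
    by apply/fork_edge.
  apply/fork_edge => //.
  have vj : 0 < var P (A j) by rewrite /var; move: hj; rewrite -/(pr P (A j)); nra.
  by rewrite -(pmulr_rgt0 _ vj) h3 mulr_gt0.
- move=> i j /rA/fork_same => /(_ (mA i) (mA j))[h [h1 h2]].
  by apply/rA/fork_same => //; rewrite setIC -h1 h2.
- by move=> i j k l /rA h /rA h'; apply/rA; apply: (same_fork _ _ _ _ h h').
- by move=> i j k l /rA h /rA h'; apply/rA; apply: (same_fork_mid _ _ _ _ h h').
Qed.

Let c i j := cov P (A i) (A j).
Let v i := var P (A i).

(** Pairs that enter no equation get the arbitrary positive value 1. *)
Definition log_length i j : R :=
  if ((i, i, j) \in r) && apart r i j then ln (v i * v j / c i j ^+ 2) else 1.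

Lemma cov_sym i j : c i j = c j i.
Proof. exact: covC. Qed.

Lemma edge_cov i j : (i, i, j) \in r -> 0 < c i j.
Proof. by move=> /rA/fork_edge; apply. Qed.

Lemma edge_var i j : 0 < c i j -> 0 < v i.
Proof. by move=> /(cov_pr (mA i) (mA j)); rewrite /v /var; nra. Qed.

Lemma edge_sym i j : (i, i, j) \in r -> (j, j, i) \in r.
Proof. by move=> /edge_cov h; apply/rA/fork_edge => //; rewrite -/(c j i) cov_sym. Qed.

(** Equality in [var_cov] would make the two events almost surely equal, against [apart]. *)
Lemma log_length_gt0 i j : 0 < log_length i j.
Proof.
rewrite /log_length; case: ifP => // /andP[he /andP[_ ns]]; apply: ln_gt0.
have h := edge_cov he; have [h1 h2] := var_cov (mA i) (mA j) h.
rewrite ltr_pdivlMr ?exprn_gt0 // mul1r lt_neqAle h1 andbT.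
apply/negP => /eqP /h2 hs; move/negP: ns; apply; apply/rA/fork_same => //; split => //.
by apply: (cov_pr (mA j) (mA i)); rewrite -/(c j i) cov_sym.
Qed.

Lemma log_length_additive : additive_on r log_length.
Proof.
split=> [i j|i j k hr aij ajk aik].
  rewrite /log_length; have -> : ((i, i, j) \in r) && apart r i j = ((j, j, i) \in r) && apart r j i.
    have [_ sy _ _] := representable_fork_axioms; rewrite /apart eq_sym.
    have -> : ((i, j, i) \in r) = ((j, i, j) \in r) by apply/idP/idP; apply: sy.
    by congr andb; apply/idP/idP; apply: edge_sym.
  by rewrite [v i * _]mulrC [c i j]cov_sym.
have [ax _ _ _] := representable_fork_axioms.
have [hr' eij eik] := ax _ _ _ hr.
have ejk : (j, j, k) \in r by have [_ + _] := ax _ _ _ hr'; apply: edge_sym.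
rewrite /log_length eij aij ejk ajk eik aik /=.
have cij := edge_cov eij; have cjk := edge_cov ejk; have cik := edge_cov eik.
have vi := edge_var cij; have vj := edge_var cjk.
have vk : 0 < v k by apply: (@edge_var k i); rewrite cov_sym.
have pos (u w z : R) : 0 < u -> 0 < w -> 0 < z -> u * w / z ^+ 2 \is Num.pos.
  by move=> u0 w0 z0; rewrite posrE divr_gt0 ?mulr_gt0 ?exprn_gt0.
rewrite -lnM ?pos //; congr (ln _).
have [_ _] := fork_cov (mA i) (mA j) (mA k) (proj1 (rA i j k) hr).
rewrite -/(c i k) -/(c i j) -/(v j) -/(c k j) [c k j]cov_sym => e.
(* Once the fork identity has eliminated c i k, the arguments of the logarithms agree. *)
have -> : c i k = c i j * c j k / v j by rewrite -e; field; rewrite gt_eqF.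
by field; rewrite !gt_eqF.
Qed.

End Necessity.

(** * Finite probability spaces *)

Section FiniteSpace.
Variables (R : realType) (Om : finType) (w : Om -> R).
Hypotheses (w0 : forall o, 0 <= w o) (w1 : \sum_o w o = 1).

(** Outcomes are numbered so that the measure lives on [nat], all of whose subsets are measurable;
    numbers from [#|Om|] on weigh 0. *)
Definition weight (k : nat) : R :=
  if @idP (k < #|Om|)%N is ReflectT h then w (enum_val (Ordinal h)) else 0.

Lemma weight_ge0 k : 0 <= weight k.
Proof. by rewrite /weight; case: {-}_ / idP. Qed.

Definition finite_measure : set nat -> \bar R :=
  msum (fun k => mscale (NngNum (weight_ge0 k)) (dirac k)) #|Om|.

HB.instance Definition _ := Measure.copy finite_measure
  (msum (fun k => mscale (NngNum (weight_ge0 k)) (dirac k)) #|Om|).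

Lemma weight_ord (i : 'I_#|Om|) : weight i = w (enum_val i).
Proof.
rewrite /weight; case: {-}_ / idP => [h|]; last by rewrite ltn_ord.
by congr (w (enum_val _)); apply: val_inj.
Qed.

Definition event (S : pred Om) : set nat :=
  [set t | exists2 i : 'I_#|Om|, t = i :> nat & S (enum_val i)].

Lemma eventI S S' : event S `&` event S' = event (predI S S').
Proof.
apply/seteqP; split=> [t [[i -> Si] [j /val_inj <- Sj]]|t [i -> /andP[h1 h2]]].
  by exists i => //; apply/andP.
by split; exists i.
Qed.

Lemma finite_measureE S : finite_measure (event S) = (\sum_(o | S o) w o)%:E.
Proof.
rewrite /finite_measure /msum (reindex (@enum_val _ Om)) /=; last first.
  exact: onW_bij (enum_val_bij _).
rewrite [in RHS]big_mkcond -sumEFin /=; apply: eq_bigr => i _.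
rewrite /mscale /= weight_ord diracE -EFinM.
have -> : (i : nat) \in event S = S (enum_val i).
  apply/idP/idP => [|h]; last by rewrite inE; exists i.
  by rewrite inE => -[j /val_inj <-].
by case: ifP => _; rewrite ?mulr1 ?mulr0.
Qed.

Lemma finite_measureT : finite_measure setT = 1%E.
Proof.
rewrite /finite_measure /msum -w1 (reindex (@enum_val _ Om)) /=; last first.
  exact: onW_bij (enum_val_bij _).
by rewrite -sumEFin; apply: eq_bigr => i _; rewrite /mscale /= weight_ord diracT mule1.
Qed.

#[local] HB.instance Definition _ :=
  @Measure_isProbability.Build _ _ R finite_measure finite_measureT.

Lemma finite_probability : exists P : probability nat R,
  forall S, pr P (event S) = \sum_(o | S o) w o.
Proof. by exists finite_measure => S; exact: (congr1 fine (finite_measureE S)). Qed.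

End FiniteSpace.

Lemma additive_representable (R : realType) (N : finType) (r : {set N * N * N}) (x : N -> N -> nat) :
  fork_axioms r -> (forall i j, (0 < x i j)%N) -> additive_on r x -> fork_representable R r.
Proof.
move=> ax x0 xadd; pose f : {set N} -> R := spectrum R r x.
have f0 : f finset.set0 = 1 := spectrum0 R r x.
have f_small U : U != finset.set0 -> `|f U| <= ((2 ^ #|N|)%:R)^-1.
  exact: spectrum_small.
have f1 a : f [set a]%SET = 0 := spectrum1 R r x a.
have [P prP] := finite_probability (density_ge0 f0 f_small) (density_sum f0).
pose ev i := event (fun o : {set N} => rep r i \in o).
(* The empty event has probability 0 and covariance 0 with every event, so it occurs in no fork,
   just as an index that is not live. *)
pose A i := if live r i then ev i else set0.
have mA i : measurable (A i) by [].
exists _, nat, P, A; split=> // i j k.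
have A0 i' : ~~ live r i' -> A i' = set0 by rewrite /A => /negPf ->.
have pr0 : pr P set0 = 0 by rewrite /pr measure0.
rewrite (mem_walsh_fork R ax x0 xadd) forkE //.
have [hi|/A0 ei] := boolP (live r i); last first.
  by split=> [[]//|[_ _ _]]; rewrite /cov ei set0I pr0 mul0r subrr ltxx.
have [hk|/A0 ek] := boolP (live r k); last first.
  by split=> [[]//|[_ _ _ _]]; rewrite /cov ek set0I pr0 mul0r subrr ltxx.
have [hj|/A0 ej] := boolP (live r j); last first.
  by split=> [[]//|[]]; rewrite ej pr0 ltxx.
have -> : A i = ev i by rewrite /A hi.
have -> : A j = ev j by rewrite /A hj.
have -> : A k = ev k by rewrite /A hk.
have p1 l : pr P (ev l) = 1 / 2 by rewrite prP; exact: prob1.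
have p2 l m : pr P (ev l `&` ev m) = (1 + corr f (rep r l) (rep r m)) / 4.
  by rewrite eventI prP; exact: prob2.
rewrite /cov !p1 !p2 !eventI prP.
under eq_bigl do rewrite /= -andbA.
rewrite (prob3 f0 f1) /walsh_fork (corr_sym _ (rep r k)).
move: (corr f _ _) (corr f _ _) (corr f _ _) (triple_moment f _ _ _) => u v w m.
split=> [[_ _ _ [hu hv e e']]|[_ e e' hu hv]].
  by split; [apply/andP; split| | | |]; lra.
by do 2?split=> //; lra.
Qed.

Theorem mainTheorem2 (R : realType) :
  exists (M : turing_machine) (p : {poly nat}),
    forall (N : finType) (r : {set N * N * N}) (s : seq (N * N * N)),
      uniq s -> s =i r ->
      decides_within M (encode_relation s) p.[#|N|] (fork_representable R r).
Proof.
have [M [p decM]] := decision_machine; exists M, p => N r s us sr.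
apply: decM => //; rewrite decide_bits_encode.
set T := rev _.
have rT i j k : ((rank i, rank j, rank k) \in T) = ((i, j, k) \in r).
  by rewrite mem_rev -sr -(mem_map (@ranks_inj N) s (i, j, k)).
have T_ranks t : t \in T -> exists i j k : N, t = (rank i, rank j, rank k).
  by rewrite mem_rev => /mapP[[[i j] k] _ ->]; exists i, j, k.
split=> [/(decide_sound rT T_ranks)[ax [x x0 xadd]]|]; first exact: additive_representable xadd.
case=> [d [S [P [A [mA rA]]]]].
have xadd := log_length_additive mA rA.
apply: (decide_complete rT T_ranks) xadd => //.
  exact: (representable_fork_axioms mA rA).
exact: log_length_gt0.
Qed.
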